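(* Let $V$ be a finite dimensional complex Hilbert space. Consider the standard representation of the unitary group $U(V)$ on $V$ and the contragredient representation on the dual Hilbert space $V^*$. Let $T_i\in (V^* )^{\otimes m_i}\otimes V^{\otimes n_i}$, $i\in I$, be a collection of tensors, and let $K\subset U(V)$ be the closed subgroup stabilizing all the tensors $T_i$. Then the monoidal category $\operatorname{Rep} K$ of finite dimensional complex representations of $K$ is generated by $V$ and $V^*$ and the following morphisms: (a) the flip $\sigma\colon V\otimes V\to V\otimes V$; (b) the morphisms $r\colon \mathbb{C}\to V^*\otimes V$, $r(1)=\sum_k e^k\otimes e_k$, and $\bar r\colon\mathbb{C}\to V\otimes V^*$, $\bar r(1)=\sum_k e_k\otimes e^k$, and their Hermitian adjoints, where $\{e_k\}_k$ is a basis in $V$ and $\{e^k\}_k$ is the dual basis in $V^*$; (c) the tensors $T_i$, viewed as morphisms $\mathbb{C}\to (V^* )^{\otimes m_i}\otimes V^{\otimes n_i}$, and their Hermitian adjoints. In other words, any irreducible representation of $K$ appears as a subrepresentation of a tensor product of the representations on $V$ and $V^*$, and any $K$-intertwiner between such tensor products can be written as a linear combination of compositions of morphisms of the form $\iota\otimes\dots\otimes\iota\otimes f\otimes\iota\otimes\dots\otimes\iota$, where $f$ is one of the morphisms $\sigma$, $r$, $r^*$, $\bar r$, $\bar r^*$, $T_i$, $T_i^*$ ($i\in I$), with $^*$ denoting the Hermitian adjoint.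
   Context: The Hermitian scalar product on $V^*$ is defined so that the dual basis of an orthonormal basis of $V$ is orthonormal; tensor products carry the tensor product scalar products, and adjoints are Hermitian adjoints with respect to these. Each $\iota$ denotes the identity map of $V$ or of $V^*$. ''Tensor products of $V$ and $V^*$'' means tensor products of finitely many copies of $V$ and $V^*$ in all possible orders (the empty product being $\mathbb{C}$). *)

(* Defs.v *)
From HB Require Import structures.
From mathcomp Require Import all_boot all_order all_algebra.
From mathcomp Require Import complex.
From mathcomp Require Import boolp classical_sets reals topology normedtype.

Set Implicit Arguments.
Unset Strict Implicit.
Unset Printing Implicit Defensive.

Import Order.TTheory GRing.Theory Num.Theory.
Import numFieldNormedType.Exports.
Import passmx.

Local Open Scope classical_set_scope.
Local Open Scope ring_scope.

(* Going through [numClosedFieldType] gives R[i] its usual topology. *)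
Definition Cplx (R : realType) : numClosedFieldType := R[i]%C.

Lemma linfunE (F : fieldType) (X Y : vectType F) (f : X -> Y) :
  linear f -> linfun f =1 f.
Proof.
move=> lin x.
pose g := HB.pack_for {linear X -> Y} f
  (GRing.isSemilinear.Build _ _ _ _ f (GRing.semilinear_linear lin)).
by rewrite -[linfun f]/(linfun g) lfunE.
Qed.

Definition lswap (F : fieldType) (X Y Z : vectType F) :
    'Hom('Hom(X, 'Hom(Y, Z)), 'Hom(Y, 'Hom(X, Z))) :=
  linfun (fun S : 'Hom(X, 'Hom(Y, Z)) =>
    linfun (fun y : Y => linfun (fun x : X => S x y))).

Lemma lswapE (F : fieldType) (X Y Z : vectType F) (S : 'Hom(X, 'Hom(Y, Z)))
  x y : lswap X Y Z S y x = S x y.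
Proof.
have lin1 (Q : 'Hom(X, 'Hom(Y, Z))) y' : linear (fun x' => Q x' y').
  by move=> a u v; rewrite linearP add_lfunE scale_lfunE.
have lin2 (Q : 'Hom(X, 'Hom(Y, Z))) :
    linear (fun y => linfun (fun x => Q x y)).
  move=> a u v; apply/lfunP => x'.
  by rewrite add_lfunE scale_lfunE !(linfunE (lin1 _ _)) linearP.
rewrite /lswap linfunE ?(linfunE (lin2 _)) ?(linfunE (lin1 _ _)) // => a Q Q'.
apply/lfunP => y'; rewrite add_lfunE scale_lfunE !(linfunE (lin2 _)).
apply/lfunP => x'; rewrite add_lfunE scale_lfunE !(linfunE (lin1 _ _)).
by rewrite !(add_lfunE, scale_lfunE).
Qed.

(* As everywhere in the library, scalar products are linear in their first
   argument and conjugate-linear in the second one. *)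
Structure hilbert (R : realType) := Hilbert {
  hilbert_sort :> vectType (Cplx R);
  hdot : {dot hilbert_sort for Num.conj} }.
Arguments hdot {R h}.

Section MakeDot.
Variables (R : realType) (X : vectType (Cplx R)) (f : X -> X -> Cplx R).
Hypothesis f_lin : forall z, linear_for *%R (f ^~ z).
Hypothesis f_herm : forall x y, f x y = (f y x)^*.
Hypothesis f_pos : forall x, x != 0 -> 0 < f x x.

Definition mkdot_fun : X -> X -> Cplx R := f.

Fact mkdot_bilinear : bilinear_for
  (GRing.Scale.Law.clone _ _ ( *%R ) _)
  (GRing.Scale.Law.clone _ _ (Num.conj \; *%R ) _) mkdot_fun.
Proof.
split=> [z|z] a x y /=; rewrite /mkdot_fun ?f_lin //.
by rewrite f_herm f_lin rmorphD rmorphM /= -!f_herm.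
Qed.

Fact mkdot_herm x y : mkdot_fun x y = (-1) ^+ false * (mkdot_fun y x)^*.
Proof. by rewrite expr0 mul1r; apply: f_herm. Qed.

HB.instance Definition _ := bilinear_isBilinear.Build _ _ _ _
  (GRing.Scale.Law.clone _ _ ( *%R ) _)
  (GRing.Scale.Law.clone _ _ (Num.conj \; *%R ) _)
  mkdot_fun mkdot_bilinear.
HB.instance Definition _ :=
  isHermitianSesquilinear.Build _ _ _ _ mkdot_fun mkdot_herm.
HB.instance Definition _ := isDotProduct.Build _ _ mkdot_fun f_pos.

Definition mkdot : {dot X for Num.conj} := mkdot_fun.
End MakeDot.

Section OrthonormalBasis.
Variables (R : realType) (X : hilbert R).
Local Notation C := (Cplx R).

Definition orthonormal_basis (e : (\dim {:X}).-tuple X) :=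
  basis_of {:X} e && orthonormal hdot e.

Lemma orthonormal_span (s : seq X) :
  exists2 t : seq X, orthonormal hdot t & <<t>>%VS = <<s>>%VS.
Proof.
elim: s => [|x s [t ot ts]]; first by exists [::].
have [y yt [z [xE _ zt]]] := orthogonal_split hdot t x.
have [z0|z0] := eqVneq z 0.
  exists t => //; rewrite span_cons -ts xE z0 addr0.
  by apply/esym/addv_idPr; rewrite -memvE.
have zz : hdot z z != 0 by rewrite dnorm_eq0.
set c := (sqrtC (hdot z z))^-1.
have c0 : c != 0 by rewrite invr_eq0 sqrtC_eq0.
exists (c *: z :: t); last first.
  rewrite !span_cons ts; apply/eqP; rewrite eqEsubv !subv_add !addvSr !andbT.
  apply/andP; split.
    rewrite -memvE memvZ // -[z](addKr y) -xE memvD ?memvN //.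
      by apply: (subvP (addvSr _ _)); rewrite -ts.
    by apply: (subvP (addvSl _ _)); apply: memv_line.
  rewrite -memvE xE memvD //.
    by apply: (subvP (addvSr _ _)); rewrite -ts.
  apply: (subvP (addvSl _ _)).
  by apply/vlineP; exists c^-1; rewrite scalerK.
rewrite -cat1s orthonormal_cat ot; apply/and3P; split => //.
  rewrite /orthonormal /= !andbT dnormZ normfV exprVn ger0_norm ?sqrtC_ge0 ?dnorm_ge0 //.
  by rewrite sqrtCK mulVf.
apply/orthoPl => w wt; rewrite linearZl_LR /=.
by move/orthoPl: zt => -> //; rewrite mulr0.
Qed.

Lemma orthonormal_basis_exists : exists e, orthonormal_basis e.
Proof.
have [t ot tE] := orthonormal_span (vbasis {:X}).
have st : size t == \dim {:X}.
  rewrite -(eqP (orthonormal_free ot)) tE.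
  by rewrite (span_basis (vbasisP _)).
exists (Tuple st); rewrite /orthonormal_basis ot andbT basisEfree /=.
by rewrite (orthonormal_free ot) subvf (eqP st) leqnn.
Qed.

Definition onb : (\dim {:X}).-tuple X :=
  xget (vbasis fullv) [set e | orthonormal_basis e].

Lemma onbP : orthonormal_basis onb.
Proof. exact: (xgetPex _ orthonormal_basis_exists). Qed.

Lemma hdot_coord e (he : orthonormal_basis e) i x :
  coord e i x = hdot x e`_i.
Proof.
have /andP[be oe] := he.
rewrite [x in RHS](coord_basis be) ?memvf // linear_sumlz (bigD1 i) //= big1.
  rewrite addr0 linearZl_LR /=; have [_ ->] := orthonormalP oe.
  - by rewrite eqxx mulr1.
  - by rewrite mem_nth ?size_tuple.
  - by rewrite mem_nth ?size_tuple.
move=> j ji; rewrite linearZl_LR /=; have [ue ->] := orthonormalP oe.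
- by rewrite nth_uniq ?size_tuple // (inj_eq val_inj) (negPf ji) mulr0.
- by rewrite mem_nth ?size_tuple.
- by rewrite mem_nth ?size_tuple.
Qed.

Lemma onb_sum (x : X) : x = \sum_(i < \dim {:X}) hdot x onb`_i *: onb`_i.
Proof.
have /andP[be _] := onbP.
rewrite [x in LHS](coord_basis be) ?memvf //.
by apply: eq_bigr => i _; rewrite (hdot_coord onbP).
Qed.

Lemma parseval (x y : X) : hdot x y = \sum_(i < \dim {:X}) hdot x onb`_i * (hdot y onb`_i)^*.
Proof.
rewrite [in LHS](onb_sum x) linear_sumlz; apply: eq_bigr => i _.
by rewrite linearZl_LR /=; congr (_ * _); rewrite hermC expr0 mul1r.
Qed.
End OrthonormalBasis.

Section Adjoint.
Variables (R : realType) (X Y : hilbert R).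

(* The Hermitian adjoint: see [adjE]. *)
Definition adj (f : 'Hom(X, Y)) : 'Hom(Y, X) :=
  linfun (fun y => \sum_(i < \dim {:X}) hdot y (f (onb X)`_i) *: (onb X)`_i).

Lemma adjE (f : 'Hom(X, Y)) x y : hdot (f x) y = hdot x (adj f y).
Proof.
rewrite /adj linfunE; last first.
  move=> a u v; rewrite scaler_sumr -big_split; apply: eq_bigr => i _ /=.
  by rewrite linearPl scalerDl scalerA.
rewrite {1}(onb_sum x) linear_sum linear_sumlz linear_sumr.
apply: eq_bigr => i _; rewrite linearZ linearZl_LR linearZr_LR /= mulrC.
by congr (_ * _); rewrite [LHS]hermC expr0 mul1r.
Qed.
End Adjoint.

Section Constructions.
Variable R : realType.
Local Notation C := (Cplx R).

Definition cform (x y : C^o) : C := (x : C) * (y : C)^*.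

Fact cform_lin z : linear_for *%R (cform ^~ z).
Proof. by move=> a x y; rewrite /cform mulrDl mulrA. Qed.

Fact cform_herm x y : cform x y = (cform y x)^*.
Proof. by rewrite /cform rmorphM /= conjCK mulrC. Qed.

Fact cform_pos x : x != 0 -> 0 < cform x x.
Proof. by move=> x0; rewrite /cform mul_conjC_gt0. Qed.

Definition unit_hilbert : hilbert R :=
  Hilbert (mkdot cform_lin cform_herm cform_pos).

Variable X : hilbert R.
Local Notation "X ^*v" := ('Hom(X, C^o)) (at level 2).

Definition dual_basis (e : (\dim {:X}).-tuple X) (i : 'I_(\dim {:X})) : X^*v :=
  linfun (coord e i : X -> C^o).

(* The scalar product of V^* for which the basis dual to an orthonormal basis
   of V is orthonormal, see [dual_orthonormal]. *)
Definition dual_form (phi psi : X^*v) : C :=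
  \sum_(i < \dim {:X}) (phi (onb X)`_i : C) * (psi (onb X)`_i : C)^*.

Fact dual_form_lin z : linear_for *%R (dual_form ^~ z).
Proof.
move=> a x y; rewrite /dual_form mulr_sumr -big_split.
by apply: eq_bigr => i _ /=; rewrite !lfunE /= lfunE mulrDl mulrA.
Qed.

Fact dual_form_herm x y : dual_form x y = (dual_form y x)^*.
Proof.
rewrite /dual_form rmorph_sum; apply: eq_bigr => i _.
by rewrite rmorphM /= conjCK mulrC.
Qed.

Fact dual_form_pos x : x != 0 -> 0 < dual_form x x.
Proof.
move=> x0; rewrite lt_neqAle sumr_ge0 ?andbT => [|i _]; last exact: mul_conjC_ge0.
apply: contra_neq x0 => /esym/psumr_eq0P s0; apply/lfunP => v.
rewrite (onb_sum v) !linear_sum; apply: eq_bigr => i _; rewrite !linearZ /=.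
congr (_ *: _); rewrite lfunE; apply/eqP; rewrite -mul_conjC_eq0; apply/eqP.
by apply: s0 => // j _; apply: mul_conjC_ge0.
Qed.

Definition dual_hilbert : hilbert R :=
  Hilbert (mkdot dual_form_lin dual_form_herm dual_form_pos).

Variable Y : hilbert R.

(* The tensor product X (x) Y of finite dimensional spaces, realized as the
   space of linear maps X^* -> Y; [pure x y] is the elementary tensor. *)
Local Notation tensor_space := ('Hom(X^*v, Y)).

Definition pure (x : X) (y : Y) : tensor_space :=
  linfun (fun phi : X^*v => (phi x : C) *: y).

(* Contracting with the basis dual to an orthonormal basis of X; this is the
   tensor product scalar product by [hdot_pure]. *)
Definition tensor_form (S T : tensor_space) : C :=
  \sum_(i < \dim {:X})
     hdot (S (dual_basis (onb X) i)) (T (dual_basis (onb X) i)).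

Fact tensor_form_lin z : linear_for *%R (tensor_form ^~ z).
Proof.
move=> a x y; rewrite /tensor_form mulr_sumr -big_split.
by apply: eq_bigr => i _ /=; rewrite !lfunE /= lfunE linearPl.
Qed.

Fact tensor_form_herm x y : tensor_form x y = (tensor_form y x)^*.
Proof.
rewrite /tensor_form rmorph_sum; apply: eq_bigr => i _.
by rewrite hermC expr0 mul1r.
Qed.

Lemma dual_basisE e i x : dual_basis e i x = coord e i x.
Proof. by rewrite linfunE // => a u v; rewrite linearP. Qed.

Lemma dual_basis_sum (e : (\dim {:X}).-tuple X) (he : basis_of {:X} e) (phi : X^*v) :
  phi = \sum_(i < \dim {:X}) (phi e`_i : C) *: dual_basis e i.
Proof.
apply/lfunP => v; rewrite sum_lfunE [v in LHS](coord_basis he) ?memvf //.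
rewrite linear_sum; apply: eq_bigr => i _.
by rewrite linearZ scale_lfunE dual_basisE /= [LHS]mulrC.
Qed.

Fact tensor_form_pos x : x != 0 -> 0 < tensor_form x x.
Proof.
move=> x0; rewrite lt_neqAle sumr_ge0 ?andbT => [|i _]; last exact: dnorm_ge0.
apply: contra_neq x0 => /esym/psumr_eq0P s0; apply/lfunP => v.
have /andP[be _] := onbP X.
rewrite (dual_basis_sum be v) !linear_sum; apply: eq_bigr => i _.
rewrite !linearZ /=; congr (_ *: _); rewrite lfunE; apply/eqP.
rewrite -(dnorm_eq0 hdot); apply/eqP.
by apply: s0 => // j _; apply: dnorm_ge0.
Qed.

Definition tensor_hilbert : hilbert R :=
  Hilbert (mkdot tensor_form_lin tensor_form_herm tensor_form_pos).

Lemma dual_orthonormal (e : (\dim {:X}).-tuple X) i j :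
  orthonormal_basis e ->
  hdot (dual_basis e i : dual_hilbert) (dual_basis e j) = (i == j)%:R.
Proof.
move=> he; rewrite [LHS]/(dual_form _ _) /dual_form.
transitivity (hdot e`_j e`_i); last first.
  have /andP[_ oe] := he; have [ue ->] := orthonormalP oe.
  - by rewrite nth_uniq ?size_tuple // (inj_eq val_inj) eq_sym.
  - by rewrite mem_nth ?size_tuple.
  - by rewrite mem_nth ?size_tuple.
rewrite parseval; apply: eq_bigr => k _.
rewrite !dual_basisE !hdot_coord // mulrC.
by congr (_ * _); rewrite hermC expr0 mul1r //= conjCK.
Qed.

Lemma pureE x y (phi : X^*v) : pure x y phi = (phi x : C) *: y.
Proof.
by rewrite linfunE // => a u v; rewrite add_lfunE scale_lfunE scalerDl scalerA.
Qed.

Lemma hdot_pure x y x' y' :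
  hdot (pure x y : tensor_hilbert) (pure x' y') = hdot x x' * hdot y y'.
Proof.
rewrite [LHS]/(tensor_form _ _) /tensor_form parseval mulr_suml.
apply: eq_bigr => i _; rewrite !pureE !dual_basisE !(hdot_coord (onbP X)).
by rewrite linearZl_LR linearZr_LR /= mulrA.
Qed.

Lemma tensor_sum (S : tensor_space) :
  S = \sum_(i < \dim {:X}) pure (onb X)`_i (S (dual_basis (onb X) i)).
Proof.
apply/lfunP => phi; have /andP[be _] := onbP X.
rewrite [phi in LHS](dual_basis_sum be) linear_sum sum_lfunE.
by apply: eq_bigr => i _; rewrite linearZ pureE.
Qed.

End Constructions.

Section TensorMap.
Variables (R : realType) (X X' Y Y' : hilbert R).
Local Notation C := (Cplx R).

(* f (x) g in the model above: see [tensor_map_pure]. *)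
Definition tensor_map (f : 'Hom(X, X')) (g : 'Hom(Y, Y')) :
    'Hom(tensor_hilbert X Y, tensor_hilbert X' Y') :=
  linfun (fun S : 'Hom('Hom(X, C^o), Y) =>
    g \o S \o linfun (fun phi : 'Hom(X', C^o) => phi \o f))%VF.

Lemma tensor_map_pure f g x y :
  tensor_map f g (pure x y) = pure (f x) (g y).
Proof.
rewrite /tensor_map linfunE => [|a u v]; last first.
  by apply/lfunP => phi; do !rewrite ?lfunE /=; rewrite linearP.
apply/lfunP => phi; rewrite !comp_lfunE !pureE linfunE => [|a u v]; last first.
  by rewrite comp_lfunDl comp_lfunZl.
by rewrite comp_lfunE linearZ.
Qed.
End TensorMap.

Variant letter := std | dual.

Section Words.
Variables (R : realType) (V : hilbert R).
Local Notation C := (Cplx R).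

Definition letter_space (l : letter) : hilbert R :=
  if l is std then V else dual_hilbert V.

Fixpoint tens (w : seq letter) : hilbert R :=
  if w is l :: w' then tensor_hilbert (letter_space l) (tens w')
  else unit_hilbert R.

(* x (x) y, up to the canonical associativity isomorphisms *)
Fixpoint tcat (u v : seq letter) : tens u -> tens v -> tens (u ++ v) :=
  match u return tens u -> tens v -> tens (u ++ v) with
  | [::] => fun c y => (c : C) *: y
  | l :: u' => fun S y =>
      linfun (fun phi : 'Hom(letter_space l, C^o) =>
        @tcat u' v ((S : 'Hom('Hom(letter_space l, C^o), tens u')) phi) y)
  end.

Lemma tcat_linearl u v y : linear (fun x => @tcat u v x y).
Proof.
elim: u => [|l u IH] a x x' /=; first by rewrite scalerDl scalerA.
have lin (S : 'Hom('Hom(letter_space l, C^o), tens u)) :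
    linear (fun phi => tcat (S phi) y).
  by move=> b phi psi; rewrite linearP IH.
apply/lfunP => phi; rewrite add_lfunE scale_lfunE.
by rewrite (linfunE (lin _)) (linfunE (lin x)) (linfunE (lin x')) add_lfunE scale_lfunE IH.
Qed.

Lemma tcat_pure l u v (x : letter_space l) (y : tens u) (z : tens v) :
  @tcat (l :: u) v (pure x y) z = pure x (tcat y z).
Proof.
apply/lfunP => phi /=; rewrite linfunE => [|a ? ?]; last first.
  by rewrite linearP tcat_linearl.
rewrite !pureE; have := tcat_linearl z (phi x) y 0.
by rewrite !addr0 => ->; have := tcat_linearl z (-1) y y; rewrite scaleN1r addNr => -> ; rewrite scaleN1r addNr addr0.
Qed.

Lemma tcat_linearr u v x : linear (@tcat u v x).
Proof.
elim: u x => [|l u IH] x a y y' /=; first by rewrite scalerDr !scalerA mulrC.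
have lin z : linear (fun phi => @tcat u v (x phi) z).
  by move=> b phi psi; rewrite linearP tcat_linearl.
apply/lfunP => phi; rewrite add_lfunE scale_lfunE.
by rewrite !(linfunE (lin _)) IH.
Qed.

Lemma tcat_ext u v (Z : vectType C) (F G : 'Hom(tens (u ++ v), Z)) :
  (forall x y, F (tcat x y) = G (tcat x y)) -> F = G.
Proof.
elim: u F G => [|l u IH] F G FG.
  by apply/lfunP => y; have := FG (1 : C^o) y; rewrite /= scale1r.
apply/lfunP => S; rewrite (tensor_sum S) !linear_sum.
apply: eq_bigr => i _; set x := _`_i.
have lin : linear (fun z : tens (u ++ v) => pure x z).
  move=> a z z'; apply/lfunP => phi.
  by rewrite add_lfunE scale_lfunE !pureE scalerDr !scalerA mulrC.
have FGx : (F \o linfun (fun z : tens (u ++ v) => pure x z) =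
           G \o linfun (fun z : tens (u ++ v) => pure x z))%VF.
  by apply: IH => y z; rewrite !comp_lfunE !(linfunE lin) -!tcat_pure FG.
by have := congr1 (fun h : 'Hom(_, _) => h (S (dual_basis (onb _) i))) FGx;
  rewrite !comp_lfunE !(linfunE lin).
Qed.

Lemma tcat_univ u v (Z : vectType C) (b : tens u -> tens v -> Z) :
  (forall y, linear (b ^~ y)) -> (forall x, linear (b x)) ->
  exists F : 'Hom(tens (u ++ v), Z), forall x y, F (tcat x y) = b x y.
Proof.
elim: u b => [|l u IH] b bl br.
  exists (linfun (b (1 : C^o))) => x y; rewrite /= linfunE // .
  have := br (1 : C^o) x y 0; rewrite addr0 => ->.
  have := bl y x (1 : C^o) 0; rewrite addr0 [x *: _]mulr1 => ->.
  have := bl y (-1) 0 0; rewrite scaler0 addr0 scaleN1r addNr => ->.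
  have := br (1 : C^o) (-1) 0 0; rewrite scaler0 addr0 scaleN1r addNr => ->.
  by [].
have H i : exists F : 'Hom(tens (u ++ v), Z), forall x y,
    F (tcat x y) = b (pure (onb (letter_space l))`_i x) y.
  apply: IH => [y|x] a z z'; last exact: br.
  rewrite -bl; congr b; apply/lfunP => phi.
  by rewrite add_lfunE scale_lfunE !pureE scalerDr !scalerA mulrC.
have [f fE] := choice H.
pose g (S : 'Hom('Hom(letter_space l, C^o), tens (u ++ v))) :=
  \sum_(i < \dim {:letter_space l}) f i (S (dual_basis (onb _) i)).
have lin : linear g.
  move=> a S S'; rewrite /g scaler_sumr -big_split; apply: eq_bigr => i _ /=.
  by rewrite add_lfunE scale_lfunE linearP.
exists (linfun g) => S y; rewrite linfunE // /g.
have lins : linear (fun phi => @tcat u v (S phi) y).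
  by move=> a phi psi; rewrite linearP tcat_linearl.
transitivity (\sum_(i < \dim {:letter_space l}) b
    (pure (onb (letter_space l))`_i (S (dual_basis (onb _) i))) y).
  by apply: eq_bigr => i _; rewrite /= (linfunE lins) fE.
pose b' := HB.pack_for {linear tens (l :: u) -> Z} (b ^~ y)
  (GRing.isSemilinear.Build _ _ _ _ _ (GRing.semilinear_linear (bl y))).
by rewrite [in RHS](tensor_sum S) -[RHS]/(b' _) linear_sum.
Qed.

Definition unitary (g : 'End(V)) : Prop :=
  (adj g \o g = \1 /\ g \o adj g = \1)%VF.

Definition letter_act (g : 'End(V)) (l : letter) : 'End(letter_space l) :=
  match l return 'End(letter_space l) with
  | std => g
  | dual => linfun (fun phi : 'Hom(V, C^o) => phi \o g^-1)%VF
  end.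

Fixpoint act (g : 'End(V)) (w : seq letter) : 'End(tens w) :=
  match w return 'End(tens w) with
  | [::] => \1%VF
  | l :: w' => tensor_map (letter_act g l) (act g w')
  end.

Definition stabilizer (I : Type) (w : I -> seq letter)
    (T : forall i, tens (w i)) : set 'End(V) :=
  [set g | unitary g /\ forall i, act g (w i) (T i) = T i].

(* x (x) y |-> y (x) x: see [flipE]. *)
Definition flip : 'Hom(tens [:: std; std], tens [:: std; std]) :=
  lswap 'Hom(V, C^o) 'Hom(V, C^o) C^o.

Definition tensor_hom (w : seq letter) (t : tens w) :
    'Hom(tens [::], tens w) :=
  linfun (fun c : C^o => (c : C) *: t).

Definition tensor2 (k l : letter) (x : letter_space k) (y : letter_space l) :
    tens [:: k; l] :=
  @pure _ _ (tens [:: l]) x (@pure _ _ (tens [::]) y (1 : C^o)).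

Lemma flipE (x y : V) :
  flip (@tensor2 std std x y) = @tensor2 std std y x.
Proof.
apply/lfunP => phi; apply/lfunP => psi; rewrite /flip lswapE pureE.
have -> : (tensor2 (k := std) (l := std) x y :
    'Hom('Hom(V, C^o), 'Hom('Hom(V, C^o), C^o))) psi =
    (psi x : C) *: @pure _ V (unit_hilbert R) y (1 : C^o) :> 'Hom('Hom(V, C^o), C^o).
  exact: (@pureE _ V (tensor_hilbert V (unit_hilbert R)) x
           (@pure _ V (unit_hilbert R) y (1 : C^o)) psi).
have pE (z : V) (q : 'Hom(V, C^o)) :
    @pure _ V (unit_hilbert R) z (1 : C^o) q = (q z : C).
  by rewrite (@pureE _ V (unit_hilbert R)) -[LHS]/((q z : C) * 1) mulr1.
transitivity ((psi x : C) * (phi y : C)).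
  rewrite scale_lfunE.
  exact: (congr1 (fun t : C => (psi x : C) * t) (pE y phi)).
rewrite mulrC scale_lfunE; apply/esym.
exact: (congr1 (fun t : C => (phi y : C) * t) (pE x psi)).
Qed.

Section Generators.
Variable e : (\dim {:V}).-tuple V.

Definition rmor : 'Hom(tens [::], tens [:: dual; std]) :=
  tensor_hom (\sum_(k < \dim {:V}) @tensor2 dual std (dual_basis e k) e`_k).

Definition rbarmor : 'Hom(tens [::], tens [:: std; dual]) :=
  tensor_hom (\sum_(k < \dim {:V}) @tensor2 std dual e`_k (dual_basis e k)).

Variables (I : Type) (w : I -> seq letter) (T : forall i, tens (w i)).

Inductive generator : forall u v, 'Hom(tens u, tens v) -> Prop :=
| gen_flip : generator flip
| gen_r : generator rmor
| gen_r_adj : generator (adj rmor)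
| gen_rbar : generator rbarmor
| gen_rbar_adj : generator (adj rbarmor)
| gen_T i : generator (tensor_hom (T i))
| gen_T_adj i : generator (adj (tensor_hom (T i))).

(* F = iota_a (x) f (x) iota_b, for f from u to v; such an F exists and is
   unique, see [whisker_exists] and [whisker_uniq]. *)
Definition whisker a b u v (f : 'Hom(tens u, tens v))
    (F : 'Hom(tens (a ++ u ++ b), tens (a ++ v ++ b))) : Prop :=
  forall x y z, F (tcat x (tcat y z)) = tcat x (tcat (f y) z).

Lemma whisker_uniq a b u v (f : 'Hom(tens u, tens v))
    (F F' : 'Hom(tens (a ++ u ++ b), tens (a ++ v ++ b))) :
  whisker f F -> whisker f F' -> F = F'.
Proof.
move=> Ff F'f; apply: tcat_ext => x y.
have lin : linear (fun y : tens (u ++ b) => tcat x y) by apply: tcat_linearr.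
have FF' : (F \o linfun (fun y : tens (u ++ b) => tcat x y) =
            F' \o linfun (fun y : tens (u ++ b) => tcat x y))%VF.
  by apply: tcat_ext => y1 y2; rewrite !comp_lfunE !(linfunE lin) Ff F'f.
by have := congr1 (fun h : 'Hom(_, _) => h y) FF';
  rewrite !comp_lfunE !(linfunE lin).
Qed.

Lemma whisker_exists a b u v (f : 'Hom(tens u, tens v)) :
  exists F : 'Hom(tens (a ++ u ++ b), tens (a ++ v ++ b)), whisker f F.
Proof.
have [|x|G GE] := @tcat_univ u b _ (fun y z => tcat (f y) z).
- by move=> z c y y'; rewrite linearP tcat_linearl.
- exact: tcat_linearr.
have [|x|F FE] := @tcat_univ a (u ++ b) _ (fun x y => tcat x (G y)).
- by move=> y; apply: tcat_linearl.
- by move=> c y y'; rewrite linearP tcat_linearr.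
by exists F => x y z; rewrite FE GE.
Qed.

Inductive composite : forall u v, 'Hom(tens u, tens v) -> Prop :=
| composite_id u : @composite u u \1%VF
| composite_step a b u v t (f : 'Hom(tens u, tens v))
    (F : 'Hom(tens (a ++ u ++ b), tens (a ++ v ++ b)))
    (G : 'Hom(tens t, tens (a ++ u ++ b))) :
    generator f -> whisker f F -> composite G -> composite (F \o G)%VF.

Definition generated u v (F : 'Hom(tens u, tens v)) : Prop :=
  exists (k : nat) (c : 'I_k -> C) (G : 'I_k -> 'Hom(tens u, tens v)),
    (forall i, composite (G i)) /\ F = \sum_(i < k) c i *: G i.
End Generators.

Variable K : set 'End(V).

(* The usual topology of End(W), transported from matrices; it does not depend
   on the choice of the basis. *)
Definition End_top (W : vectType C) := initial_topology
  (mxof (vbasis {:W}) (vbasis {:W}) : 'End(W) -> 'M[C]_(\dim {:W})).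

(* A representation of K is encoded as a total function on End(V) of which only
   the values on K matter. *)
Definition representation (W : vectType C) (rho : 'End(V) -> 'End(W)) : Prop :=
  [/\ rho \1%VF = \1%VF,
      forall g h, K g -> K h -> rho (g \o h)%VF = (rho g \o rho h)%VF &
      {within (K : set (End_top V)),
        continuous (rho : End_top V -> End_top W)}].

Definition irreducible (W : vectType C) (rho : 'End(V) -> 'End(W)) : Prop :=
  {:W}%VS != 0%VS /\
  forall U : {vspace W}, (forall g, K g -> (rho g @: U <= U)%VS) ->
    U = 0%VS \/ U = fullv.

Definition intertwiner (W W' : vectType C) (rho : 'End(V) -> 'End(W))
    (rho' : 'End(V) -> 'End(W')) (F : 'Hom(W, W')) : Prop :=
  forall g, K g -> (F \o rho g = rho' g \o F)%VF.

Definition subrepresentation (W W' : vectType C) (rho : 'End(V) -> 'End(W))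
    (rho' : 'End(V) -> 'End(W')) : Prop :=
  exists2 F : 'Hom(W, W'), lker F = 0%VS & intertwiner rho rho' F.

End Words.

(* Main.v *)
Require Import Defs.
From HB Require Import structures.
From mathcomp Require Import all_boot all_order all_algebra.
From mathcomp Require Import complex ring.
From mathcomp Require Import boolp classical_sets reals topology normedtype.

(** Both halves average over [K] without Haar measure. A function on a group is
    called null when its two-sided translates can be made uniformly small by
    finite convex averaging; a coefficient [x pi(g) y] of a bounded
    representation is null as soon as every invariant row kills [y].

    Suppose an intertwiner [F] of [K] is not generated. Removing its orthogonal
    projection on the generated morphisms, we get [F1 != 0] orthogonal to all of
    them, and [psi(g) = <g F1 g^*, F>] on [U(V)] is null by the first fundamental
    theorem for [U(V)]. It stays null after multiplication by matrix coefficients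
    [<g T_i, T_i>] and their conjugates, because tensoring with [T_i] preserves
    orthogonality to the generated morphisms. So [b^N psi] is null for the bump
    [b = 1 - sum_i |g T_i - T_i|^2 / B], [i] in a finite set. But [psi] is the
    positive constant [|F1|^2] on [K] and, by compactness, its real part is
    bounded below where [b] is close to [1]; as finitely many translates of that
    region cover [U(V)], the means of [b^N psi] cannot all be small.

    For an irreducible representation [rho] of [K] occurring in no tensor word,
    the same argument applies to [psi = tr rho] on [K] and
    [b = 1 - sum_i |g e_i - e_i|^2 / B], the functions [conj(t(g)) rho_kl(g)]
    with [t] a coefficient of a tensor word being null by Schur's lemma.

    The first fundamental theorem reduces by duality to commutants of
    [A^(x)n], [A] unitary. Vanishing of polynomials extends commutation to all
    matrices [A]; the entries [A_ab = t^(D^r)], [r] the rank of [(a, b)], then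
    isolate the operators constant on multisets of index pairs, which
    include everything commuting with the flips. *)

Set Implicit Arguments.
Unset Strict Implicit.
Unset Printing Implicit Defensive.

Import Order.TTheory GRing.Theory Num.Theory.
Import numFieldNormedType.Exports.

Local Open Scope classical_set_scope.
Local Open Scope ring_scope.

(** The bump has to be a polynomial in matrix coefficients: multiplication by its powers then stays
    inside a class of functions that are null for an algebraic reason, and no density of
    coefficients among continuous functions is called for. Translating on both sides, uniformly, is
    what makes null functions closed under sums. Since [I] may be infinite, compactness must supply
    a finite subcollection of tensors together with a radius; it enters through ultrafilters on
    End(V), along which all tensor coefficients converge to those of a single unitary. In the second
    half [rho] lives on [K] alone, so the averaging takes place on [K]; continuity is used near the
    identity and spread by translation. As [rho] comes without an invariant scalar product, the
    ergodic argument rests on bounded entries instead of unitarity. *)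

Lemma Cplx_archi (R : realType) (x : Cplx R) : exists n : nat, `|x| < n%:R.
Proof.
case: x => a b.
exists (Num.bound (Num.sqrt (a ^+ 2 + b ^+ 2))).
rewrite -[ltLHS]/((Num.sqrt (a ^+ 2 + b ^+ 2))%:C)%C.
have -> : (Num.bound (Num.sqrt (a ^+ 2 + b ^+ 2)))%:R =
  ((Num.bound (Num.sqrt (a ^+ 2 + b ^+ 2)))%:R%:C)%C :> R[i] by rewrite rmorph_nat.
by rewrite ltcR archi_boundP // sqrtr_ge0.
Qed.

(** Bernoulli's inequality with d / c = 1 + q makes (d / c)^N at least 1 + N q, which passes l / k
    by the Archimedean property. The case c = 0 is settled by N = 1. *)
Lemma geometric_dominated (R : realType) (c d k l : Cplx R) :
  0 <= c -> c < d -> 0 < k -> 0 <= l -> exists N : nat, l * c ^+ N < k * d ^+ N.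
Proof.
move=> c0 cd k0 l0.
have d0 : 0 < d by apply: le_lt_trans cd.
have [c00|cn0] := eqVneq c 0.
  by exists 1; rewrite c00 !expr1 mulr0 mulr_gt0.
have cp : 0 < c by rewrite lt0r cn0.
set q := d / c - 1.
have q0 : 0 < q by rewrite subr_gt0 ltr_pdivlMr ?mul1r.
have [N hN] := Cplx_archi (l / k / q).
exists N.
have dE : d = (1 + q) * c by rewrite /q addrC subrK divfK.
rewrite dE exprMn mulrA ltr_pM2r ?exprn_gt0 //.
have bern n : 1 + n%:R * q <= (1 + q) ^+ n.
  elim: n => [|n IH]; first by rewrite mul0r addr0.
  rewrite exprS (le_trans _ (ler_wpM2l (addr_ge0 ler01 (ltW q0)) IH)) //.
  have -> : (1 + q) * (1 + n%:R * q) = (1 + n.+1%:R * q) + q * (n%:R * q).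
    by rewrite -natr1; ring.
  by rewrite lerDl !mulr_ge0 ?(ltW q0).
apply: lt_le_trans (ler_wpM2l (ltW k0) (bern N)).
rewrite mulrDr mulr1 ltr_wpDl ?(ltW k0) //.
rewrite -ltr_pdivrMl // -ltr_pdivrMr // [_^-1 * _]mulrC.
by apply: le_lt_trans hN; rewrite ger0_norm ?divr_ge0 ?(ltW k0, ltW q0).
Qed.

Lemma sumr_const_seq (V : nmodType) (J : Type) (r : seq J) (x : V) :
  \sum_(j <- r) x = x *+ size r.
Proof. by rewrite big_const_seq count_predT iter_addr_0. Qed.

(** * Null functions *)

Section Means.
Variables (C : numClosedFieldType) (S : eqType) (mul : S -> S -> S) (one : S).
Variable G : S -> Prop.
Hypothesis mulA : associative mul.
Hypothesis G1 : G one.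
Hypothesis GM : forall g h, G g -> G h -> G (mul g h).

(* A finitely supported complex measure on [S] is a list of weighted points. *)
Definition ev (mu : seq (C * S)) (phi : S -> C) : C :=
  \sum_(x <- mu) x.1 * phi x.2.

Definition mean (mu : seq (C * S)) : Prop :=
  (forall x, x \in mu -> 0 <= x.1 /\ G x.2) /\ \sum_(x <- mu) x.1 = 1.

Definition conv (mu nu : seq (C * S)) : seq (C * S) :=
  [seq (x.1 * y.1, mul x.2 y.2) | x <- mu, y <- nu].

Lemma ev_conv mu nu phi :
  ev (conv mu nu) phi = ev mu (fun g => ev nu (fun h => phi (mul g h))).
Proof.
rewrite /ev /conv big_allpairs_dep; apply: eq_bigr => x _.
by rewrite big_distrr; apply: eq_bigr => y _ /=; rewrite mulrA.
Qed.

Lemma mean_conv mu nu : mean mu -> mean nu -> mean (conv mu nu).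
Proof.
move=> [mu0 mu1] [nu0 nu1]; split.
  move=> _ /allpairsP[[x y] /= [xmu ynu ->]] /=.
  have [? ?] := mu0 _ xmu; have [? ?] := nu0 _ ynu.
  by split; [apply: mulr_ge0|apply: GM].
rewrite /conv big_allpairs_dep -[RHS]mu1; apply: eq_bigr => x _ /=.
by rewrite -big_distrr /= nu1 mulr1.
Qed.

Definition avg N (mus : nat -> seq (C * S)) : seq (C * S) :=
  flatten [seq [seq (N%:R^-1 * x.1, x.2) | x <- mus k] | k <- iota 0 N].

Lemma ev_avg N mus phi :
  ev (avg N mus) phi = N%:R^-1 * \sum_(k < N) ev (mus k) phi.
Proof.
rewrite /ev /avg big_flatten /= big_map (_ : iota 0 N =
  index_iota 0 N) ?big_mkord ?/index_iota ?subn0 //.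
rewrite big_distrr; apply: eq_bigr => k _ /=.
by rewrite big_map big_distrr; apply: eq_bigr => x _ /=; rewrite mulrA.
Qed.

Lemma mean_avg N mus : (0 < N)%N -> (forall k, (k < N)%N -> mean (mus k)) ->
  mean (avg N mus).
Proof.
move=> N0 mm; split.
  move=> x /flatten_mapP[k]; rewrite mem_iota add0n => /= kN /mapP[y ymu ->] /=.
  have [/(_ _ ymu)[y1 y2] _] := mm _ kN.
  by split => //; rewrite mulr_ge0 ?invr_ge0.
rewrite /avg big_flatten /= big_map (_ : iota 0 N =
  index_iota 0 N) ?big_mkord ?/index_iota ?subn0 //.
transitivity (\sum_(k < N) (N%:R^-1 : C)).
  apply: eq_bigr => k _; rewrite big_map -big_distrr /=.
  by have [_ ->] := mm _ (ltn_ord k); rewrite mulr1.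
by rewrite sumr_const card_ord -[LHS]mulr_natr mulVf // pnatr_eq0 -lt0n.
Qed.

Definition dirac g : seq (C * S) := [:: (1, g)].

Lemma ev_dirac g phi : ev (dirac g) phi = phi g.
Proof. by rewrite /ev big_seq1 mul1r. Qed.

Lemma mean_dirac g : G g -> mean (dirac g).
Proof.
by move=> Gg; split; [move=> x; rewrite inE => /eqP-> | rewrite big_seq1].
Qed.

Lemma ev_norm_le mu phi c : mean mu -> (forall g, G g -> `|phi g| <= c) ->
  `|ev mu phi| <= c.
Proof.
move=> [mu0 mu1] hc; apply: le_trans (ler_norm_sum _ _ _) _.
rewrite -[leRHS]mul1r -mu1 big_distrl big_seq [leRHS]big_seq.
apply: ler_sum => x /mu0[x1 Gx]; rewrite normrM ger0_norm //.
by rewrite ler_wpM2l // hc.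
Qed.

Lemma evD mu phi psi : ev mu (fun g => phi g + psi g) = ev mu phi + ev mu psi.
Proof. by rewrite /ev -big_split; apply: eq_bigr => x _; rewrite mulrDr. Qed.

Lemma evZ mu c phi : ev mu (fun g => c * phi g) = c * ev mu phi.
Proof. by rewrite /ev big_distrr; apply: eq_bigr => x _; rewrite mulrCA. Qed.

Lemma ev_sum (J : Type) (r : seq J) mu (phi : J -> S -> C) :
  ev mu (fun g => \sum_(j <- r) phi j g) = \sum_(j <- r) ev mu (phi j).
Proof.
rewrite /ev exchange_big; apply: eq_bigr => x _ /=.
by rewrite big_distrr.
Qed.

Lemma ev_cst mu c : mean mu -> ev mu (fun=> c) = c.
Proof. by move=> [_ mu1]; rewrite /ev -big_distrl /= mu1 mul1r. Qed.

Lemma ev_exchange mu nu (chi : S -> S -> C) :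
  ev mu (fun g => ev nu (chi g)) = ev nu (fun h => ev mu (chi^~ h)).
Proof.
rewrite /ev; under eq_bigr do rewrite big_distrr /=.
rewrite exchange_big; apply: eq_bigr => y _ /=.
by rewrite big_distrr; apply: eq_bigr => x _ /=; rewrite mulrCA.
Qed.

Lemma ev_ext mu phi psi : mean mu -> (forall g, G g -> phi g = psi g) ->
  ev mu phi = ev mu psi.
Proof.
by move=> [mu0 _] e; rewrite /ev !big_seq; apply: eq_bigr => x /mu0[_ /e->].
Qed.

Lemma ev_le mu phi psi : mean mu -> (forall g, G g -> phi g <= psi g) ->
  ev mu phi <= ev mu psi.
Proof.
move=> [mu0 _] e; rewrite /ev !big_seq; apply: ler_sum => x /mu0[x0 /e h].
exact: ler_wpM2l.
Qed.

(* Replaces the vanishing of the Haar integral of [phi]. *)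
Definition null (phi : S -> C) : Prop := forall eps, 0 < eps ->
  exists2 mu, mean mu & forall h h', G h -> G h' ->
    `|ev mu (fun g => phi (mul (mul h g) h'))| <= eps.

Lemma null_ext phi psi : (forall g, G g -> phi g = psi g) -> null phi -> null psi.
Proof.
move=> e np eps eps0; have [mu mm h] := np _ eps0; exists mu => // a b Ga Gb.
by rewrite -(@ev_ext _ (fun g => phi (mul (mul a g) b))) ?h // => g Gg; rewrite e //;
  do !apply: GM.
Qed.

Lemma null0 : null (fun=> 0).
Proof.
move=> eps e0; exists (dirac one); first exact: mean_dirac.
by move=> h h' _ _; rewrite ev_dirac normr0 ltW.
Qed.

Lemma nullZ c phi : null phi -> null (fun g => c * phi g).
Proof.
move=> np eps e0; have d0 : 0 < `|c| + 1 by rewrite ltr_wpDl.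
have [mu mm h] := np _ (divr_gt0 e0 d0); exists mu => // a b Ga Gb.
rewrite evZ normrM; apply: le_trans (ler_wpM2l _ (h _ _ Ga Gb)) _ => //.
by rewrite mulrCA ler_piMr ?(ltW e0) // ler_pdivrMr // mul1r lerDl.
Qed.

(** The convolution of the two means works for both functions: for [phi] the inner point is absorbed
    into the right translate, for [psi] the outer point into the left one. Hence the uniformity over
    two-sided translates in [null]. *)
Lemma nullD phi psi : null phi -> null psi -> null (fun g => phi g + psi g).
Proof.
move=> np nq eps e0; have e2 : 0 < eps / 2 by rewrite divr_gt0.
have [mu mm hp] := np _ e2; have [nu nn hq] := nq _ e2.
exists (conv mu nu); first exact: mean_conv.
move=> a b Ga Gb; rewrite ev_conv.
under [X in ev _ X]funext => g do rewrite evD.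
rewrite evD; apply: le_trans (ler_normD _ _) _.
rewrite [leRHS]splitr lerD //.
  rewrite ev_exchange; apply: ev_norm_le => // h Gh.
  under [X in ev _ X]funext => g do rewrite mulA -mulA.
  by apply: hp => //; apply: GM.
apply: ev_norm_le => // g Gg.
under [X in ev _ X]funext => h do rewrite mulA.
by apply: hq => //; apply: GM.
Qed.

Lemma null_sum (J : Type) (r : seq J) (phi : J -> S -> C) :
  (forall j, null (phi j)) -> null (fun g => \sum_(j <- r) phi j g).
Proof.
move=> np; elim: r => [|j r IH].
  by apply: null_ext null0 => g _; rewrite big_nil.
apply: null_ext (nullD (np j) IH) => g _; by rewrite big_cons.
Qed.

End Means.

Lemma ReM_real (C : numClosedFieldType) (a z : C) : a \is Num.real ->
  'Re (a * z) = a * 'Re z.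
Proof.
move=> ar; rewrite [z in LHS]Crect mulrDr mulrCA.
rewrite Re_rect // ?rpredM ?Creal_Re ?Creal_Im //.
Qed.

Lemma Re_norm_le (C : numClosedFieldType) (z : C) : 'Re z <= `|z|.
Proof.
apply: le_trans (leif_normC_Re_Creal z).
by apply: real_ler_norm; apply: Creal_Re.
Qed.

Lemma Re_norm_ge (C : numClosedFieldType) (z : C) : - `|z| <= 'Re z.
Proof. by rewrite lerNl -raddfN /= -(normrN z) Re_norm_le. Qed.

Arguments dirac {C S} g.

(** * Concentration of powers of a bump function *)

Section Bump.
Variables (R : realType) (S : eqType) (mul : S -> S -> S) (one : S).
Local Notation C := (Cplx R).
Variable G : S -> Prop.
Hypothesis mul1 : right_id one mul.
Hypothesis G1 : G one.
Hypothesis GM : forall g h, G g -> G h -> G (mul g h).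
Variables (b psi : S -> C) (c d k l : C) (hs : seq S).
Hypothesis b0 : forall g, G g -> 0 <= b g.
Hypothesis psib : forall g, G g -> `|psi g| <= l.
Hypothesis kp : 0 < k.
Hypothesis c0 : 0 <= c.
Hypothesis cd : c < d.
Hypothesis bpsi : forall g, G g -> c <= b g -> k <= 'Re (psi g).
Hypothesis hsG : forall h, h \in hs -> G h.
Hypothesis cover : forall g, G g -> exists2 h, h \in hs & d <= b (mul h g).

(* [b ^+ N] concentrates where [Re psi] is at least [k]: up to [c ^+ N] the
   mean of [b ^+ N * psi] is at least [k] times the mean of [b ^+ N], and some
   translate of the latter has mean at least [d ^+ N / size hs]. *)
Lemma bump_not_null :
  (forall N, null mul G (fun g => b g ^+ N * psi g)) -> False.
Proof.
move=> nb.
have l0 : 0 <= l by apply: le_trans (psib G1).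
have d0 : 0 < d by apply: le_lt_trans cd.
have lk0 : 0 <= (size hs)%:R * (l + k) :> C by rewrite mulr_ge0 ?addr_ge0 ?(ltW kp).
have [N hN] := geometric_dominated c0 cd kp lk0.
(* Chosen so that the gap given by [hN] equals (size hs + 1) e, while summing the bounds [key] over
   the translates yields at most size hs times e. *)
set e := (k * d ^+ N - (size hs)%:R * (l + k) * c ^+ N) / ((size hs)%:R + 1).
have s1 : 0 < (size hs)%:R + 1 :> C by rewrite ltr_wpDl.
have e0 : 0 < e by rewrite divr_gt0 ?subr_gt0.
have [mu mm hmu] := nb N _ e0.
(* Where b is at least c, [bpsi] gives the bound k. Elsewhere Re psi is at least -l, and the loss (l
   + k) b^N is at most (l + k) c^N. *)
have pw g : G g -> k * b g ^+ N - (l + k) * c ^+ N <= 'Re (b g ^+ N * psi g).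
  move=> Gg; have bN0 : 0 <= b g ^+ N by rewrite exprn_ge0 ?b0.
  rewrite ReM_real ?ger0_real // mulrC.
  have [cb|bc] := real_leP (ger0_real c0) (ger0_real (b0 Gg)).
    apply: (@le_trans _ _ (b g ^+ N * k)); last by rewrite ler_wpM2l ?bpsi.
    by rewrite gerBl mulr_ge0 ?addr_ge0 ?exprn_ge0 // ltW.
  apply: (@le_trans _ _ (- (b g ^+ N * l))); last first.
    rewrite -mulrN ler_wpM2l //; apply: le_trans (Re_norm_ge _).
    by rewrite lerN2 psib.
  rewrite lerBlDr addrC -lerBlDr opprK -mulrDr mulrC [k + l]addrC.
  by rewrite ler_wpM2l ?addr_ge0 ?(ltW kp) // lerXn2r ?nnegrE ?b0 // ltW.
have key h : h \in hs ->
    ev mu (fun g => k * b (mul h g) ^+ N - (l + k) * c ^+ N) <= e.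
  move=> hh; have Gh := hsG hh.
  apply: le_trans (hmu _ _ Gh G1).
  under [X in `|ev _ X|]funext => g do rewrite mul1.
  apply: le_trans (ev_le mm (fun g Gg => pw _ (GM Gh Gg))) _.
  have -> : ev mu (fun g => 'Re (b (mul h g) ^+ N * psi (mul h g))) =
      'Re (ev mu (fun g => b (mul h g) ^+ N * psi (mul h g))).
    rewrite /ev raddf_sum !big_seq; apply: eq_bigr => x xm /=.
    by apply/esym/ReM_real/ger0_real; case: mm => /(_ _ xm) [].
  exact: Re_norm_le.
have : \sum_(h <- hs) ev mu (fun g => k * b (mul h g) ^+ N - (l + k) * c ^+ N)
    <= (size hs)%:R * e.
  rewrite mulr_natl -sumr_const_seq big_seq [leRHS]big_seq.
  exact: ler_sum.
rewrite -ev_sum => le1.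
have : k * d ^+ N - (size hs)%:R * (l + k) * c ^+ N <= (size hs)%:R * e.
  apply: le_trans le1; rewrite -[leLHS](ev_cst _ mm); apply: ev_le mm _ => g Gg.
  rewrite sumrB sumr_const_seq -[X in _ <= _ - X]mulr_natl [X in _ <= _ - X]mulrA lerD2r.
  rewrite -big_distrr ler_wpM2l ?(ltW kp) //=.
  have [h hh dbh] := cover Gg.
  apply: (@le_trans _ _ (b (mul h g) ^+ N)).
    by rewrite lerXn2r ?nnegrE ?(ltW d0) //; apply/b0/GM => //; apply: hsG.
  rewrite (big_rem h) //= lerDl big_seq; apply: sumr_ge0 => h' /mem_rem hh'.
  by apply/exprn_ge0/b0/GM => //; apply: hsG.
apply/negP; rewrite -real_ltNge ?ger0_real ?mulr_ge0 ?(ltW e0) ?subr_ge0 ?(ltW hN) //.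
rewrite [ltRHS](_ : _ = ((size hs)%:R + 1) * e);
  last by rewrite /e [RHS]mulrC divfK // gt_eqF.
  by rewrite mulrDl mul1r ltrDl.
by rewrite invr_ge0 ltW.
Qed.

End Bump.

(** * Coefficients of bounded representations *)

Section EntryBounds.
Variable C : numClosedFieldType.

Definition mxbounded m n (A : 'M[C]_(m, n)) (c : C) := forall i j, `|A i j| <= c.

Lemma mxboundedM m n p (A : 'M[C]_(m, n)) (B : 'M_(n, p)) c d :
  0 <= c -> mxbounded A c -> mxbounded B d -> mxbounded (A *m B) (n%:R * (c * d)).
Proof.
move=> c0 Ac Bd i j; rewrite mxE; apply: le_trans (ler_norm_sum _ _ _) _.
rewrite mulr_natl -[n in leRHS]card_ord -sumr_const; apply: ler_sum => k _.
by rewrite normrM ler_pM.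
Qed.

Lemma mxbounded_exists m n (A : 'M[C]_(m, n)) : exists2 c, 0 <= c & mxbounded A c.
Proof.
exists (\sum_i \sum_j `|A i j|); first by rewrite !sumr_ge0 // => i _; rewrite sumr_ge0.
move=> i j; rewrite (bigD1 i) //= (bigD1 j) //= -addrA lerDl.
by rewrite addr_ge0 ?sumr_ge0 // => k _; rewrite sumr_ge0.
Qed.

(** The last term is the excess of the mean square over the square of the mean; in
    [fixed_by_average] it forces some orbit point to grow. *)
Lemma variance (J : Type) (r : seq J) (z : J -> C) a :
  \sum_(j <- r) z j = (size r)%:R * a ->
  \sum_(j <- r) `|z j| ^+ 2 = (size r)%:R * `|a| ^+ 2 + \sum_(j <- r) `|z j - a| ^+ 2.
Proof.
move=> sa.
have e j : `|z j - a| ^+ 2 = `|z j| ^+ 2 + `|a| ^+ 2 - (z j * a^* + (z j)^* * a).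
  by rewrite !normCK rmorphB /=; ring.
under [X in _ = _ + X]eq_bigr do rewrite e.
have e2 : \sum_(j <- r) (z j)^* = (size r)%:R * a^*.
  by rewrite -rmorph_sum sa rmorphM /= rmorph_nat.
rewrite sumrB !big_split /= sumr_const_seq -!big_distrl /= e2 sa.
rewrite !normCK -[_ *+ size r]mulr_natl; ring.
Qed.

End EntryBounds.

(** * A mean ergodic theorem for bounded representations *)

Section Ergodic.
Variables (R : realType) (S : eqType) (mul : S -> S -> S) (one : S).
Local Notation C := (Cplx R).
Variable G : S -> Prop.
Hypothesis G1 : G one.
Hypothesis GM : forall g h, G g -> G h -> G (mul g h).
Hypothesis GV : forall g, G g -> exists2 h, G h & mul g h = one.
Variables (n : nat) (pi : S -> 'M[C]_n) (c : C).
Hypothesis pi1 : pi one = 1%:M.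
Hypothesis piM : forall g h, G g -> G h -> pi (mul g h) = pi g *m pi h.
Hypothesis pib : forall g, G g -> mxbounded (pi g) c.
Hypothesis c0 : 0 <= c.

Let q (p : 'rV[C]_n) : C := \sum_j `|p 0 j| ^+ 2.

Let q_ge0 p : 0 <= q p.
Proof. by apply: sumr_ge0 => j _; rewrite exprn_ge0. Qed.

(** The inverse of h lies in [G] too, so v is recovered from v pi(h) by a matrix with entries
    bounded by c; a short v pi(h) would make v short. *)
Lemma orbit_bounded_below (v : 'rV[C]_n) : v != 0 ->
  exists2 k, 0 < k & forall h, G h -> k <= q (v *m pi h).
Proof.
move=> v0; have [i vi] : exists i, v 0 i != 0.
  apply/existsP; apply: contraNT v0; rewrite negb_exists => /forallP vv.
  by apply/eqP/rowP => i; rewrite mxE; apply/eqP; rewrite -[_ == _]negbK.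
set e := `|v 0 i| / (c + 1).
have c1 : 0 < c + 1 by rewrite ltr_wpDl.
have e0 : 0 < e by rewrite divr_gt0 ?normr_gt0.
have n1 : 0 < n%:R + 1 :> C by rewrite ltr_wpDl.
exists (e ^+ 2 / (n%:R + 1)); first by rewrite divr_gt0 ?exprn_gt0.
move=> h Gh; set w := v *m pi h.
have [h' Gh' hh'] := GV Gh.
have vw : v = w *m pi h' by rewrite -mulmxA -piM // hh' pi1 mulmx1.
have ew : e <= \sum_j `|w 0 j|.
  rewrite ler_pdivrMr // vw mxE; apply: le_trans (ler_norm_sum _ _ _) _.
  rewrite big_distrl; apply: ler_sum => j _ /=; rewrite normrM ler_wpM2l //.
  by apply: le_trans (pib Gh' _ _) _; rewrite lerDl.
(* Summing (|w_j| - t)^2 >= 0 at this t replaces Cauchy-Schwarz; n + 1 in place of n keeps the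
   denominator nonzero. *)
set t := e / (n%:R + 1).
have t0 : 0 < t by rewrite divr_gt0.
have amgm j : 2 * t * `|w 0 j| - t ^+ 2 <= `|w 0 j| ^+ 2.
  rewrite -subr_ge0.
  have -> : `|w 0 j| ^+ 2 - (2 * t * `|w 0 j| - t ^+ 2) = (`|w 0 j| - t) ^+ 2 by ring.
  by rewrite real_exprn_even_ge0 // rpredB ?ger0_real // ltW.
apply: le_trans (ler_sum _ (fun j _ => amgm j)).
rewrite sumrB -big_distrr /= sumr_const card_ord -[X in _ <= _ - X]mulr_natl.
apply: (@le_trans _ _ (2 * t * e - n%:R * t ^+ 2)).
  rewrite -subr_ge0.
  have -> : 2 * t * e - n%:R * t ^+ 2 - e ^+ 2 / (n%:R + 1) = t ^+ 2.
    by rewrite /t; field; rewrite gt_eqF.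
  by rewrite exprn_ge0 // ltW.
by rewrite lerD2r ler_pM2l // mulr_gt0.
Qed.

(** For unitary [pi] this would be strict convexity of the norm. Here, if some g0 in s moves p,
    [variance] makes the average of q(p pi(g h)) over s exceed q(p pi(h)) by a fixed amount for
    every h; iterating, q grows without bound along the orbit, against boundedness. *)
Lemma fixed_by_average (s : seq S) (p : 'rV[C]_n) : (forall g, g \in s -> G g) ->
  p *m \sum_(g <- s) pi g = (size s)%:R *: p ->
  forall g, g \in s -> p *m pi g = p.
Proof.
move=> sG ps g0 g0s; apply/eqP; rewrite -subr_eq0; apply/negP => /negP v0.
have [k k0 hk] := orbit_bounded_below v0.
have s0 : 0 < (size s)%:R :> C by rewrite ltr0n; case: (s) g0s.
(* If no g in s gained k', the total gain over s would be at most k / 2, whereas the term of g0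
   alone contributes k. *)
set k' := k / (2 * (size s)%:R).
have k'0 : 0 < k' by rewrite divr_gt0 ?mulr_gt0.
have step h : G h -> exists2 h', G h' & q (p *m pi h) + k' <= q (p *m pi h').
  move=> Gh; apply: contrapT => nex.
  have le1 g : g \in s -> q (p *m pi (mul g h)) <= q (p *m pi h) + k'.
    move=> gs; have Ggh := GM (sG _ gs) Gh.
    have [|//] := real_leP (ger0_real (addr_ge0 (q_ge0 (p *m pi h)) (ltW k'0)))
       (ger0_real (q_ge0 (p *m pi (mul g h)))).
      by move=> hh; case: nex; exists (mul g h).
    exact: ltW.
  have : \sum_(g <- s) q (p *m pi (mul g h)) <= (size s)%:R * (q (p *m pi h) + k').
    rewrite mulr_natl -sumr_const_seq big_seq [leRHS]big_seq; exact: ler_sum.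
  rewrite exchange_big /=.
  have var j : \sum_(g <- s) `|(p *m pi (mul g h)) 0 j| ^+ 2 =
     (size s)%:R * `|(p *m pi h) 0 j| ^+ 2 +
     \sum_(g <- s) `|((p *m pi g - p) *m pi h) 0 j| ^+ 2.
    apply: (etrans (@variance C S s (fun g =>
      (p *m pi (mul g h)) 0 j) ((p *m pi h) 0 j) _)).
      transitivity (((p *m \sum_(g <- s) pi g) *m pi h) 0 j).
        rewrite mulmx_sumr mulmx_suml summxE !big_seq; apply: eq_bigr => g gs.
        by rewrite piM ?mulmxA //; apply: sG.
      by rewrite ps -scalemxAl mxE.
    congr (_ + _); rewrite !big_seq; apply: eq_bigr => g gs.
    have -> : p *m pi (mul g h) = p *m pi g *m pi h by rewrite piM ?mulmxA //; apply: sG.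
    by rewrite mulmxBl !mxE.
  under eq_bigr do rewrite var.
  rewrite big_split /= -big_distrr /= -/(q _) exchange_big /= mulrDr lerD2l.
  apply/negP; rewrite -real_ltNge.
  - apply: (@lt_le_trans _ _ k).
      have -> : (size s)%:R * k' = k / 2 by rewrite /k'; field; rewrite gt_eqF.
      by rewrite ltr_pdivrMr // mulr_natr mulr2n ltrDl.
    rewrite (big_rem g0) //=; apply: le_trans (hk _ Gh) _.
    by rewrite lerDl; apply: sumr_ge0 => g _; apply: q_ge0.
  - by rewrite ger0_real // mulr_ge0 // ltW.
  - by rewrite ger0_real //; apply: sumr_ge0 => g _; apply: q_ge0.
clearbody k'.
have grow N : exists2 h, G h & N%:R * k' <= q (p *m pi h).
  elim: N => [|N [h Gh hN]]; first by exists one => //; rewrite mul0r q_ge0.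
  have [h' Gh' hh'] := step _ Gh; exists h'; first exact: Gh'.
  by apply: le_trans hh'; rewrite -natr1 mulrDl mul1r lerD2r.
have [d d0 pd] := mxbounded_exists p.
set B := \sum_(j < n) (n%:R * (d * c)) ^+ 2.
have qB h : G h -> q (p *m pi h) <= B.
  move=> Gh; apply: ler_sum => j _; have hb := mxboundedM d0 pd (pib Gh).
  by rewrite lerXn2r ?nnegrE ?mulr_ge0.
have B0 : 0 <= B by apply: sumr_ge0 => j _; rewrite exprn_ge0 ?mulr_ge0.
have [N hN] := Cplx_archi (B / k').
have [h Gh hh] := grow N.
have := le_trans hh (qB _ Gh); apply/negP;
  rewrite -real_ltNge ?ger0_real ?mulr_ge0 ?(ltW k'0) //.
by rewrite -ltr_pdivrMr //; apply: le_lt_trans hN; rewrite ger0_norm // divr_ge0 // ltW.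
Qed.

Let fixed_space (s : seq S) : 'M[C]_n :=
  foldr (fun g V => kermx (pi g - 1%:M) :&: V)%MS 1%:M s.

Let fixed_spaceP (s : seq S) (p : 'rV[C]_n) :
  (p <= fixed_space s)%MS <-> (forall g, g \in s -> p *m pi g = p).
Proof.
elim: s => [|g s IH] /=; first by rewrite submx1; split.
rewrite sub_capmx; split.
  move=> /andP[/sub_kermxP pg /IH ps] h; rewrite inE => /orP[/eqP->|/ps //].
  by apply/eqP; rewrite -subr_eq0 -[X in _ - X]mulmx1 -mulmxBr pg.
move=> h; apply/andP; split; last by apply/IH => x xs; apply: h; rewrite inE xs orbT.
by apply/sub_kermxP; rewrite mulmxBr mulmx1 h ?inE ?eqxx // subrr.
Qed.

(** Among finite lists take one whose common fixed space has least rank: adding any further element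
    of [G] cannot shrink that space. *)
Lemma fixed_finitely_generated : exists2 s : seq S, forall g, g \in s -> G g &
  forall p : 'rV[C]_n, (forall g, g \in s -> p *m pi g = p) ->
    forall g, G g -> p *m pi g = p.
Proof.
pose P k := `[< exists2 s : seq S, forall g, g \in s ->
  G g & \rank (fixed_space s) = k >].
have exP : exists k, P k by exists (\rank (fixed_space [::])); apply/asboolP; exists [::].
case: (ex_minnP exP) => k /asboolP[s sG sk] kmin.
exists s => // p /fixed_spaceP ps g Gg.
have sub : (fixed_space (g :: s) <= fixed_space s)%MS by apply: capmxSr.
have gsG h : h \in g :: s -> G h by rewrite inE => /orP[/eqP->|/sG].
have := kmin _ (asboolT (ex_intro2 _ _ (g :: s) gsG erefl)).
rewrite -sk => ler; have ss : (fixed_space s <= fixed_space (g :: s))%MS.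
  by rewrite -(mxrank_leqif_sup sub) eqn_leq mxrankS.
by have /fixed_spaceP := submx_trans ps ss; apply; rewrite inE eqxx.
Qed.

Let mx_ev (mu : seq (C * S)) : 'M[C]_n := \matrix_(i, j) ev mu (fun g => pi g i j).

Let mx_ev_sandwich mu (A : 'rV[C]_n) (B : 'cV[C]_n) :
  ev mu (fun g => (A *m pi g *m B) 0 0) = (A *m mx_ev mu *m B) 0 0.
Proof.
transitivity (ev mu (fun g => \sum_j \sum_i A 0 i * B j 0 * pi g i j)).
  congr ev; apply/funext => g; rewrite mxE; apply: eq_bigr => j _.
  by rewrite mxE big_distrl; apply: eq_bigr => i _ /=; rewrite mulrAC.
rewrite ev_sum mxE; apply: eq_bigr => j _; rewrite ev_sum mxE big_distrl.
by apply: eq_bigr => i _; rewrite evZ mxE mulrAC.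
Qed.

Let mx_ev_conv mu nu : mean G mu -> mean G nu ->
  mx_ev (conv mul mu nu) = mx_ev mu *m mx_ev nu.
Proof.
move=> mm mn; apply/matrixP => i j; rewrite !mxE ev_conv.
transitivity (ev mu (fun g => \sum_k ev nu (fun h => pi h k j) * pi g i k)).
  apply: ev_ext mm _ => g Gg.
  transitivity (ev nu (fun h => \sum_k pi g i k * pi h k j)).
    by apply: ev_ext mn _ => h Gh; rewrite piM // mxE.
  by rewrite ev_sum; apply: eq_bigr => k _; rewrite evZ mulrC.
by rewrite ev_sum; apply: eq_bigr => k _; rewrite evZ !mxE mulrC.
Qed.

(* With [a] the average of finitely many [pi g] having no more fixed rows than
   [G], power boundedness gives [M = D *m M *m M] for [M = 1 - a]; then
   [P = 1 - D *m M] has invariant rows and the Cesaro means of [a] differ from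
   [P] by [O(1/N)]. *)
Lemma null_coefficient (x : 'rV[C]_n) (y : 'cV[C]_n) :
  (forall p : 'rV[C]_n, (forall g, G g -> p *m pi g = p) -> p *m y = 0) ->
  null mul G (fun g => (x *m pi g *m y) 0 0).
Proof.
move=> yinv; have [s sG sfix] := fixed_finitely_generated.
(* Adding the identity makes the list nonempty, so that averaging over it is legitimate, and changes
   no fixed rows. *)
set s1 := one :: s.
have s1G g : g \in s1 -> G g by rewrite inE => /orP[/eqP->|/sG].
set m : C := (size s1)%:R.
have m0 : m != 0 by rewrite pnatr_eq0.
set a := m^-1 *: \sum_(g <- s1) pi g.
have afix (p : 'rV_n) : p *m a = p -> forall g, G g -> p *m pi g = p.
  move=> pa; apply: sfix => g gs; apply: (@fixed_by_average s1) => //; last first.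
    by rewrite inE gs orbT.
  by rewrite -[in RHS]pa /a -scalemxAr scalerA divff // scale1r.
pose nu : seq (C * S) := avg (size s1) (fun k => dirac (nth one s1 k)).
have mnu : mean G nu.
  by apply: mean_avg => // k ks; apply/mean_dirac/s1G/mem_nth.
have nua : mx_ev nu = a.
  apply/matrixP => i j; rewrite !mxE ev_avg summxE (big_nth one) big_mkord.
  by congr (_ * _); apply: eq_bigr => k _; rewrite ev_dirac.
(* Convolution powers of [nu]: their matrices [pw k] are the powers of [a], and as averages of [pi]
   over means they keep the entry bound c for all k. *)
pose fix mus (k : nat) : seq (C * S) :=
  if k is k'.+1 then conv mul nu (mus k') else dirac one.
have mmus k : mean G (mus k).
  by elim: k => [|k IH] /=; [apply: mean_dirac|apply: mean_conv].
pose pw k := mx_ev (mus k).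
have pw0 : pw 0%N = 1%:M.
  by apply/matrixP => i j; rewrite mxE ev_dirac pi1.
have pwS k : pw k.+1 = a *m pw k by rewrite /pw /= mx_ev_conv // nua.
have pwb k : mxbounded (pw k) c.
  by move=> i j; rewrite mxE; apply: ev_norm_le (mmus k) _ => g Gg; apply: pib.
set M := 1%:M - a.
have tele N : M *m \sum_(k < N) pw k = 1%:M - pw N.
  elim: N => [|N IH]; first by rewrite big_ord0 mulmx0 pw0 subrr.
  by rewrite big_ord_recr /= mulmxDr IH mulmxBl mul1mx -pwS addrA subrK.
have fixpw (p : 'M_n) k : p *m a = p -> p *m pw k = p.
  move=> pa; elim: k => [|k IH]; first by rewrite pw0 mulmx1.
  by rewrite pwS mulmxA pa.
have fixpw1 (p : 'rV_n) k : p *m a = p -> p *m pw k = p.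
  move=> pa; elim: k => [|k IH]; first by rewrite pw0 mulmx1.
  by rewrite pwS mulmxA pa.
(* If u = v M is fixed by a, telescoping gives N u = v - v a^N, which is bounded in N; hence u = 0.
   So 1 is a semisimple eigenvalue of a. *)
have MM (v : 'rV_n) : v *m M *m M = 0 -> v *m M = 0.
  move=> vMM; set u := v *m M.
  have ua : u *m a = u.
    by apply/esym/eqP; rewrite -subr_eq0 -[X in X - _]mulmx1 -mulmxBr vMM.
  have Nu N : N%:R *: u = v - v *m pw N.
    rewrite -[X in X - _]mulmx1 -mulmxBr -tele mulmxA -/u mulmx_sumr.
    under eq_bigr do rewrite (fixpw1 _ _ ua).
    by rewrite sumr_const card_ord scaler_nat.
  have [d d0 vd] := mxbounded_exists v.
  apply/rowP => j; rewrite [RHS]mxE; apply/eqP/negP => /negP uj.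
  set B := d + n%:R * (d * c).
  have [N hN] := Cplx_archi (B / `|u 0 j|).
  have uj0 : 0 < `|u 0 j| by rewrite normr_gt0.
  have B0 : 0 <= B by rewrite addr_ge0 ?mulr_ge0.
  have : N%:R * `|u 0 j| <= B.
    rewrite -[N%:R]normr_nat -normrM.
    have -> : N%:R * u 0 j = v 0 j - (v *m pw N) 0 j.
      by have := congr1 (fun A : 'rV_n => A 0 j) (Nu N); rewrite !mxE.
    apply: le_trans (ler_normB _ _) _; rewrite lerD //.
    exact: (mxboundedM d0 vd (pwb N)).
  apply/negP; rewrite -real_ltNge ?ger0_real ?mulr_ge0 // -ltr_pdivrMr //.
  by rewrite -(ger0_norm (divr_ge0 B0 (ltW uj0))).
(* By [MM] the row space of M meets its left kernel trivially, so M and M^2 have the same rank and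
   the same row space. *)
have [D MD] : exists D, M = D *m (M *m M).
  apply/submxP; rewrite -(mxrank_leqif_sup (submxMl M M)) /=.
  have <- := mxrank_mul_ker M M.
  rewrite (_ : \rank (M :&: kermx M) = 0%N) ?addn0 //.
  apply/eqP; rewrite mxrank_eq0 -submx0; apply/rV_subP => u.
  rewrite sub_capmx => /andP[/submxP[v ->] /sub_kermxP h].
  by rewrite MM // sub0mx.
set P := 1%:M - D *m M.
have PM : P *m M = 0 by rewrite mulmxBl mul1mx -mulmxA -MD subrr.
have Pa : P *m a = P.
  by apply/esym/eqP; rewrite -subr_eq0 -[X in X - _]mulmx1 -mulmxBr PM.
have Pg g : G g -> P *m pi g = P.
  move=> Gg; apply/row_matrixP => i; rewrite row_mul; apply: afix => //.
  by rewrite -row_mul Pa.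
have Py : P *m y = 0.
  apply/row_matrixP => i; rewrite row_mul row0; apply: yinv => g Gg.
  by rewrite -row_mul Pg.
have [dx dx0 xd] := mxbounded_exists x.
have [dy dy0 yd] := mxbounded_exists y.
have [dD dD0 Dd] := mxbounded_exists D.
have [d1 d10 d1d] := mxbounded_exists (1%:M : 'M[C]_n).
(* Right translation is absorbed by P pi(h') = P, and P y = 0 by the hypothesis on y; what remains
   carries the factor 1 / (N + 1), with entries bounded independently of h, h' and N. *)
have main N h h' : G h -> G h' ->
    x *m pi h *m mx_ev (avg N.+1 mus) *m (pi h' *m y) =
    N.+1%:R^-1 *: (x *m pi h *m (D *m (1%:M - pw N.+1)) *m (pi h' *m y)).
  move=> Gh Gh'.
  have -> : mx_ev (avg N.+1 mus) = P + N.+1%:R^-1 *: (D *m (1%:M - pw N.+1)).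
    have -> : mx_ev (avg N.+1 mus) = N.+1%:R^-1 *: \sum_(k < N.+1) pw k.
      apply/matrixP => i j; rewrite !mxE ev_avg summxE.
      by congr (_ * _); apply: eq_bigr => k _; rewrite mxE.
    rewrite -tele -[X in _ *: X = _]mul1mx -[X in _ *: (X *m _) = _](subrK (D *m M)).
    rewrite -/P mulmxDl scalerDr -mulmxA; congr (_ + _).
    rewrite mulmx_sumr; under eq_bigr do rewrite fixpw //.
    by rewrite sumr_const card_ord -[P *+ _]scaler_nat scalerA mulVf ?pnatr_eq0 //
      scale1r.
  rewrite mulmxDr mulmxDl -[X in X + _ = _]mulmxA [P *m _]mulmxA Pg // Py mulmx0 add0r.
  by rewrite -scalemxAr -scalemxAl.
pose K1 := n%:R * (dx * c).
pose K2 := n%:R * (dD * (d1 + c)).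
pose K3 := n%:R * (c * dy).
have K10 : 0 <= K1 by rewrite !mulr_ge0.
have K20 : 0 <= K2 by rewrite !mulr_ge0 // addr_ge0.
have K30 : 0 <= K3 by rewrite !mulr_ge0.
pose K := n%:R * (n%:R * (K1 * K2) * K3).
have K0 : 0 <= K by apply: mulr_ge0 => //; apply: mulr_ge0 => //;
  apply: mulr_ge0 => //; apply: mulr_ge0.
move=> eps e0; have [N hN] := Cplx_archi (K / eps).
exists (avg N.+1 mus); first by apply: mean_avg.
move=> h h' Gh Gh'.
have mA : mean G (avg N.+1 mus) by apply: mean_avg.
have -> : ev (avg N.+1 mus) (fun g => (x *m pi (mul (mul h g) h') *m y) 0 0) =
    ev (avg N.+1 mus) (fun g => (x *m pi h *m pi g *m (pi h' *m y)) 0 0).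
  apply: (ev_ext mA) => g Gg; rewrite (piM (GM Gh Gg) Gh') (piM Gh Gg).
  by rewrite !mulmxA.
rewrite mx_ev_sandwich main // mxE normrM.
apply: (@le_trans _ _ (N.+1%:R^-1 * K)).
  rewrite normfV normr_nat ler_wpM2l ?invr_ge0 //.
  have b1 : mxbounded (x *m pi h) K1 := mxboundedM dx0 xd (pib Gh).
  have b2 : mxbounded (1%:M - pw N.+1) (d1 + c).
    move=> i j; rewrite mxE [X in _ + X]mxE; apply: le_trans (ler_normB _ _) _.
    exact: lerD (d1d i j) (pwb N.+1 i j).
  have b3 : mxbounded (D *m (1%:M - pw N.+1)) K2 := mxboundedM dD0 Dd b2.
  have b4 := mxboundedM K10 b1 b3.
  have b5 : mxbounded (pi h' *m y) K3 := mxboundedM c0 (pib Gh') yd.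
  exact: (mxboundedM (mulr_ge0 (ler0n _ _) (mulr_ge0 K10 K20)) b4 b5 0 0).
rewrite mulrC ler_pdivrMr ?ltr0n // mulrC -ler_pdivrMr //.
apply: (@le_trans _ _ N%:R); last by rewrite ler_nat.
by apply: ltW; apply: le_lt_trans hN; rewrite ger0_norm // divr_ge0 // ltW.
Qed.

End Ergodic.

(** * Tensor words in coordinates *)

Section HilbertFacts.
Variable R : realType.
Local Notation C := (Cplx R).
Implicit Types X Y Z : hilbert R.

Lemma hdotC X (x y : X) : hdot x y = (hdot y x)^*.
Proof. by rewrite hermC expr0 mul1r. Qed.

Lemma hdotZl X a (x y : X) : hdot (a *: x) y = a * hdot x y.
Proof. exact: linearZl_LR. Qed.

Lemma hdotZr X a (x y : X) : hdot x (a *: y) = a^* * hdot x y.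
Proof. exact: linearZr_LR. Qed.

Lemma hdotDl X (x x' y : X) : hdot (x + x') y = hdot x y + hdot x' y.
Proof. exact: linearDl. Qed.

Lemma hdotDr X (x y y' : X) : hdot x (y + y') = hdot x y + hdot x y'.
Proof. exact: linearDr. Qed.

Lemma hdotBl X (x x' y : X) : hdot (x - x') y = hdot x y - hdot x' y.
Proof. by rewrite hdotDl -scaleN1r hdotZl mulN1r. Qed.

Lemma hdotBr X (x y y' : X) : hdot x (y - y') = hdot x y - hdot x y'.
Proof. by rewrite hdotC hdotBl rmorphB /= -!hdotC. Qed.

Lemma hdot_suml X (J : Type) (r : seq J) (P : pred J) (f : J -> X) y :
  hdot (\sum_(j <- r | P j) f j) y = \sum_(j <- r | P j) hdot (f j) y.
Proof. exact: linear_sumlz. Qed.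

Lemma hdot_sumr X (J : Type) (r : seq J) (P : pred J) (f : J -> X) y :
  hdot y (\sum_(j <- r | P j) f j) = \sum_(j <- r | P j) hdot y (f j).
Proof. exact: linear_sumr. Qed.

Lemma hdot_ge0 X (x : X) : 0 <= hdot x x.
Proof. exact: dnorm_ge0. Qed.

Lemma hdot_eq0 X (x : X) : (hdot x x == 0) = (x == 0).
Proof. exact: dnorm_eq0. Qed.

Lemma hdot_eq X (x y : X) : (forall z, hdot x z = hdot y z) -> x = y.
Proof.
move=> xy; apply/eqP; rewrite -subr_eq0 -hdot_eq0 hdotBl xy.
by rewrite subrr.
Qed.

Lemma adj_uniq X Y (f : 'Hom(X, Y)) (h : 'Hom(Y, X)) :
  (forall x y, hdot (f x) y = hdot x (h y)) -> h = adj f.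
Proof.
move=> fh; apply/lfunP => y; apply: hdot_eq => x.
by rewrite hdotC -fh adjE -hdotC.
Qed.

Lemma adjK X Y (f : 'Hom(X, Y)) : adj (adj f) = f.
Proof. by apply/esym/adj_uniq => x y; rewrite hdotC -adjE -hdotC. Qed.

Lemma adj_comp X Y Z (f : 'Hom(Y, Z)) (h : 'Hom(X, Y)) :
  adj (f \o h)%VF = (adj h \o adj f)%VF.
Proof. by apply/esym/adj_uniq => x y; rewrite !comp_lfunE !adjE. Qed.

Lemma linear_comb (F : fieldType) (W Z : vectType F) (f : W -> Z) (J : Type) (r : seq J)
    (c : J -> F) (x : J -> W) : linear f ->
  f (\sum_(j <- r) c j *: x j) = \sum_(j <- r) c j *: f (x j).
Proof.
move=> lin; rewrite -(linfunE lin) linear_sum; apply: eq_bigr => j _.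
by rewrite linearZ /= (linfunE lin).
Qed.

Lemma linear_pure_r X Y (x : X) : linear (@pure _ X Y x).
Proof.
move=> a y y'; apply/lfunP => phi.
by rewrite add_lfunE scale_lfunE !pureE scalerDr !scalerA mulrC.
Qed.

Lemma linear_pure_l X Y (y : Y) : linear (fun x : X => pure x y).
Proof.
move=> a x x'; apply/lfunP => phi.
by rewrite add_lfunE scale_lfunE !pureE linearP /= scalerDl scalerA.
Qed.

Lemma pure_combl X Y (J : Type) (r : seq J) (c : J -> C) (x : J -> X) (y : Y) :
  pure (\sum_(j <- r) c j *: x j) y =
  \sum_(j <- r) c j *: (pure (x j) y : tensor_hilbert X Y).
Proof. exact: (linear_comb _ _ _ (@linear_pure_l X Y y)). Qed.

Lemma pure_combr X Y (J : Type) (r : seq J) (c : J -> C) (x : X) (y : J -> Y) :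
  pure x (\sum_(j <- r) c j *: y j) =
  \sum_(j <- r) c j *: (pure x (y j) : tensor_hilbert X Y).
Proof. exact: (linear_comb _ _ _ (@linear_pure_r X Y x)). Qed.

Lemma tensor_expand X Y (J : finType) (b : J -> X) (S : tensor_hilbert X Y) :
  (forall x : X, x = \sum_j hdot x (b j) *: b j) ->
  exists y : J -> Y, S = \sum_j pure (b j) (y j).
Proof.
move=> bs.
have lin j : linear (fun x : X => hdot x (b j) : C^o).
  by move=> a x x'; rewrite hdotDl hdotZl.
pose phi j : 'Hom(X, C^o) := linfun (fun x : X => hdot x (b j) : C^o).
exists (fun j => (S : 'Hom('Hom(X, C^o), Y)) (phi j)).
apply/lfunP => psi.
have psiE : psi = \sum_j (psi (b j) : C) *: phi j.
  apply/lfunP => x; rewrite [in LHS](bs x) sum_lfunE linear_sum.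
  apply: eq_bigr => j _; rewrite linearZ scale_lfunE (linfunE (lin j)) /=.
  by rewrite [LHS]mulrC.
by rewrite {1}psiE linear_sum sum_lfunE; apply: eq_bigr => j _; rewrite linearZ pureE.
Qed.

End HilbertFacts.

(** Multi-indices are nested pairs, so that recursion on a word computes on its indices and its
    tensor space alike. *)
Fixpoint idx (d : nat) (w : seq letter) : finType :=
  if w is _ :: w' then ('I_d * idx d w')%type else unit.

Section TensorEntry.
Variables (K : comPzRingType) (d : nat).
Implicit Types (A B : letter -> 'I_d -> 'I_d -> K) (w : seq letter).

(** Entries of a Kronecker product along the word. The coefficients range over any commutative ring
    because [comm_line] uses matrices of polynomials. *)
Fixpoint tensor_entry A w : idx d w -> idx d w -> K :=
  match w return idx d w -> idx d w -> K with
  | [::] => fun _ _ => 1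
  | l :: w' => fun i j => A l i.1 j.1 * @tensor_entry A w' i.2 j.2
  end.

Lemma tensor_entryM A B D w i j :
  (forall l i j, A l i j = \sum_k B l i k * D l k j) ->
  @tensor_entry A w i j = \sum_k @tensor_entry B w i k * tensor_entry D k j.
Proof.
move=> e; elim: w i j => [|l w IH] i j /=.
  by rewrite (big_pred1 tt) ?mulr1 // => [[]].
rewrite e IH big_distrlr pair_bigA; apply: eq_bigr => k _ /=.
by rewrite mulrACA.
Qed.

Lemma tensor_entry1 A w i j : (forall l i j, A l i j = (i == j)%:R) ->
  @tensor_entry A w i j = (i == j)%:R.
Proof.
move=> e; elim: w i j => [|l w IH] i j /=; first by case: i j => [] [].
by rewrite e IH -natrM mulnb; congr (_%:R); case: i j => i1 i2 [j1 j2].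
Qed.

Lemma tensor_entry_ext A B w i j : (forall l i j, A l i j = B l i j) ->
  @tensor_entry A w i j = @tensor_entry B w i j.
Proof. by move=> e; elim: w i j => //= l w IH i j; rewrite e IH. Qed.

End TensorEntry.

Lemma tensor_entry_morph (K L : comPzRingType) (f : {rmorphism K -> L}) d
    (A : letter -> 'I_d -> 'I_d -> K) w (i j : idx d w) :
  f (tensor_entry A i j) = tensor_entry (fun l i j => f (A l i j)) i j.
Proof. by elim: w i j => [|l w IH] i j /=; rewrite ?rmorph1 ?rmorphM ?IH. Qed.

Section Coordinates.
Variables (R : realType) (V : hilbert R).
Local Notation C := (Cplx R).
Local Notation d := (\dim (fullv : {vspace V})).
Local Notation idx := (idx d).
Local Notation tens := (tens V).

(** For unitary g the contragredient has the conjugate matrix in the dual orthonormal basis, whence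
    the conjugate on [dual]; see [letter_act_lvec]. *)
Definition entry (g : 'End(V)) (l : letter) (i j : 'I_d) : C :=
  let c := hdot (g (onb V)`_j) (onb V)`_i in if l is std then c else c^*.

Definition lvec (l : letter) (i : 'I_d) : letter_space V l :=
  match l return letter_space V l with
  | std => (onb V)`_i
  | dual => dual_basis (onb V) i
  end.

Lemma onb_orthonormal (i j : 'I_d) : hdot (onb V)`_i (onb V)`_j = (i == j)%:R.
Proof.
have /andP[_ oe] := onbP V; have [ue ->] := orthonormalP oe.
- by rewrite nth_uniq ?size_tuple.
- by rewrite mem_nth ?size_tuple.
- by rewrite mem_nth ?size_tuple.
Qed.

Lemma hdot_lvec l i j : hdot (lvec l i) (lvec l j) = (i == j)%:R.
Proof.
case: l => /=; first exact: onb_orthonormal.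
exact: dual_orthonormal (onbP V).
Qed.

Lemma hdot_dual_basis (phi : dual_hilbert V) i :
  hdot phi (lvec dual i) = (phi : 'Hom(V, C^o)) (onb V)`_i :> C.
Proof.
rewrite [LHS]/(dual_form _ _) /dual_form (bigD1 i) //= big1 => [|j ji].
  by rewrite dual_basisE (hdot_coord (onbP V)) onb_orthonormal eqxx rmorph1 mulr1 addr0.
by rewrite dual_basisE (hdot_coord (onbP V)) onb_orthonormal (negPf ji) rmorph0 mulr0.
Qed.

Lemma lvec_sum l (x : letter_space V l) : x = \sum_i hdot x (lvec l i) *: lvec l i.
Proof.
case: l x => [|] x; first exact: onb_sum.
have /andP[be _] := onbP V.
rewrite [LHS](dual_basis_sum be); apply: eq_bigr => i _.
by rewrite hdot_dual_basis.
Qed.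

Fixpoint bv (w : seq letter) : idx w -> tens w :=
  match w return idx w -> tens w with
  | [::] => fun _ => (1 : C^o)
  | l :: w' => fun i => pure (lvec l i.1) (@bv w' i.2)
  end.

Arguments bv : clear implicits.

Lemma hdot_bv w i j : hdot (bv w i) (bv w j) = (i == j)%:R.
Proof.
elim: w i j => [|l w IH] i j /=.
  by case: i j => [] []; rewrite [LHS]/(cform _ _) /cform rmorph1 mulr1.
by rewrite hdot_pure IH hdot_lvec -natrM mulnb; case: i j => i1 i2 [j1 j2].
Qed.

Lemma bv_comb w (x : tens w) : exists c : idx w -> C, x = \sum_i c i *: bv w i.
Proof.
elim: w x => [|l w IH] x.
  exists (fun=> x : C); rewrite (big_pred1 tt) => [|[]] //.
  by rewrite /= -[RHS]/((x : C) * 1) mulr1.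
have [y ->] := tensor_expand x (@lvec_sum l).
have [c cE] := choice (fun j => IH (y j)).
exists (fun i => c i.1 i.2); rewrite -(pair_bigA _ (fun i j => c i j *: bv (l :: w) (i,
  j))) /=.
apply: eq_bigr => i _; rewrite {1}cE.
exact: pure_combr.
Qed.

Lemma bv_sum w (x : tens w) : x = \sum_i hdot x (bv w i) *: bv w i.
Proof.
have [c cE] := bv_comb x; rewrite {1}cE; apply: eq_bigr => i _; congr (_ *: _).
rewrite cE hdot_suml (bigD1 i) //= big1 => [|j ji].
  by rewrite hdotZl hdot_bv eqxx mulr1 addr0.
by rewrite hdotZl hdot_bv (negPf ji) mulr0.
Qed.

Lemma hdot_sum w (x y : tens w) :
  hdot x y = \sum_i hdot x (bv w i) * (hdot y (bv w i))^*.
Proof.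
rewrite {1}(bv_sum x) hdot_suml; apply: eq_bigr => i _.
by rewrite hdotZl -hdotC.
Qed.

Lemma tens_ext w (Z : vectType C) (f g : tens w -> Z) :
  linear f -> linear g -> (forall i, f (bv w i) = g (bv w i)) -> f =1 g.
Proof.
move=> lf lg fg x; rewrite (bv_sum x) !linear_comb //.
by apply: eq_bigr => i _; rewrite fg.
Qed.

Lemma hom_ext w (Z : vectType C) (F G : 'Hom(tens w, Z)) :
  (forall i, F (bv w i) = G (bv w i)) -> F = G.
Proof. by move=> FG; apply/lfunP; apply: tens_ext FG => a x y; rewrite linearP. Qed.

Definition hom_of u v (m : idx v -> idx u -> C) : 'Hom(tens u, tens v) :=
  linfun (fun x => \sum_j hdot x (bv u j) *: \sum_i m i j *: bv v i).

Lemma hom_ofE u v m j : @hom_of u v m (bv u j) = \sum_i m i j *: bv v i.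
Proof.
rewrite /hom_of linfunE => [|a x y].
  rewrite (bigD1 j) //= [X in _ + X]big1 => [|k kj].
    by rewrite hdot_bv eqxx scale1r addr0.
  by rewrite hdot_bv eq_sym (negPf kj) scale0r.
rewrite scaler_sumr -big_split; apply: eq_bigr => j' _ /=.
by rewrite hdotDl hdotZl scalerDl scalerA.
Qed.

Lemma unitary_inv g : unitary g -> (g^-1)%VF = @adj _ V V g.
Proof.
move=> [ag ga].
have kg : lker g = 0%VS.
  apply/eqP; rewrite -subv0; apply/subvP => x; rewrite memv_ker memv0 => /eqP gx.
  by have := congr1 (fun f : 'End(V) => f x) ag;
    rewrite comp_lfunE gx linear0 id_lfunE => <-.
rewrite -[LHS]comp_lfun1r -ga comp_lfunA.
by rewrite (lker0_compVf (introT eqP kg)) comp_lfun1l.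
Qed.

Lemma letter_act_lvec g l j : unitary g ->
  letter_act g l (lvec l j) = \sum_i entry g l i j *: lvec l i.
Proof.
move=> ug; rewrite [LHS]lvec_sum; apply: eq_bigr => i _; congr (_ *: _).
case: l => //=; rewrite [LHS]hdot_dual_basis linfunE => [|a u v]; last first.
  by rewrite comp_lfunDl comp_lfunZl.
rewrite comp_lfunE unitary_inv // dual_basisE (hdot_coord (onbP V)).
by rewrite hdotC adjE.
Qed.

Lemma act_bv g w j : unitary g ->
  act g w (bv w j) = \sum_i tensor_entry (entry g) i j *: bv w i.
Proof.
move=> ug; elim: w j => [|l w IH] j.
  by rewrite (big_pred1 tt) => [|[]] //=; rewrite id_lfunE scale1r.
rewrite /= tensor_map_pure IH letter_act_lvec //.
rewrite pure_combl.
rewrite -(pair_bigA _ (fun i k =>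
  (entry g l i j.1 * tensor_entry (entry g) k j.2) *: bv (l :: w) (i, k))) /=.
apply: eq_bigr => i _; rewrite pure_combr scaler_sumr.
by apply: eq_bigr => k _; rewrite scalerA.
Qed.

End Coordinates.
Arguments bv {R V} w i.

(** * Unitary operators acting on tensor words *)

Section Unitary.
Variables (R : realType) (V : hilbert R).
Local Notation C := (Cplx R).
Local Notation d := (\dim (fullv : {vspace V})).
Local Notation idx := (idx d).
Local Notation tens := (tens V).
Implicit Types (g h : 'End(V)) (u v w : seq letter).

Local Notation adjV := (@adj R V V).

(* [pure], typed so that its result is visibly a tensor of a longer word. *)
Definition tcons l w (x : letter_space V l) (y : tens w) : tens (l :: w) := pure x y.

Lemma bv_cons l w (i : idx (l :: w)) :
  bv (V := V) (l :: w) i = tcons (lvec l i.1) (bv w i.2).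
Proof. by []. Qed.

Lemma tcons_combl l w (J : Type) (r : seq J) (c : J -> C) (x : J -> letter_space V l)
    (y : tens w) :
  tcons (\sum_(j <- r) c j *: x j) y = \sum_(j <- r) c j *: tcons (x j) y.
Proof. exact: pure_combl. Qed.

Lemma tcons_combr l w (J : Type) (r : seq J) (c : J -> C) (x : letter_space V l)
    (y : J -> tens w) :
  tcons x (\sum_(j <- r) c j *: y j) = \sum_(j <- r) c j *: tcons x (y j).
Proof. exact: pure_combr. Qed.

Lemma tcons_sumr l w (J : Type) (r : seq J) (x : letter_space V l) (y : J -> tens w) :
  tcons x (\sum_(j <- r) y j) = \sum_(j <- r) tcons x (y j).
Proof.
have := tcons_combr r (fun=> 1) x y.
under eq_bigr do rewrite scale1r.
by under [RHS]eq_bigr do rewrite scale1r.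
Qed.

Lemma hom_sum u v (F : 'Hom(tens u, tens v)) (J : Type) (r : seq J) (x : J -> tens u) :
  F (\sum_(j <- r) x j) = \sum_(j <- r) F (x j).
Proof. exact: linear_sum. Qed.

Lemma hom_comb u v (F : 'Hom(tens u, tens v)) (J : Type) (r : seq J) (c : J -> C)
    (x : J -> tens u) :
  F (\sum_(j <- r) c j *: x j) = \sum_(j <- r) c j *: F (x j).
Proof. by rewrite hom_sum; apply: eq_bigr => j _; rewrite linearZ. Qed.

Lemma sum_delta (W : lmodType C) (J : finType) (i : J) (x : J -> W) :
  \sum_j (i == j)%:R *: x j = x i.
Proof.
rewrite (bigD1 i) //= big1 ?addr0 => [|j ji]; first by rewrite eqxx scale1r.
by rewrite eq_sym (negPf ji) scale0r.
Qed.

Lemma tcat_tcons l u v (x : letter_space V l) (y : tens u) (z : tens v) :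
  tcat (tcons x y) z = tcons x (tcat y z).
Proof. exact: tcat_pure. Qed.

Lemma hdot_tcons l w (x x' : letter_space V l) (y y' : tens w) :
  hdot (tcons x y) (tcons x' y') = hdot x x' * hdot y y'.
Proof. exact: hdot_pure. Qed.

Lemma act_tcons g l w (x : letter_space V l) (y : tens w) :
  act g (l :: w) (tcons x y) = tcons (letter_act g l x) (act g w y).
Proof. exact: tensor_map_pure. Qed.

Definition tens_one : tens [::] := (1 : C^o).

Lemma tcat_nil v (y : tens v) : tcat tens_one y = y.
Proof. exact: scale1r. Qed.

Lemma hdot_tcat u v (x x' : tens u) (y y' : tens v) :
  hdot (tcat x y) (tcat x' y') = hdot x x' * hdot y y'.
Proof.
have bb i j : hdot (tcat (bv u i) y) (tcat (bv u j) y') = (i == j)%:R * hdot y y'.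
  elim: u i j {x x'} => [|l u IH] i j.
    by case: i j => [] [] /=; rewrite !scale1r mul1r.
  rewrite !bv_cons !tcat_tcons hdot_tcons IH hdot_lvec mulrA -natrM mulnb.
  by case: i j => i1 i2 [j1 j2].
rewrite {1}(bv_sum x) {1}(bv_sum x').
rewrite !(linear_comb _ _ _ (@tcat_linearl _ _ u v _)) hdot_suml (hdot_sum x x')
  mulr_suml.
apply: eq_bigr => i _; rewrite hdot_sumr (bigD1 i) //= big1 => [|j ji].
  by rewrite addr0 hdotZl hdotZr bb eqxx mul1r mulrA.
by rewrite hdotZl hdotZr bb eq_sym (negPf ji) mul0r !mulr0.
Qed.

Lemma act_tcat g u v (x : tens u) (y : tens v) :
  act g (u ++ v) (tcat x y) = tcat (act g u x) (act g v y).
Proof.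
elim: u x => [|l u IH] x; first by rewrite /= linearZ id_lfunE.
apply: (tens_ext (f := fun x => act g ((l :: u) ++ v) (tcat x y))
  (g := fun x => tcat (act g (l :: u) x) (act g v y))).
- by move=> a z z'; rewrite tcat_linearl linearP.
- by move=> a z z'; rewrite linearP tcat_linearl.
by move=> i; rewrite bv_cons tcat_tcons !act_tcons IH tcat_tcons.
Qed.

Lemma unitary1 : unitary (\1%VF : 'End(V)).
Proof.
rewrite /unitary; have <- : \1%VF = adjV \1%VF by apply: adj_uniq => x y;
  rewrite !id_lfunE.
by split; rewrite comp_lfun1l.
Qed.

Lemma unitaryM g h : unitary g -> unitary h -> unitary (g \o h)%VF.
Proof.
move=> [g1 g2] [h1 h2]; rewrite /unitary (adj_comp (X := V) (Y := V) (Z := V)).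
split; rewrite comp_lfunA.
  by rewrite -[X in (X \o _)%VF]comp_lfunA g1 comp_lfun1r.
by rewrite -[X in (X \o _)%VF]comp_lfunA h2 comp_lfun1r.
Qed.

Lemma unitary_adj g : unitary g -> unitary (adjV g).
Proof. by move=> [g1 g2]; rewrite /unitary (adjK (X := V) (Y := V)). Qed.

Lemma unitary_adjl g : unitary g -> (adjV g \o g = \1)%VF.
Proof. by case. Qed.

Lemma unitary_adjr g : unitary g -> (g \o adjV g = \1)%VF.
Proof. by case. Qed.

Lemma entryM g h l i j : entry (g \o h)%VF l i j = \sum_k entry g l i k * entry h l k j.
Proof.
have e : hdot ((g \o h)%VF (onb V)`_j) (onb V)`_i =
    \sum_(k < d) hdot (g (onb V)`_k) (onb V)`_i * hdot (h (onb V)`_j) (onb V)`_k.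
  rewrite comp_lfunE {1}(onb_sum (h (onb V)`_j)) linear_sum hdot_suml.
  by apply: eq_bigr => k _; rewrite linearZ hdotZl mulrC.
case: l; rewrite /entry e // rmorph_sum; apply: eq_bigr => k _.
by rewrite rmorphM.
Qed.

Lemma entry1 l i j : entry (\1%VF : 'End(V)) l i j = (i == j)%:R.
Proof.
rewrite /entry id_lfunE onb_orthonormal eq_sym.
by case: l; rewrite // rmorph_nat.
Qed.

Lemma entry_adj g l i j : entry (adjV g) l i j = (entry g l j i)^*.
Proof.
have e : hdot (adjV g (onb V)`_j) (onb V)`_i = (hdot (g (onb V)`_i) (onb V)`_j)^*.
  by rewrite hdotC -adjE.
by rewrite /entry e; case: l.
Qed.

Lemma entry_norm g l i j : unitary g -> `|entry g l i j| <= 1.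
Proof.
move=> ug; have : \sum_k `|entry g l k j| ^+ 2 = 1.
  transitivity (\sum_k entry (adjV g) l j k * entry g l k j); last first.
    by rewrite -entryM unitary_adjl // entry1 eqxx.
  by apply: eq_bigr => k _; rewrite entry_adj normCK mulrC.
move=> s1; rewrite -(@expr_le1 _ 2) // -s1 (bigD1 i) //= lerDl.
by apply: sumr_ge0 => k _; rewrite exprn_ge0.
Qed.

Lemma tensor_entry_norm g w i j : unitary g -> `|@tensor_entry C d (entry g) w i j| <= 1.
Proof.
move=> ug; elim: w i j => [|l w IH] i j /=; first by rewrite normr1.
by rewrite normrM mulr_ile1 ?entry_norm.
Qed.

Lemma actM g h w : unitary g -> unitary h ->
  act (g \o h)%VF w = (act g w \o act h w)%VF.
Proof.
move=> ug uh; apply: hom_ext => j; rewrite comp_lfunE !act_bv //; last exact: unitaryM.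
rewrite linear_sum; under [RHS]eq_bigr do rewrite linearZ /= act_bv // scaler_sumr.
rewrite exchange_big; apply: eq_bigr => i _ /=.
rewrite (tensor_entryM (B := entry g) (D := entry h)) => [|l a b]; last exact: entryM.
by rewrite scaler_suml; apply: eq_bigr => k _; rewrite scalerA mulrC.
Qed.

Lemma act1 w : act (\1%VF : 'End(V)) w = \1%VF.
Proof.
apply: hom_ext => j; rewrite act_bv; last exact: unitary1.
rewrite id_lfunE (bigD1 j) //= big1 => [|k kj].
  by rewrite tensor_entry1 ?eqxx ?scale1r ?addr0 // => l a b; apply: entry1.
by rewrite tensor_entry1 ?(negPf kj) ?scale0r // => l a b; apply: entry1.
Qed.

Lemma hdot_act_bv g w i j : unitary g ->
  hdot (act g w (bv w j)) (bv w i) = tensor_entry (entry g) i j.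
Proof.
move=> ug; rewrite act_bv // hdot_suml (bigD1 i) //= big1 => [|k ki].
  by rewrite addr0 hdotZl hdot_bv eqxx mulr1.
by rewrite hdotZl hdot_bv (negPf ki) mulr0.
Qed.

Lemma tensor_entry_adj g w (i j : idx w) :
  tensor_entry (entry (adjV g)) i j = (tensor_entry (entry g) j i)^*.
Proof.
elim: w i j => [|l w IH] i j /=; first by rewrite rmorph1.
by rewrite IH entry_adj rmorphM.
Qed.

Lemma adj_act g w : unitary g -> adj (act g w) = act (adjV g) w.
Proof.
move=> ug; have ug' := unitary_adj ug; apply: hom_ext => i; rewrite act_bv //.
rewrite [LHS]bv_sum; apply: eq_bigr => j _; congr (_ *: _).
by rewrite hdotC -adjE hdot_act_bv // tensor_entry_adj.
Qed.

Lemma act_adjl g w : unitary g -> (adj (act g w) \o act g w)%VF = \1%VF.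
Proof.
by move=> ug; rewrite adj_act // -actM ?unitary_adjl ?act1 //; apply: unitary_adj.
Qed.

Lemma hdot_act g w x y : unitary g -> hdot (act g w x) (act g w y) = hdot x y.
Proof. by move=> ug; rewrite adjE -comp_lfunE act_adjl // id_lfunE. Qed.

Lemma unitary_of_entries (a : 'I_d -> 'I_d -> C) :
  (forall i j, \sum_k (a k i)^* * a k j = (i == j)%:R) ->
  (forall i j, \sum_k a i k * (a j k)^* = (i == j)%:R) ->
  exists2 g : 'End(V), unitary g & forall i j, entry g std i j = a i j.
Proof.
move=> a1 a2.
pose f (x : V) : V := \sum_(j < d) hdot x (onb V)`_j *: \sum_(i < d) a i j *: (onb V)`_i.
have lin : linear f.
  move=> c x y; rewrite /f scaler_sumr -big_split; apply: eq_bigr => j _ /=.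
  by rewrite hdotDl hdotZl scalerDl scalerA.
have ent i j : entry (linfun f) std i j = a i j.
  rewrite /entry (linfunE lin) /f hdot_suml (bigD1 j) //= [X in _ + X]big1 => [|k kj];
    last first.
    by rewrite hdotZl onb_orthonormal eq_sym (negPf kj) mul0r.
  rewrite addr0 onb_orthonormal eqxx scale1r hdot_suml (bigD1 i) //= big1 => [|k ki].
    by rewrite hdotZl onb_orthonormal eqxx mulr1 addr0.
  by rewrite hdotZl onb_orthonormal (negPf ki) mulr0.
have eqg (g h : 'End(V)) : (forall i j, entry g std i j = entry h std i j) -> g = h.
  move=> gh; apply/lfunP => x; rewrite (onb_sum x) !linear_sum; apply: eq_bigr => j _.
  rewrite !linearZ /=; congr (_ *: _); rewrite [LHS]onb_sum [RHS]onb_sum.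
  by apply: eq_bigr => i _; congr (_ *: _); apply: gh.
exists (linfun f) => //; split; apply: eqg => i j; rewrite entry1 entryM.
  by rewrite -a1; apply: eq_bigr => k _; rewrite entry_adj !ent.
by rewrite -a2; apply: eq_bigr => k _; rewrite entry_adj !ent.
Qed.

End Unitary.
Arguments tens_one {R} V.

(** * Orthonormal frames and the Hilbert-Schmidt product *)

(** A subspace of maximal dimension inside P exhausts it, since a missing element would span a line
    to add. This turns a predicate such as [generated] into a subspace with bases. *)
Lemma vspace_of_pred (F : fieldType) (W : vectType F) (P : W -> Prop) :
  P 0 -> (forall a x y, P x -> P y -> P (a *: x + y)) ->
  exists U : {vspace W}, forall x, x \in U <-> P x.
Proof.
move=> P0 PD.
pose Q k := `[< exists2 U : {vspace W}, forall x, x \in U -> P x & \dim U = k >].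
have exQ : exists k, Q k.
  exists 0%N; apply/asboolP; exists 0%VS; last exact: dimv0.
  by move=> x; rewrite memv0 => /eqP ->.
have Qle k : Q k -> (k <= \dim {:W})%N.
  by move=> /asboolP[U _ <-]; rewrite dimvS ?subvf.
case: (ex_maxnP exQ Qle) => k /asboolP[U UP dU] kmax.
exists U => x; split; first exact: UP.
move=> Px; have : Q (\dim (<[x]> + U)%VS).
  apply/asboolP; exists (<[x]> + U)%VS => // _ /memv_addP[_ /vlineP[a ->] [y yU ->]].
  by apply: PD => //; apply: UP.
move=> /kmax; rewrite -dU => le.
have /eqP UU : U == (<[x]> + U)%VS by rewrite eqEdim addvSr.
by rewrite UU memvE addvSl.
Qed.

(** The list is an orthonormal basis of the subspace cut out by P; the reproducing formula is what
    orthogonal projection onto P uses. *)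
Lemma frame_exists (R : realType) (X : hilbert R) (P : X -> Prop) :
  P 0 -> (forall a x y, P x -> P y -> P (a *: x + y)) ->
  exists2 t : seq X, forall x, x \in t -> P x &
    forall y, P y -> y = \sum_(x <- t) hdot y x *: x.
Proof.
move=> P0 PD; have [U UP] := vspace_of_pred P0 PD.
have [t ot ts] := orthonormal_span (vbasis U).
have spanU : <<t>>%VS = U by rewrite ts (span_basis (vbasisP U)).
exists t => [x xt|y /UP]; first by apply/UP; rewrite -spanU memv_span.
rewrite -spanU => /(@coord_span _ _ _ (in_tuple t)) /= yE.
have fr := orthonormal_free ot.
have [ut ott] := orthonormalP ot.
rewrite {1}yE (big_nth 0) big_mkord; apply: eq_bigr => i _.
rewrite -[X in hdot X _]/y [in RHS]yE hdot_suml (bigD1 i) //= big1 => [|j ji].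
  by rewrite hdotZl ott ?mem_nth // eqxx mulr1 addr0.
by rewrite hdotZl ott ?mem_nth // nth_uniq // (inj_eq val_inj) (negPf ji) mulr0.
Qed.

Section HilbertSchmidt.
Variables (R : realType) (V : hilbert R).
Local Notation C := (Cplx R).
Local Notation d := (\dim (fullv : {vspace V})).
Local Notation tens := (tens V).
Implicit Types (u v w : seq letter).

(* The Hilbert-Schmidt scalar product. *)
Definition hs u v (X Y : 'Hom(tens u, tens v)) : C :=
  \sum_j hdot (X (bv u j)) (Y (bv u j)).

Lemma hs_lin u v (Z : 'Hom(tens u, tens v)) : linear_for *%R (@hs u v ^~ Z).
Proof.
move=> a X Y; rewrite /hs mulr_sumr -big_split; apply: eq_bigr => j _ /=.
by rewrite add_lfunE scale_lfunE hdotDl hdotZl.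
Qed.

Lemma hs_herm u v (X Y : 'Hom(tens u, tens v)) : hs X Y = (hs Y X)^*.
Proof. by rewrite /hs rmorph_sum; apply: eq_bigr => j _; rewrite /= -hdotC. Qed.

Lemma hs_pos u v (X : 'Hom(tens u, tens v)) : X != 0 -> 0 < hs X X.
Proof.
move=> X0; rewrite lt_neqAle sumr_ge0 ?andbT => [|j _]; last exact: hdot_ge0.
apply: contra_neq X0 => /esym/psumr_eq0P s0; apply: hom_ext => j; rewrite lfunE /=.
by apply/eqP; rewrite -hdot_eq0; apply/eqP; apply: s0 => // k _; apply: hdot_ge0.
Qed.

Definition hom_hilbert u v : hilbert R :=
  Hilbert (mkdot (@hs_lin u v) (@hs_herm u v) (@hs_pos u v)).

Lemma hs_frame u v (P : 'Hom(tens u, tens v) -> Prop) :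
  P 0 -> (forall a X Y, P X -> P Y -> P (a *: X + Y)) ->
  exists2 t : seq 'Hom(tens u, tens v), forall X, X \in t -> P X &
    forall X, P X -> X = \sum_(Y <- t) hs X Y *: Y.
Proof. exact: (@frame_exists _ (hom_hilbert u v)). Qed.

Lemma hs_adjl u v w (A : 'Hom(tens v, tens w)) (X : 'Hom(tens u, tens v)) Y :
  hs (A \o X)%VF Y = hs X (adj A \o Y)%VF.
Proof. by apply: eq_bigr => j _; rewrite !comp_lfunE adjE. Qed.

Lemma hs_entries u v (X Y : 'Hom(tens u, tens v)) :
  hs X Y = \sum_j \sum_i hdot (X (bv u j)) (bv v i) * (hdot (Y (bv u j)) (bv v i))^*.
Proof. by apply: eq_bigr => j _; rewrite hdot_sum. Qed.

Lemma hs_adj u v (X Y : 'Hom(tens u, tens v)) : hs X Y = hs (adj Y) (adj X).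
Proof.
rewrite !hs_entries exchange_big; apply: eq_bigr => i _; apply: eq_bigr => j _ /=.
rewrite [hdot (adj Y _) _]hdotC [hdot (adj X _) _]hdotC -!adjE conjCK.
by rewrite mulrC.
Qed.

Lemma hs_adjr u v w (A : 'Hom(tens w, tens u)) (X : 'Hom(tens u, tens v)) Y :
  hs (X \o A)%VF Y = hs X (Y \o adj A)%VF.
Proof. by rewrite hs_adj adj_comp hs_herm hs_adjl [RHS]hs_adj adj_comp [RHS]hs_herm. Qed.

End HilbertSchmidt.

(** * Generated morphisms *)

Section Generated.
Variables (R : realType) (V : hilbert R).
Local Notation C := (Cplx R).
Local Notation d := (\dim (fullv : {vspace V})).
Local Notation tens := (tens V).
Variable e : d.-tuple V.
Hypothesis he : basis_of fullv e.
Variables (I : Type) (w : I -> seq letter) (T : forall i, tens (w i)).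
Local Notation generator := (generator e T).
Local Notation composite := (composite e T).
Local Notation generated := (generated e T).

Lemma composite_comp u v t (F : 'Hom(tens v, tens t)) (G : 'Hom(tens u, tens v)) :
  composite F -> composite G -> composite (F \o G)%VF.
Proof.
move=> cF; elim: cF G => [v'|a b x y z f F' G' gf wf cG' IH] G cG.
  by rewrite comp_lfun1l.
by rewrite -comp_lfunA; apply: (composite_step gf wf); apply: IH.
Qed.

Lemma generated_composite u v (F : 'Hom(tens u, tens v)) : composite F -> generated F.
Proof.
by move=> cF; exists 1%N, (fun=> 1), (fun=> F); split => //; rewrite big_ord1 scale1r.
Qed.

Lemma generated0 u v : generated (0 : 'Hom(tens u, tens v)).
Proof. by exists 0%N, (fun=> 0), (fun=> 0); split; [case|rewrite big_ord0]. Qed.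

Lemma generatedD u v a (F G : 'Hom(tens u, tens v)) :
  generated F -> generated G -> generated (a *: F + G).
Proof.
move=> [k [c [H [cH ->]]]] [k' [c' [H' [cH' ->]]]].
exists (k + k')%N, (fun i => match split i with inl j => a * c j | inr j => c' j end).
exists (fun i => match split i with inl j => H j | inr j => H' j end); split.
  by move=> i; case: (split i).
rewrite big_split_ord scaler_sumr; congr (_ + _); apply: eq_bigr => i _ /=.
  by rewrite -[lshift _ _]/(unsplit (inl i)) unsplitK scalerA.
by rewrite -[rshift _ _]/(unsplit (inr i)) unsplitK.
Qed.

Lemma generated_sum_seq u v (r : seq 'Hom(tens u, tens v))
    (c : 'Hom(tens u, tens v) -> C) :
  (forall F, F \in r -> generated F) -> generated (\sum_(F <- r) c F *: F).
Proof.
elim: r => [|F r IH] gr; first by rewrite big_nil; apply: generated0.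
rewrite big_cons; apply: generatedD; first by apply: gr; rewrite inE eqxx.
by apply: IH => G Gr; apply: gr; rewrite inE Gr orbT.
Qed.

Lemma generated_comp_l u v t (F : 'Hom(tens v, tens t)) (G : 'Hom(tens u, tens v)) :
  composite F -> generated G -> generated (F \o G)%VF.
Proof.
move=> cF [k [c [H [cH ->]]]]; exists k, c, (fun i => F \o H i)%VF; split.
  by move=> i; apply: composite_comp.
apply/lfunP => x; rewrite comp_lfunE !sum_lfunE linear_sum.
by apply: eq_bigr => i _; rewrite !scale_lfunE linearZ comp_lfunE.
Qed.

Lemma generated_comp_r u v t (F : 'Hom(tens v, tens t)) (G : 'Hom(tens u, tens v)) :
  generated F -> composite G -> generated (F \o G)%VF.
Proof.
move=> [k [c [H [cH ->]]]] cG; exists k, c, (fun i => H i \o G)%VF; split.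
  by move=> i; apply: composite_comp.
apply/lfunP => x; rewrite comp_lfunE !sum_lfunE.
by apply: eq_bigr => i _; rewrite !scale_lfunE comp_lfunE.
Qed.

(** Whiskering on the right only. Identities on the left are added one letter at a time by [lmap],
    so that the words agree by computation. *)
Definition front u v b (f : 'Hom(tens u, tens v))
    (F : 'Hom(tens (u ++ b), tens (v ++ b))) :=
  forall y z, F (tcat y z) = tcat (f y) z.

Lemma composite_front u v b (f : 'Hom(tens u, tens v))
    (F : 'Hom(tens (u ++ b), tens (v ++ b))) :
  generator f -> front f F -> composite F.
Proof.
move=> gf fF; rewrite -[F]comp_lfun1r.
apply: (@composite_step _ _ _ _ _ _ [::] b u v (u ++ b) f F \1%VF gf) => [x y z|].
  change (F ((x : C) *: tcat y z) = (x : C) *: tcat (f y) z).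
  by rewrite linearZ /= fF.
exact: composite_id.
Qed.

Lemma front_exists u v b (f : 'Hom(tens u, tens v)) : exists F, @front u v b f F.
Proof.
have [|x|F FE] := @tcat_univ R V u b _ (fun y z => tcat (f y) z).
- by move=> z c y y'; rewrite linearP tcat_linearl.
- exact: tcat_linearr.
by exists F.
Qed.

Lemma front_adj u v b (f : 'Hom(tens u, tens v)) F :
  @front u v b f F -> front (adj f) (adj F).
Proof.
move=> fF y z; apply: hdot_eq => x; rewrite hdotC [RHS]hdotC; congr (_^*).
have lin t : linear (fun x : tens (u ++ b) => hdot x t : C^o).
  by move=> a x1 x2; rewrite hdotDl hdotZl.
rewrite -(linfunE (lin _)) -[RHS](linfunE (lin _)); congr (fun_of_lfun _ x).
apply: tcat_ext => y' z'; rewrite !(linfunE (lin _)).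
by rewrite -adjE fF !hdot_tcat adjE.
Qed.

Definition lmap l u v (F : 'Hom(tens u, tens v)) : 'Hom(tens (l :: u), tens (l :: v)) :=
  tensor_map (\1%VF : 'End(letter_space V l)) F.

Lemma lmap_tcons l u v (F : 'Hom(tens u, tens v)) x y :
  lmap l F (tcons x y) = tcons x (F y).
Proof.
have := tensor_map_pure (\1%VF : 'End(letter_space V l)) F x y.
by rewrite id_lfunE.
Qed.

Lemma lmap_whisker l a b u v (f : 'Hom(tens u, tens v)) F :
  @whisker R V a b u v f F -> @whisker R V (l :: a) b u v f (lmap l F).
Proof.
move=> wF x y z.
apply: (@tens_ext R V (l :: a) (tens (l :: (a ++ v ++ b)))
  (fun x => lmap l F (@tcat R V (l :: a) (u ++ b) x (tcat y z)))
  (fun x => @tcat R V (l :: a) (v ++ b) x (tcat (f y) z))).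
- by move=> c x1 x2; rewrite (tcat_linearl _ _ x1 x2) linearP.
- by move=> c x1 x2; rewrite (tcat_linearl _ _ x1 x2).
by move=> i; rewrite bv_cons !tcat_tcons lmap_tcons wF.
Qed.

Lemma lmap_id l u : lmap l (\1%VF : 'End(tens u)) = \1%VF.
Proof. by apply: hom_ext => i; rewrite bv_cons lmap_tcons !id_lfunE. Qed.

Lemma lmap_comp l u v t (F : 'Hom(tens v, tens t)) (G : 'Hom(tens u, tens v)) :
  lmap l (F \o G)%VF = (lmap l F \o lmap l G)%VF.
Proof. by apply: hom_ext => i; rewrite comp_lfunE bv_cons !lmap_tcons comp_lfunE. Qed.

Lemma composite_lmap l u v (F : 'Hom(tens u, tens v)) :
  composite F -> composite (lmap l F).
Proof.
elim=> [u'|a b x y z f F' G' gf wf cG' IH]; first by rewrite lmap_id; apply: composite_id.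
rewrite lmap_comp.
apply: (@composite_step _ _ _ _ _ _ (l :: a) b x y _ f _ _ gf _ IH).
exact: lmap_whisker.
Qed.

Lemma lmap_comb l u v (J : Type) (r : seq J) (c : J -> C)
    (F : J -> 'Hom(tens u, tens v)) :
  lmap l (\sum_(j <- r) c j *: F j) = \sum_(j <- r) c j *: lmap l (F j).
Proof.
apply: hom_ext => i; rewrite bv_cons lmap_tcons !sum_lfunE.
under eq_bigr do rewrite scale_lfunE.
rewrite tcons_combr; apply: eq_bigr => j _.
by rewrite scale_lfunE lmap_tcons.
Qed.

Lemma generated_lmap l u v (F : 'Hom(tens u, tens v)) :
  generated F -> generated (lmap l F).
Proof.
move=> [k [c [H [cH ->]]]]; exists k, c, (fun i => lmap l (H i)); split.
  by move=> i; apply: composite_lmap.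
exact: lmap_comb.
Qed.

Definition bar (l : letter) := if l is std then dual else std.

Lemma tensor2E k l (x : letter_space V k) (y : letter_space V l) :
  tensor2 x y = tcons x (tcons y (tens_one V)).
Proof. by []. Qed.

Lemma tcat_tensor2 k l b (x : letter_space V k) (y : letter_space V l) (z : tens b) :
  tcat (tensor2 x y) z = tcons x (tcons y z).
Proof. by rewrite tensor2E !tcat_tcons tcat_nil. Qed.

Lemma hdot_tensor2 k l (x x' : letter_space V k) (y y' : letter_space V l) :
  hdot (tensor2 x y) (tensor2 x' y') = hdot x x' * hdot y y'.
Proof.
rewrite !tensor2E !hdot_tcons; congr (_ * _).
by rewrite [X in _ * X]/(cform _ _) /cform rmorph1 !mulr1.
Qed.

Lemma tensor2_combl k l (J : Type) (r : seq J) (c : J -> C) (x : J -> letter_space V k)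
  (y : letter_space V l) :
  tensor2 (\sum_(j <- r) c j *: x j) y = \sum_(j <- r) c j *: tensor2 (x j) y.
Proof. exact: tcons_combl. Qed.

Lemma tensor2_combr k l (J : Type) (r : seq J) (c : J -> C) (x : letter_space V k)
  (y : J -> letter_space V l) :
  tensor2 x (\sum_(j <- r) c j *: y j) = \sum_(j <- r) c j *: tensor2 x (y j).
Proof. by rewrite tensor2E tcons_combl; apply: tcons_combr. Qed.

Lemma tensor_hom1 v (t : tens v) : tensor_hom t (tens_one V) = t.
Proof.
rewrite /tensor_hom linfunE ?scale1r // => a x y.
by rewrite scalerDl scalerA.
Qed.

Lemma dual_lvec_sum (i : 'I_d) :
  lvec dual i = \sum_(k < d) hdot e`_k (onb V)`_i *: dual_basis e k :> letter_space V
    dual.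
Proof.
rewrite [LHS](dual_basis_sum he); apply: eq_bigr => k _; congr (_ *: _).
by rewrite dual_basisE (hdot_coord (onbP V)).
Qed.

(** The canonical tensor does not depend on the basis. Passing from [e], which need not be
    orthonormal, to [onb] makes the adjoint of r a plain contraction. *)
Lemma rmor1 : rmor e (tens_one V) =
    \sum_i @tensor2 R V dual std (lvec dual i) (lvec std i).
Proof.
rewrite /rmor tensor_hom1.
under eq_bigr do rewrite (onb_sum e`_ _) (@tensor2_combr dual std).
rewrite exchange_big; apply: eq_bigr => i _ /=.
by rewrite -[RHS]/(@tensor2 R V dual std (lvec dual i) (onb V)`_i) dual_lvec_sum
  tensor2_combl.
Qed.

Lemma rbarmor1 : rbarmor e (tens_one V) =
    \sum_i @tensor2 R V std dual (lvec std i) (lvec dual i).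
Proof.
rewrite /rbarmor tensor_hom1.
under eq_bigr do rewrite (onb_sum e`_ _) (@tensor2_combl std dual).
rewrite exchange_big; apply: eq_bigr => i _ /=.
by rewrite -[RHS]/(@tensor2 R V std dual (onb V)`_i (lvec dual i)) dual_lvec_sum
  tensor2_combr.
Qed.

Lemma cup_exists l : exists2 f : 'Hom(tens [::], tens [:: l; bar l]),
  generator f /\ generator (adj f) &
  f (tens_one V) = \sum_i tensor2 (lvec l i) (lvec (bar l) i).
Proof.
case: l.
  by exists (rbarmor e); [split; constructor|apply: rbarmor1].
by exists (rmor e); [split; constructor|apply: rmor1].
Qed.

Lemma tcat_suml u v (J : Type) (r : seq J) (x : J -> tens u) (y : tens v) :
  tcat (\sum_(j <- r) x j) y = \sum_(j <- r) tcat (x j) y.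
Proof.
have := linear_comb r (fun=> 1) x (@tcat_linearl R V u v y).
under eq_bigr do rewrite scale1r.
by under [RHS]eq_bigr do rewrite scale1r.
Qed.

Lemma cup_front l q : exists2 F : 'Hom(tens q, tens [:: l, bar l & q]), composite F &
  forall z, F z = \sum_i tcons (lvec l i) (tcons (lvec (bar l) i) z).
Proof.
have [f [gf _] fE] := cup_exists l; have [F fF] := front_exists q f.
exists F; first exact: composite_front gf fF.
move=> z; rewrite -[z in LHS]tcat_nil fF fE tcat_suml.
by apply: eq_bigr => i _; apply: tcat_tensor2.
Qed.

Lemma cap_front l q : exists2 F : 'Hom(tens [:: l, bar l & q], tens q), composite F &
  forall i j z, F (tcons (lvec l i) (tcons (lvec (bar l) j) z)) = (i == j)%:R *: z.
Proof.
have [f [_ gf] fE] := cup_exists l; have [F fF] := front_exists q (adj f).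
exists F; first exact: composite_front gf fF.
move=> i j z; rewrite -tcat_tensor2 fF.
set x := adj f _.
have -> : x = (i == j)%:R :> C.
  have -> : x = (hdot (1 : unit_hilbert R) x)^* :> C.
    by rewrite [X in _ = X^*]/(cform _ _) /cform mul1r conjCK.
  rewrite -[hdot _ _]/(hdot (tens_one V) x) /x -adjE fE hdot_suml rmorph_sum.
  rewrite (bigD1 i) //= big1 => [|k ki].
    by rewrite addr0 hdot_tensor2 !hdot_lvec eqxx mul1r rmorph_nat.
  by rewrite hdot_tensor2 !hdot_lvec (negPf ki) mul0r rmorph0.
by [].
Qed.

Lemma flip_front q : exists2 F : 'End(tens [:: std, std & q]), composite F &
  forall (x y : letter_space V std) z, F (tcons x (tcons y z)) = tcons y (tcons x z).
Proof.
have [F fF] := front_exists q (flip V).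
exists F; first exact: composite_front (gen_flip _ _) fF.
by move=> x y z; rewrite -!tcat_tensor2 fF flipE.
Qed.

(* On [dual :: std :: q], create a pair [std, dual] behind, flip the two
   adjacent copies of V and annihilate the leading pair [dual, std]. *)
Lemma cross_front q :
  exists2 F : 'Hom(tens [:: dual, std & q], tens [:: std, dual & q]), composite F &
  forall i j z, F (tcons (lvec dual i) (tcons (lvec std j) z)) =
    tcons (lvec std j) (tcons (lvec dual i) z).
Proof.
have [F1 c1 E1] := cup_front std q.
have [F2 c2 E2] := flip_front (dual :: q).
have [F3 c3 E3] := cap_front dual [:: std, dual & q].
exists (F3 \o (lmap dual F2 \o lmap dual (lmap std F1)))%VF.
  apply: (composite_comp c3); apply: composite_comp; first exact: composite_lmap.
  by apply: composite_lmap; apply: composite_lmap.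
have {}E1 z : F1 z = \sum_k tcons (lvec std k) (tcons (lvec dual k) z) by apply: E1.
have {}E3 i j z : F3 (tcons (lvec dual i) (tcons (lvec std j) z)) = (i == j)%:R *: z.
  by apply: E3.
move=> i j z; rewrite !comp_lfunE !lmap_tcons E1 tcons_sumr hom_sum.
under eq_bigr do rewrite E2.
rewrite tcons_sumr hom_sum; under eq_bigr do rewrite E3.
exact: sum_delta.
Qed.

End Generated.

(** * The first fundamental theorem for U(V) *)

Section Bending.
Variables (R : realType) (V : hilbert R).
Local Notation C := (Cplx R).
Local Notation d := (\dim (fullv : {vspace V})).
Local Notation idx := (idx d).
Local Notation tens := (tens V).
Variable e : d.-tuple V.
Hypothesis he : basis_of fullv e.
Variables (I : Type) (w : I -> seq letter) (T : forall i, tens (w i)).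
Local Notation generated := (generated e T).
Local Notation tent g := (tensor_entry (entry g)).

(** The relation m = g m g^* in entries, that is, commutation of [hom_of m] with every unitary; in
    this shape moving a letter to the other side only regroups factors. *)
Definition invariant_form u v (m : idx v -> idx u -> C) :=
  forall g : 'End(V), unitary g ->
  forall i j, m i j = \sum_k \sum_l tent g i k * m k l * (tent g j l)^*.

Definition first_fundamental u v :=
    forall m : idx v -> idx u -> C, invariant_form m -> generated (hom_of m).

Lemma entry_bar g l i j : entry g (bar l) i j = (@entry R V g l i j)^*.
Proof. by case: l; rewrite /entry /= ?conjCK. Qed.

Lemma sum_idx_cons (W : nmodType) l u (f : idx (l :: u) -> W) :
  \sum_k f k = \sum_a \sum_b f ((a, b) : idx (l :: u)).
Proof.
rewrite (pair_bigA _ (fun a b => f ((a, b) : idx (l :: u)))).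
by apply: eq_bigr => [[]].
Qed.

Lemma tensor_entry_cons (K : comPzRingType) (B : letter -> 'I_d -> 'I_d -> K) l u
    (i k : idx (l :: u)) :
  tensor_entry B i k = B l i.1 k.1 * tensor_entry B i.2 k.2.
Proof. by []. Qed.

(** Frobenius reciprocity: conjugating an entry on l gives the entry on [bar l], so the bent matrix
    is still invariant, and a cap undoes the bending. *)
Lemma bend_source l u v : first_fundamental u (bar l :: v) ->
  first_fundamental (l :: u) v.
Proof.
move=> H m im.
pose m' (k : idx (bar l :: v)) (j : idx u) := m k.2 ((k.1, j) : idx (l :: u)).
have im' : invariant_form m'.
  move=> g ug i j; rewrite /m' (im g ug) [RHS]sum_idx_cons [RHS]exchange_big.
  apply: eq_bigr => k _; rewrite sum_idx_cons; apply: eq_bigr => a _.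
  apply: eq_bigr => b _; rewrite !tensor_entry_cons entry_bar rmorphM /=; ring.
have [F cF FE] := cap_front he T l v.
have -> : hom_of m = (F \o lmap l (hom_of m'))%VF.
  apply: hom_ext => j; rewrite hom_ofE comp_lfunE bv_cons lmap_tcons hom_ofE.
  rewrite tcons_combr hom_comb [RHS]sum_idx_cons exchange_big; apply: eq_bigr => k _.
  under eq_bigr do rewrite bv_cons FE scalerA mulrC -scalerA.
  by rewrite sum_delta; case: j.
by apply: (generated_comp_l cF); apply: generated_lmap; apply: H.
Qed.

Lemma bend_target l u v : first_fundamental (bar l :: u) v ->
  first_fundamental u (l :: v).
Proof.
move=> H m im.
pose m' (k : idx v) (j : idx (bar l :: u)) := m ((j.1, k) : idx (l :: v)) j.2.
have im' : invariant_form m'.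
  move=> g ug i j; rewrite /m' (im g ug) sum_idx_cons exchange_big.
  apply: eq_bigr => k _; rewrite [RHS]sum_idx_cons; apply: eq_bigr => a _.
  apply: eq_bigr => b _; rewrite !tensor_entry_cons entry_bar rmorphM /= conjCK; ring.
have [F cF FE] := cup_front he T l u.
have -> : hom_of m = (lmap l (hom_of m') \o F)%VF.
  apply: hom_ext => j; rewrite hom_ofE comp_lfunE FE hom_sum sum_idx_cons.
  apply: eq_bigr => a _; rewrite lmap_tcons.
  rewrite -[tcons _ (bv u j)]/(bv (bar l :: u) ((a, j) : idx (bar l :: u))).
  by rewrite hom_ofE tcons_combr.
by apply: generated_comp_r cF; apply: generated_lmap; apply: H.
Qed.

Lemma cross_target u v : first_fundamental u [:: dual, std & v] ->
    first_fundamental u [:: std, dual & v].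
Proof.
move=> H m im.
pose s (k : idx [:: dual, std & v]) : idx [:: std, dual & v] := (k.2.1, (k.1, k.2.2)).
pose s' (k : idx [:: std, dual & v]) : idx [:: dual, std & v] := (k.2.1, (k.1, k.2.2)).
have sK : cancel s s' by case=> [? []].
have s'K : cancel s' s by case=> [? []].
have sb : bijective s by exists s'.
pose m' k j := m (s k) j.
have im' : invariant_form m'.
  move=> g ug i j; rewrite /m' (im g ug) (reindex s); last exact: onW_bij.
  apply: eq_bigr => k _; apply: eq_bigr => l _; rewrite !tensor_entry_cons.
  by congr (_ * _ * _); rewrite mulrCA.
have [F cF FE] := cross_front he T v.
have -> : hom_of m = (F \o hom_of m')%VF.
  apply: hom_ext => j; rewrite hom_ofE comp_lfunE hom_ofE hom_comb (reindex s);
    last exact: onW_bij.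
  by apply: eq_bigr => k _; congr (_ *: _); rewrite !bv_cons FE.
by apply: (generated_comp_l cF); apply: H.
Qed.

(** A dual letter at the front of the target can be bent into a standard letter of the source, and
    every source letter can be bent to the target. So it suffices to bring dual letters of the
    target to the front. *)
Lemma first_fundamental_of_std : (forall j k,
    first_fundamental (nseq j std) (nseq k std)) -> forall u v, first_fundamental u v.
Proof.
move=> base.
(* The leading standard letter is parked in the source as a dual one while the induction hypothesis
   acts on the rest, so letters are only ever crossed at the front. *)
have move_dual k u v : first_fundamental u (dual :: nseq k std ++ v) ->
  first_fundamental u (nseq k std ++ dual :: v).
  elim: k u => [//|k IH] u H /=.
  apply: (@bend_target std); apply: IH; apply: (@bend_source dual).
  by apply: cross_target.
have H v : forall j k, first_fundamental (nseq j std) (nseq k std ++ v).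
  elim: v => [|[] v IH] j k; first by rewrite cats0.
    have -> : nseq k std ++ std :: v = nseq k.+1 std ++ v by elim: (k) => //= n ->.
    exact: IH.
  by apply: move_dual; apply: (@bend_target dual); apply: (IH j.+1 k).
elim=> [|l u IH] v; first exact: (H v 0%N 0%N).
by apply: bend_source.
Qed.

End Bending.

(** * From unitary to arbitrary matrices *)

Section PolynomialZeros.
Variable F : fieldType.

Lemma poly_eq0_injective_roots (p : {poly F}) (s : nat -> F) :
  injective s -> (forall n, root p (s n)) -> p = 0.
Proof.
move=> si rp; apply/eqP/negP => /negP p0.
have : (size (map s (iota 0 (size p))) < size p)%N.
  apply: max_poly_roots p0 _ _; last by rewrite map_inj_uniq ?iota_uniq.
  by apply/allP => x /mapP[n _ ->].
by rewrite size_map size_iota ltnn.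
Qed.

End PolynomialZeros.

Section UnitarySpan.
Variables (R : realType) (V : hilbert R).
Local Notation C := (Cplx R).
Local Notation d := (\dim (fullv : {vspace V})).
Local Notation idx := (idx d).
Variables j k : nat.
Variable m : idx (nseq k std) -> idx (nseq j std) -> C.
Hypothesis im : @invariant_form R V _ _ m.
Local Open Scope sesquilinear_scope.

Local Notation tpow A := (tensor_entry (fun _ : letter => fun_of_matrix A)).

Let comm (A : 'M[C]_d) := forall i l,
  \sum_p m i p * tpow A p l = \sum_p tpow A i p * m p l.

Lemma tensor_entry_std (K : comPzRingType) (B : letter -> 'I_d -> 'I_d -> K) n
  (i l : idx (nseq n std)) : tensor_entry B i l = tensor_entry (fun=> B std) i l.
Proof. by elim: n i l => [//|n IH] i l /=; rewrite IH. Qed.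

Lemma comm_unitary (A : 'M[C]_d) : A \is unitarymx -> comm A.
Proof.
move=> uA; have uA' : A^t* *m A = 1%:M.
  by rewrite -invmx_unitary // mulVmx // unitarymx_unit.
have uA2 : A *m A^t* = 1%:M by apply/unitarymxP.
have [a b|a b|g ug gE] := @unitary_of_entries R V (fun a b => A a b).
- have := congr1 (fun B : 'M_d => B a b) uA'; rewrite !mxE => <-.
  by apply: eq_bigr => c _; rewrite !mxE.
- have := congr1 (fun B : 'M_d => B a b) uA2; rewrite !mxE => <-.
  by apply: eq_bigr => c _; rewrite !mxE.
have tE n (a b : idx (nseq n std)) : tpow A a b = tensor_entry (entry g) a b.
  by rewrite [RHS]tensor_entry_std; apply: tensor_entry_ext => l a' b'; rewrite gE.
move=> i l; under eq_bigr do rewrite (im ug) mulr_suml.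
rewrite exchange_big; apply: eq_bigr => p _ /=.
under eq_bigr do rewrite mulr_suml.
rewrite exchange_big (bigD1 l) //= [X in _ + X]big1 => [|q ql].
  rewrite addr0 -[RHS]mulr1 tE; under eq_bigr do rewrite -(mulrA (_ * _)).
  rewrite -big_distrr /=; congr (_ * _).
  transitivity (\sum_q tensor_entry (entry (@adj R V V g)) l q * tensor_entry (entry g)
    q l).
    by apply: eq_bigr => q _; rewrite tensor_entry_adj tE.
  rewrite -(tensor_entryM (A := entry (@adj R V V g \o g)%VF)) => [|x a b];
    last exact: entryM.
  by rewrite unitary_adjl // tensor_entry1 ?eqxx // => x a b; apply: entry1.
under eq_bigr do rewrite -(mulrA (_ * _)).
rewrite -big_distrr /= [X in _ * X](_ : _ = 0) ?mulr0 //.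
transitivity (\sum_p tensor_entry (entry (@adj R V V g)) q p * tensor_entry (entry g) p
  l).
  by apply: eq_bigr => p' _; rewrite tensor_entry_adj tE.
rewrite -(tensor_entryM (A := entry (@adj R V V g \o g)%VF)) => [|x a b];
  last exact: entryM.
rewrite unitary_adjl // tensor_entry1 ?(negPf ql) // => x a b; apply: entry1.
Qed.

(** For a fixed row and column the commutation defect is a polynomial in t; the infinitely many
    zeros [s n] make it vanish. *)
Lemma comm_line (A B : 'M[C]_d) (s : nat -> C) : injective s ->
  (forall n, comm (A + s n *: B)) -> forall t, comm (A + t *: B).
Proof.
move=> si cs t i l.
pose L (_ : letter) (a b : 'I_d) : {poly C} := (A a b)%:P + B a b *: 'X.
pose P : {poly C} := \sum_p (m i p)%:P * tensor_entry L p l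
                     - \sum_p tensor_entry L i p * (m p l)%:P.
have LE n (a b : idx (nseq n std)) x : (tensor_entry L a b).[x] = tpow (A + x *: B) a b.
  rewrite -[LHS]/(horner_eval x _) tensor_entry_morph.
  apply: tensor_entry_ext => l0 a' b'.
  rewrite -[LHS]/((L l0 a' b').[x]) /L !mxE.
  by rewrite hornerD hornerC hornerZ hornerX [x * _]mulrC.
have PE x : P.[x] = \sum_p m i p * tpow (A + x *: B) p l - \sum_p tpow (A +
  x *: B) i p * m p l.
  rewrite /P hornerD hornerN !horner_sum.
  by congr (_ - _); apply: eq_bigr => p _; rewrite hornerM hornerC LE.
have P0 : P = 0.
  apply: (poly_eq0_injective_roots si) => n; rewrite rootE PE.
  by rewrite (cs n i l) subrr.
by apply/eqP; rewrite -subr_eq0 -PE P0 horner0.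
Qed.

(* The Cayley transform gives infinitely many numbers of modulus 1. *)
Definition cayley (n : nat) : C := (1 + 'i * n%:R) / (1 - 'i * n%:R).

Lemma cayley_denom n : 1 - 'i * n%:R != 0 :> C.
Proof.
apply/eqP => h; have : (1 + n ^ 2)%:R = 0 :> C.
  transitivity ((1 - 'i * n%:R) * (1 + 'i * n%:R) : C); last by rewrite h mul0r.
  have -> : (1 - 'i * n%:R) * (1 + 'i * n%:R) = 1 - 'i ^+ 2 * n%:R ^+ 2 :> C by ring.
  by rewrite sqrCi mulN1r opprK natrD natrX.
by apply/eqP; rewrite pnatr_eq0.
Qed.

Lemma norm_cayley n : `|cayley n| = 1.
Proof.
have nz := cayley_denom n.
have e1 : (1 - 'i * n%:R)^* = 1 + 'i * n%:R :> C.
  by rewrite rmorphB rmorph1 rmorphM /= conjCi rmorph_nat; ring.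
by rewrite /cayley normf_div -e1 norm_conjC divff // normr_eq0.
Qed.

Lemma cayley_inj : injective cayley.
Proof.
move=> a b ab; have na := cayley_denom a; have nb := cayley_denom b.
have h : (1 + 'i * a%:R) * (1 - 'i * b%:R) = (1 + 'i * b%:R) * (1 - 'i * a%:R) :> C.
  apply: (mulIf (invr_neq0 na)); apply: (mulIf (invr_neq0 nb)).
  have -> : (1 + 'i * a%:R) * (1 - 'i * b%:R) / (1 - 'i * a%:R) / (1 - 'i * b%:R) =
    cayley a.
    by rewrite /cayley; field; rewrite na nb.
  rewrite ab /cayley; field; by rewrite na nb.
have i0 : 'i != 0 :> C by apply: neq0Ci.
have h2 : 2 * 'i * (a%:R - b%:R) = 0 :> C.
  have -> : 2 * 'i * (a%:R - b%:R) = (1 + 'i * a%:R) * (1 - 'i * b%:R) -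
     (1 + 'i * b%:R) * (1 - 'i * a%:R) :> C by ring.
  by rewrite h subrr.
apply/eqP; rewrite -(eqr_nat C) -subr_eq0.
by move/eqP: h2; rewrite !mulf_eq0 pnatr_eq0 (negPf i0).
Qed.

(** The diagonal entries are freed one at a time: n counts those already arbitrary, the others
    having modulus 1. With the rest fixed, the matrix is affine in the next entry, and the Cayley
    numbers feed [comm_line]. *)
Lemma comm_diag (U : 'M[C]_d) (z : 'rV[C]_d) : U \is unitarymx ->
  comm (U^t* *m diag_mx z *m U).
Proof.
move=> uU.
suff H n : forall z : 'rV[C]_d, (forall a : 'I_d, (n <= a)%N -> `|z 0 a| = 1) ->
    comm (U^t* *m diag_mx z *m U).
  by apply: (H d) => a; rewrite leqNgt ltn_ord.
elim: n => [|n IH] {}z hz.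
  have uU' : U^t* \is unitarymx by rewrite trmxC_unitary.
  apply: comm_unitary; apply: (mul_unitarymx _ uU); apply: (mul_unitarymx uU').
  apply/unitarymxP; rewrite mul_diag_mx; apply/matrixP => a b; rewrite !mxE.
  have [->|ab] := eqVneq a b.
    by rewrite !mulr1n -normCK hz // expr1n.
  by rewrite !mulr0n rmorph0 mulr0.
have [nd|dn] := ltnP n d; last first.
  by apply: IH => a na; have := leq_trans dn na; rewrite leqNgt ltn_ord.
pose a0 := Ordinal nd.
pose z' t : 'rV[C]_d := \row_a (if a == a0 then t else z 0 a).
have zE t : U^t* *m diag_mx (z' t) *m U =
    U^t* *m diag_mx (z' 0) *m U + t *: (U^t* *m diag_mx (delta_mx 0 a0) *m U).
  rewrite scalemxAl scalemxAr -mulmxDl -mulmxDr; congr (_ *m _ *m _).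
  rewrite -linearZ -linearD /=; congr diag_mx; apply/rowP => a; rewrite !mxE eqxx /=.
  by case: eqP => _; rewrite ?mulr1 ?add0r // mulr0 addr0.
have -> : z = z' (z 0 a0).
  by apply/rowP => a; rewrite mxE; case: eqP => // ->.
rewrite zE; apply: (comm_line cayley_inj) => q; rewrite -zE; apply: IH => a na.
rewrite mxE; case: eqP => [_|/eqP aa0]; first exact: norm_cayley.
by apply: hz; rewrite ltn_neqAle na andbT; apply: contra aa0 => /eqP na';
  apply/eqP/val_inj.
Qed.

(** Hermitian matrices are covered by the spectral theorem and [comm_diag]. Writing A = H1 + i H2
    with H1 and H2 Hermitian, H1 + n H2 is Hermitian for every natural n, and [comm_line] reaches
    the parameter i. *)
Lemma comm_all (A : 'M[C]_d) : comm A.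
Proof.
have comm_herm (H : 'M[C]_d) : (forall a b, (H b a)^* = H a b) -> comm H.
  move=> hH; have nH : H \is normalmx.
    have HH : H^t* = H by apply/matrixP => a b; rewrite !mxE.
    by apply/normalmxP; rewrite HH.
  rewrite (orthomx_spectralP nH) invmx_unitary ?spectral_unitarymx //.
  exact/comm_diag/spectral_unitarymx.
pose H1 : 'M[C]_d := \matrix_(a, b) ((A a b + (A b a)^*) / 2).
pose H2 : 'M[C]_d := \matrix_(a, b) (- 'i / 2 * (A a b - (A b a)^*)).
have -> : A = H1 + 'i *: H2.
  apply/matrixP => a b; rewrite !mxE.
  have -> : 'i * (- 'i / 2 * (A a b - (A b a)^*)) =
    - 'i ^+ 2 / 2 * (A a b - (A b a)^*) by ring.
  by rewrite sqrCi; field.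
apply: (@comm_line _ _ (fun n => n%:R)) => [x y /eqP|n].
  by rewrite eqr_nat => /eqP.
apply: comm_herm => a b; rewrite !mxE !(rmorphD, rmorphM, rmorphB,
  rmorphN) /= !rmorph_nat.
by rewrite fmorphV rmorph_nat !conjCK conjCi; field.
Qed.

End UnitarySpan.

(** * Adjacent transpositions and multisets *)

Section AdjacentSwaps.
Variable A : eqType.

Fixpoint swap_at (r : nat) (s : seq A) : seq A :=
  match r, s with
  | 0%N, a :: b :: s' => b :: a :: s'
  | r'.+1, a :: s' => a :: swap_at r' s'
  | _, _ => s
  end.

Lemma swap_atK r : involutive (swap_at r).
Proof. by elim: r => [|r IH] [|a [|b s]] //=; rewrite ?IH. Qed.

Lemma swap_at_cat s1 a b s2 : swap_at (size s1) (s1 ++ a :: b :: s2) = s1 ++ b :: a :: s2.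
Proof. by elim: s1 => [|x s1 IH] //=; rewrite IH. Qed.

(** Adjacent swaps bring the head of t to the front of s; the induction then goes on with the
    predicate P (x :: _). The length restriction lets P be known only at one word length. *)
Lemma perm_eq_swaps (P : seq A -> Prop) n s t :
  (forall r s, size s = n -> P s -> P (swap_at r s)) ->
  perm_eq s t -> size s = n -> P s -> P t.
Proof.
elim: n P s t => [|n IH] P s t HP st sn Ps.
  by move: st Ps; rewrite (size0nil sn) perm_sym => /perm_nilP ->.
case: t st => [|x t] st; first by move: (perm_size st); rewrite sn.
have : x \in s by rewrite (perm_mem st) inE eqxx.
move=> /splitPr xs; case: xs st sn Ps => s1 s2 st sn Ps.
have front s1' s2' : size (s1' ++ x :: s2') = n.+1 -> P (s1' ++ x :: s2') ->
  P (x :: s1' ++ s2').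
  elim/last_ind: s1' s2' => [//|s1' y IHs] s2' sz.
  rewrite cat_rcons => /(HP (size s1')); rewrite swap_at_cat => H.
  rewrite cat_rcons; apply: IHs; last by apply: H; rewrite -cat_rcons.
  by move: sz; rewrite cat_rcons !size_cat.
have {}Ps := front _ _ sn Ps.
apply: (IH (fun s => P (x :: s)) (s1 ++ s2)) => //.
- by move=> r s' ss Pxs; apply: (HP r.+1 (x :: s')) => //=; rewrite ss.
- rewrite -(perm_cons x); apply: perm_trans st.
  by rewrite -(cat1s x (s1 ++ s2)) perm_catCA.
- by move: sn; rewrite !size_cat /= addnS => -[].
Qed.

End AdjacentSwaps.

Lemma digits_inj D N (f g : 'I_N -> nat) :
  (forall i, f i < D)%N -> (forall i, g i < D)%N ->
  (\sum_(i < N) f i * D ^ i = \sum_(i < N) g i * D ^ i)%N -> f =1 g.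
Proof.
elim: N f g => [|N IH] f g fD gD; first by move=> _ [].
rewrite !big_ord_recl !expn0 !muln1 => e.
have D0 : (0 < D)%N by apply: leq_ltn_trans (fD ord0).
have split_sum (h : 'I_N.+1 -> nat) : (\sum_(i < N) h (lift ord0 i) * D ^ (lift ord0 i) =
    (\sum_(i < N) h (lift ord0 i) * D ^ i) * D)%N.
  by rewrite big_distrl; apply: eq_bigr => i _ /=; rewrite /bump add1n expnSr mulnA.
rewrite !split_sum in e.
have e0 : f ord0 = g ord0.
  have := congr1 (modn^~ D) e; rewrite /= ![(_ + _ * D)%N]addnC !modnMDl.
  by rewrite !modn_small.
have e1 : (fun i => f (lift ord0 i)) =1 (fun i => g (lift ord0 i)).
  apply: IH => //; move/eqP: e; rewrite e0 eqn_add2l eqn_pmul2r // => /eqP //.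
by move=> i; case: (unliftP ord0 i) => [j ->|->].
Qed.

Section MultisetCode.
Variables (A : finType) (D : nat).

(* Base-[D] encoding of the multiplicities in [s], faithful when [size s < D]. *)
Definition code (s : seq A) : nat := (\sum_(x <- s) D ^ enum_rank x)%N.

Lemma code_count s : code s = (\sum_(i < #|A|) count_mem (enum_val i) s * D ^ i)%N.
Proof.
rewrite /code; elim: s => [|y s IH].
  by rewrite big_nil big1.
rewrite big_cons IH /=; under [RHS]eq_bigr do rewrite mulnDl.
rewrite big_split /=; congr addn; rewrite (bigD1 (enum_rank y)) //= big1 => [|i iy].
  by rewrite enum_rankK eqxx mul1n addn0.
by rewrite eq_sym (can2_eq enum_valK enum_rankK) (negPf iy) mul0n.
Qed.

Lemma code_perm_eq s t : (size s < D)%N -> (size t < D)%N -> code s = code t ->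
    perm_eq s t.
Proof.
move=> sD tD; rewrite !code_count => /digits_inj e.
apply/allP => x _ /=; have := e _ _ (enum_rank x); rewrite enum_rankK => -> //.
  by move=> i; apply: leq_ltn_trans (count_size _ _) sD.
by move=> i; apply: leq_ltn_trans (count_size _ _) tD.
Qed.

End MultisetCode.

(** * Schur-Weyl duality by a double commutant argument *)

Section SchurWeyl.
Variables (R : realType) (V : hilbert R).
Local Notation C := (Cplx R).
Local Notation d := (\dim (fullv : {vspace V})).
Local Notation idx := (idx d).
Local Notation tens := (tens V).
Variable e : d.-tuple V.
Hypothesis he : basis_of fullv e.
Variables (I : Type) (w : I -> seq letter) (T : forall i, tens (w i)).
Local Notation composite := (composite e T).
Local Notation generated := (generated e T).

(** Permuting the tensor factors in both indices at once permutes this list, so its multiset is the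
    invariant of simultaneous permutations. *)
Fixpoint pairs u : idx u -> idx u -> seq ('I_d * 'I_d) :=
  match u return idx u -> idx u -> seq ('I_d * 'I_d) with
  | [::] => fun _ _ => [::]
  | l :: u' => fun i j => (i.1, j.1) :: @pairs u' i.2 j.2
  end.

Lemma size_pairs u (i j : idx u) : size (pairs i j) = size u.
Proof. by elim: u i j => [|l u IH] i j //=; rewrite IH. Qed.

Lemma pairs_inj u (i j i' j' : idx u) : pairs i j = pairs i' j' -> i = i' /\ j = j'.
Proof.
elim: u i j i' j' => [|l u IH]; first by case=> [] [] [] [].
by move=> [i1 i] [j1 j] [i1' i'] [j1' j'] /= [-> -> /IH [-> ->]].
Qed.

Lemma tensor_entry_code (K : comPzRingType) D (t : K) u (i j : idx u) :
  tensor_entry (fun _ a b => t ^+ (D ^ enum_rank (a, b))%N) i j = t ^+ code D (pairs i j).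
Proof.
elim: u i j => [|l u IH] i j /=; first by rewrite /code big_nil expr0.
by rewrite IH /code big_cons exprD.
Qed.

(** The flip at the front, preceded by r identity letters. When the word is too short the identity
    serves, in accordance with the default of [swap_at]. *)
Lemma adjacent_flip n r : exists (F : 'End(tens (nseq n std)))
    (s : idx (nseq n std) -> idx (nseq n std)),
  [/\ composite F, involutive s, forall i, F (bv _ i) = bv _ (s i) &
      forall i j, pairs (s i) (s j) = swap_at r (pairs i j)].
Proof.
elim: r n => [|r IH] [|n].
- exists \1%VF, id; split => //; first exact: composite_id.
  by move=> i; rewrite id_lfunE.
- case: n => [|n].
    exists \1%VF, id; split => //; first exact: composite_id.
    by move=> i; rewrite id_lfunE.
  have [F cF FE] := flip_front e T (nseq n std).
  exists F, (fun i => (i.2.1, (i.1, i.2.2)) : idx (nseq n.+2 std)); split => //.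
    by case=> [? []].
  by move=> i; rewrite !bv_cons FE.
- exists \1%VF, id; split => //; first exact: composite_id.
  by move=> i; rewrite id_lfunE.
have [F [s [cF ss Fs sp]]] := IH n.
exists (lmap std F), (fun i => (i.1, s i.2) : idx (nseq n.+1 std)); split.
- exact: composite_lmap.
- by case=> ? ? /=; rewrite ss.
- by move=> i; rewrite !bv_cons lmap_tcons Fs.
by move=> i j /=; rewrite sp.
Qed.

Section Equivariant.
Variables (n : nat).
Local Notation W := (nseq n std).
Variable m : idx W -> idx W -> C.
Hypothesis im : @invariant_form R V _ _ m.

(** Multiplicities among n index pairs are at most n, hence are digits in this base. *)
Let D := n.+1.

Lemma comm_code c i l :
  \sum_p m i p * (code D (pairs p l) == c)%:R =
    \sum_p (code D (pairs i p) == c)%:R * m p l.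
Proof.
pose P : {poly C} := \sum_p (m i p)%:P * 'X^(code D (pairs p l)).
pose Q : {poly C} := \sum_p 'X^(code D (pairs i p)) * (m p l)%:P.
have PQ : P = Q.
  apply/eqP; rewrite -subr_eq0; apply/eqP.
  apply: (@poly_eq0_injective_roots _ _ (fun k => k%:R)) => [x y /eqP|k].
    by rewrite eqr_nat => /eqP.
  rewrite rootE hornerD hornerN !horner_sum.
  have := comm_all im (\matrix_(a, b) (k%:R ^+ (D ^ enum_rank (a, b))%N)) i l.
  have tE (a b : idx W) : tensor_entry (fun=> fun_of_matrix
       (\matrix_(a, b) (k%:R ^+ (D ^ enum_rank (a,
         b))%N : C))) a b = k%:R ^+ code D (pairs a b).
    by rewrite -tensor_entry_code; apply: tensor_entry_ext => l0 a' b'; rewrite mxE.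
  under eq_bigr do rewrite tE; under [in X in _ = X -> _]eq_bigr do rewrite tE.
  move=> h; rewrite subr_eq0; apply/eqP.
  under eq_bigr do rewrite hornerM hornerC hornerXn.
  by rewrite h; apply: eq_bigr => p _; rewrite hornerM hornerC hornerXn.
have := congr1 (fun p : {poly C} => p`_c) PQ; rewrite /P /Q !coef_sum.
under eq_bigr do rewrite coefCM coefXn eq_sym.
move=> ->; apply: eq_bigr => p _.
by rewrite coefMC coefXn eq_sym.
Qed.

(* An operator commuting with the adjacent flips has entries depending only on
   the multiset of index pairs, hence lies in the span of the operators
   handled by [comm_code]. *)
Lemma comm_symmetric (b : idx W -> idx W -> C) :
  (forall r s, (forall i j, pairs (s i) (s j) = swap_at r (pairs i j)) ->
    involutive s -> (exists2 F : 'End(tens W), composite F & forall i,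
      F (bv W i) = bv W (s i)) ->
    forall i j, b (s i) (s j) = b i j) ->
  forall i l, \sum_p m i p * b p l = \sum_p b i p * m p l.
Proof.
move=> bs.
have bperm i j i' j' : perm_eq (pairs i j) (pairs i' j') -> b i' j' = b i j.
  move=> pe.
  apply: (@perm_eq_swaps _ (fun z => forall i' j', pairs i' j' = z ->
    b i' j' = b i j) n _ _ _ pe) => //.
  - move=> r z _ Pz i1 j1 zE; have [F [s [cF ss Fs sp]]] := adjacent_flip n r.
    rewrite -(bs r s sp ss) //; last by exists F.
    by apply: Pz; rewrite sp zE swap_atK.
  - by rewrite size_pairs size_nseq.
  - by move=> i1 j1 /pairs_inj[-> ->].
pose cd (x : idx W * idx W) := code D (pairs x.1 x.2).
(* The common value of b on the index pairs of code c; the value 0 on codes that do not occur is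
   never read. *)
pose be c := if [pick x | cd x == c] is Some x then b x.1 x.2 else 0.
have bE i j : b i j = be (cd (i, j)).
  rewrite /be; case: pickP => [x /eqP|/(_ (i, j))]; last by rewrite eqxx.
  by rewrite /cd => /code_perm_eq e'; apply: bperm; apply: e';
    rewrite size_pairs size_nseq.
pose N := (\max_x cd x).+1.
have bE2 i j : b i j = \sum_(c < N) be c * (code D (pairs i j) == c)%:R.
  rewrite bE (bigD1 (Ordinal (leq_bigmax (i, j) : (cd (i, j) < N)%N))) //=.
  rewrite big1 => [|c cn]; first by rewrite eqxx mulr1 addr0.
  by rewrite (_ : _ == _ = false) ?mulr0 //; apply: contraNF cn => /eqP h;
    apply/eqP/val_inj.
move=> i l; under eq_bigr do rewrite bE2 big_distrr /=.
under [RHS]eq_bigr do rewrite bE2 big_distrl /=.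
rewrite exchange_big [RHS]exchange_big; apply: eq_bigr => c _ /=.
under eq_bigr do rewrite mulrCA.
under [RHS]eq_bigr do rewrite -mulrA.
by rewrite -!big_distrr /= comm_code.
Qed.

(** Let P be the orthogonal projection of End(W) onto the generated endomorphisms. These are stable
    under left composition with flips, which are self-adjoint, so P commutes with such compositions;
    by [comm_symmetric] it then commutes with left composition by Z. Hence P(Z) = Z P(1) = Z, so Z
    is generated. *)
Lemma equivariant_std_generated : generated (hom_of m).
Proof.
pose Z := hom_of m; rewrite -/Z.
have [t tP tE] := hs_frame (@generated0 _ _ e _ _ T W W) (@generatedD _ _ e _ _ T W W).
(* The blocks of P: [b y y' i j] is the entry (i, y') of the projection of the matrix unit sending
   the basis vector y to j. *)
pose b y y' (i j : idx W) := \sum_(G <- t) (hdot (G (bv W y)) (bv W j))^* * hdot (G (bv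
  W y')) (bv W i).
have bB y y' j : \sum_i b y y' i j *: bv W i =
  \sum_(G <- t) hdot (bv W j) (G (bv W y)) *: G (bv W y').
  under eq_bigr do rewrite /b scaler_suml.
  rewrite exchange_big; apply: eq_bigr => G _ /=.
  rewrite [G (bv W y') in RHS]bv_sum scaler_sumr; apply: eq_bigr => i _.
  by rewrite scalerA -hdotC.
have bcomm y y' i l : \sum_p m i p * b y y' p l = \sum_p b y y' i p * m p l.
  apply: comm_symmetric => r s sp ss [F cF Fs] {}i j.
  have aF : adj F = F.
    apply/esym/adj_uniq => x z; rewrite (bv_sum x) !hom_comb !hdot_suml.
    apply: eq_bigr => a _; rewrite !hdotZl; congr (_ * _); rewrite Fs.
    rewrite (bv_sum z) !hom_comb !hdot_sumr; apply: eq_bigr => c _.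
    by rewrite !hdotZr Fs !hdot_bv (inv_eq ss).
  have FG (G : 'End(tens W)) : G \in t ->
    (F \o G)%VF = \sum_(H <- t) hs (F \o G)%VF H *: H.
    by move=> Gt; apply: tE; apply: (generated_comp_l cF); apply: tP.
  have hF x z : hdot (F x) z = hdot x (F z) by rewrite adjE aF.
  have L1 (a : idx W) y0 (G : 'End(tens W)) :
      hdot (G (bv W y0)) (bv W (s a)) = hdot ((F \o G)%VF (bv W y0)) (bv W a).
    by rewrite comp_lfunE hF Fs.
  have L2 (G : 'End(tens W)) : G \in t -> hdot ((F \o G)%VF (bv W y')) (bv W i) =
      \sum_(H <- t) hs (F \o G)%VF H * hdot (H (bv W y')) (bv W i).
    move=> Gt; rewrite {1}(FG G Gt) sum_lfunE hdot_suml; apply: eq_bigr => H _.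
    by rewrite scale_lfunE hdotZl.
  have L3 (H : 'End(tens W)) : H \in t -> (hdot (H (bv W y)) (bv W j))^* =
      \sum_(G <- t) (hdot ((F \o G)%VF (bv W y)) (bv W j))^* * hs (F \o G)%VF H.
    move=> Ht; have -> : H (bv W y) = F ((F \o H)%VF (bv W y)).
      rewrite comp_lfunE (bv_sum (H _)) !hom_comb; apply: eq_bigr => a _.
      by rewrite !Fs ss.
    rewrite (FG H Ht) sum_lfunE hom_sum hdot_suml rmorph_sum; apply: eq_bigr => G _ /=.
    rewrite scale_lfunE linearZ hdotZl rmorphM /= mulrC comp_lfunE; congr (_ * _).
    by rewrite -hs_herm hs_adjl aF.
  rewrite /b big_seq.
  transitivity (\sum_(G <- t | G \in t) \sum_(H <- t)
     (hdot ((F \o G)%VF (bv W y)) (bv W j))^* * (hs (F \o G)%VF H * hdot (H (bv W y'))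
       (bv W i))).
    by apply: eq_bigr => G Gt; rewrite !L1 L2 // big_distrr.
  rewrite -big_seq exchange_big big_seq [RHS]big_seq; apply: eq_bigr => H Ht /=.
  under eq_bigr do rewrite mulrA.
  by rewrite -big_distrl /= L3.
(* Each block of P commutes with Z, so Z may be moved from the output of the projection to its
   argument. *)
have ZB y y' l : \sum_(G <- t) hdot (bv W l) (G (bv W y)) *: Z (G (bv W y')) =
    \sum_(G <- t) hdot (Z (bv W l)) (G (bv W y)) *: G (bv W y').
  rewrite -hom_comb -bB hom_comb.
  transitivity (\sum_i (\sum_p m i p * b y y' p l) *: bv W i).
    under eq_bigr do rewrite hom_ofE scaler_sumr.
    rewrite exchange_big; apply: eq_bigr => i _ /=; rewrite scaler_suml.
    by apply: eq_bigr => p _; rewrite scalerA mulrC.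
  under eq_bigr do rewrite bcomm scaler_suml.
  rewrite exchange_big /=.
  transitivity (\sum_p m p l *: \sum_(G <- t) hdot (bv W p) (G (bv W y)) *: G (bv W y')).
    apply: eq_bigr => p _; rewrite -bB scaler_sumr; apply: eq_bigr => i _.
    by rewrite scalerA mulrC.
  under [LHS]eq_bigr => p _ do rewrite scaler_sumr.
  rewrite exchange_big; apply: eq_bigr => G _ /=.
  rewrite hom_ofE hdot_suml scaler_suml; apply: eq_bigr => p _.
  by rewrite scalerA hdotZl.
have -> : Z = \sum_(G <- t) hs Z G *: G.
  have id_t : \1%VF = \sum_(G <- t) hs \1%VF G *: G :> 'End(tens W).
    by apply/tE/generated_composite/composite_id.
  apply: hom_ext => y'.
  have -> : Z (bv W y') = \sum_(G <- t) hs \1%VF G *: Z (G (bv W y')).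
    rewrite -hom_comb -[bv W y' in LHS]id_lfunE {1}id_t sum_lfunE; congr (Z _).
    by apply: eq_bigr => G _; rewrite scale_lfunE.
  rewrite sum_lfunE.
  transitivity (\sum_y \sum_(G <- t) hdot (bv W y) (G (bv W y)) *: Z (G (bv W y'))).
    rewrite exchange_big; apply: eq_bigr => G _ /=; rewrite -scaler_suml; congr (_ *: _).
    by apply: eq_bigr => y _; rewrite id_lfunE.
  under eq_bigr do rewrite ZB.
  rewrite exchange_big; apply: eq_bigr => G _ /=.
  by rewrite scale_lfunE -scaler_suml.
exact: generated_sum_seq.
Qed.

End Equivariant.

Lemma first_fundamental_theorem u v : first_fundamental e T u v.
Proof.
apply: (first_fundamental_of_std he) => j k m im.
have [jk|jk] := eqVneq j k; first by subst k; apply: equivariant_std_generated.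
(* Commutation with the scalar matrix 2 gives 2^j m = 2^k m, so there is nothing invariant between
   different tensor powers. *)
have m0 i l : m i l = 0.
  have powE n (a b : idx (nseq n std)) :
      tensor_entry (fun=> fun_of_matrix (2%:M : 'M[C]_d)) a b = 2 ^+ n * (a == b)%:R.
    elim: n a b => [|n IH] a b /=; first by case: a b => [] []; rewrite mulr1.
    by rewrite IH mxE; case: a b => a1 a [b1 b] /=; rewrite xpair_eqE mulrb exprS;
      case: (a1 == b1); case: (a == b); rewrite /= ?mulr1 ?mulr0 ?mul0r.
  have := comm_all im 2%:M i l.
  rewrite (bigD1 l) //= big1 => [|p pl]; last by rewrite powE (negPf pl) !mulr0.
  rewrite (bigD1 i) //= [X in _ = _ + X -> _]big1 => [|p pl]; last first.
    by rewrite powE eq_sym (negPf pl) mulr0 mul0r.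
  rewrite !addr0 !powE !eqxx !mulr1 mulrC => /eqP; rewrite -subr_eq0 -mulrBl mulf_eq0.
  case/orP => [|/eqP //]; rewrite subr_eq0 -!natrX eqr_nat eqn_exp2l // => /eqP jk'.
  by rewrite jk' eqxx in jk.
have -> : hom_of m = 0.
  apply: hom_ext => l; rewrite hom_ofE big1 ?lfunE // => i _.
  by rewrite m0 scale0r.
exact: generated0.
Qed.

End SchurWeyl.

(** * Compactness of U(V) *)

Section UltraLimits.
Variables (R : realType) (T : Type) (F : set_system T).
Local Notation C := (Cplx R).

Definition tends (phi : T -> C) (l : C) := forall eps : C, 0 < eps ->
  F [set t | `|phi t - l| < eps].

Lemma tends_cvg {FF : Filter F} (phi : T -> C) l : tends phi l <-> phi t @[t --> F] --> l.
Proof.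
split => [h|/cvgrPdist_lt h eps e0].
  apply/cvgrPdist_lt => eps e0; apply: filterS (h _ e0) => t /=.
  by rewrite distrC.
by apply: filterS (h _ e0) => t /=; rewrite distrC.
Qed.

Lemma tends_cst {FF : Filter F} c : tends (fun=> c) c.
Proof. by move=> eps e0; apply: filterS filterT => t _ /=; rewrite subrr normr0. Qed.

Lemma tendsD {FF : Filter F} phi psi a b : tends phi a -> tends psi b ->
  tends (fun t => phi t + psi t) (a + b).
Proof. by rewrite !tends_cvg; apply: cvgD. Qed.

Lemma tendsM {FF : Filter F} phi psi a b : tends phi a -> tends psi b ->
  tends (fun t => phi t * psi t) (a * b).
Proof. by rewrite !tends_cvg; apply: cvgM. Qed.

Lemma tends_conj {FF : Filter F} phi a : tends phi a -> tends (fun t => (phi t)^*) (a^*).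
Proof.
move=> h eps e0; apply: filterS (h _ e0) => t /=.
by rewrite -rmorphB norm_conjC.
Qed.

Lemma tends_sum {FF : Filter F} (J : Type) (r : seq J) (phi : J -> T -> C) (l : J -> C) :
  (forall j, tends (phi j) (l j)) ->
  tends (fun t => \sum_(j <- r) phi j t) (\sum_(j <- r) l j).
Proof.
move=> h; elim: r => [|j r IH].
  by rewrite big_nil; under [X in tends X _]funext do rewrite big_nil; apply: tends_cst.
rewrite big_cons; under [X in tends X _]funext do rewrite big_cons.
exact: tendsD.
Qed.

Lemma tends_uniq {FF : ProperFilter F} phi a b : tends phi a -> tends phi b -> a = b.
Proof.
move=> ha hb; apply/eqP; rewrite -subr_eq0; apply/negP => /negP ab.
have e0 : 0 < `|a - b| / 2 by rewrite divr_gt0 ?normr_gt0.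
have [t /= [h1 h2]] := @filter_ex _ F FF _ (filterI (ha _ e0) (hb _ e0)).
have : `|a - b| < `|a - b|.
  rewrite {2}[`|a - b|]splitr; apply: le_lt_trans (ltrD h1 h2).
  rewrite -[a - b](subrKA (phi t)) distrC addrC.
  apply: le_trans (ler_normD _ _) _; rewrite addrC [`|a - _|]distrC //.
by rewrite ltxx.
Qed.

Lemma tends_ext {FF : Filter F} phi psi a (A : set T) : F A ->
  (forall t, A t -> phi t = psi t) -> tends phi a -> tends psi a.
Proof.
move=> FA pp h eps e0; apply: filterS2 (h _ e0) FA => t /= h1 At.
by rewrite -pp.
Qed.

(** The compact segment provides a cluster point p. It is a limit: an ultrafilter missing a ball
    around p contains its complement, which contradicts clustering. *)
Lemma ultra_real_limit {UF : UltraFilter F} (a : T -> R) (c : R) :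
  F [set t | `|a t| <= c] -> exists p, forall eps, 0 < eps ->
    F [set t | `|a t - p| < eps].
Proof.
move=> Fc; have PF : ProperFilter F by apply: ultra_proper.
have Pa : ProperFilter (a @ F) by apply: fmap_proper_filter.
have Fa : (a @ F) `[- c, c]%classic.
  change (F (a @^-1` `[- c, c]%classic)); apply: filterS Fc => t /=.
  by rewrite in_itv /= ler_norml.
have [p [_ cp]] := @segment_compact R (- c) c _ Pa Fa.
exists p => eps e0.
have [//|Fn] := in_ultra_setVsetC [set t | `|a t - p| < eps] UF.
have : (a @ F) (~` ball p eps).
  change (F (a @^-1` (~` ball p eps))); apply: filterS Fn => t /= h.
  by rewrite /ball /= distrC.
move=> /cp /(_ (nbhsx_ballx p eps e0)) [x []] //.
Qed.

Lemma ultra_limit {UF : UltraFilter F} (phi : T -> C) (c : C) :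
  F [set t | `|phi t| <= c] -> exists l, tends phi l.
Proof.
move=> Fc; have PF : ProperFilter F by apply: ultra_proper.
have norm_le (z : R[i]) : `|complex.Re z| <= complex.Re `|z| /\ `|complex.Im z| <=
  complex.Re `|z|.
  case: z => x y; rewrite normc_def /=; split.
    by rewrite -sqrtr_sqr ler_wsqrtr // lerDl sqr_ge0.
  by rewrite -sqrtr_sqr ler_wsqrtr // lerDr sqr_ge0.
have Re_le (t : T) : `|phi t| <= c -> complex.Re (`|phi t| : R[i]) <= complex.Re c.
  by rewrite lecE => /andP[].
have [|p hp] := @ultra_real_limit _ (fun t => complex.Re (phi t)) (complex.Re c).
  by apply: filterS Fc => t /= /Re_le; apply: le_trans; case: (norm_le (phi t)).
have [|q hq] := @ultra_real_limit _ (fun t => complex.Im (phi t)) (complex.Re c).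
  by apply: filterS Fc => t /= /Re_le; apply: le_trans; case: (norm_le (phi t)).
exists (p +i* q)%C => eps; rewrite ltcE /= => /andP[/eqP ei e0].
have e2 : 0 < complex.Re eps / 2 by rewrite divr_gt0.
apply: filterS2 (hp _ e2) (hq _ e2) => t /=.
case: (phi t) => x y /= hx hy.
apply: (@le_lt_trans _ _ ((`|x - p| + `|y - q|)%:C)%C).
  rewrite normc_def /= lecR -[leRHS]ger0_norm ?addr_ge0 // -sqrtr_sqr ler_wsqrtr //.
  rewrite -(real_normK (num_real (x - p))) -(real_normK (num_real (y - q))) sqrrD.
  by rewrite lerD2r lerDl mulrn_wge0 // mulr_ge0.
by rewrite ltcE /= ei eqxx /= (splitr (complex.Re eps)) ltrD.
Qed.

End UltraLimits.

(** * Displacement of tensors and finite covers *)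

Section Displacement.
Variables (R : realType) (V : hilbert R).
Local Notation C := (Cplx R).
Local Notation d := (\dim (fullv : {vspace V})).
Local Notation idx := (idx d).
Local Notation tens := (tens V).
Local Notation adjV := (@adj R V V).
Local Notation tent g := (tensor_entry (entry g)).

Lemma sqnorm_entries w (x : tens w) : hdot x x = \sum_i `|hdot x (bv w i)| ^+ 2.
Proof. by rewrite hdot_sum; apply: eq_bigr => i _; rewrite normCK. Qed.

Lemma act_entries g w (x : tens w) i : unitary g ->
  hdot (act g w x) (bv w i) = \sum_j tent g i j * hdot x (bv w j).
Proof.
move=> ug; rewrite {1}(bv_sum x) hom_comb hdot_suml; apply: eq_bigr => j _.
by rewrite hdotZl hdot_act_bv // mulrC.
Qed.

(** Entries of unitaries are bounded by 1 and so converge along the ultrafilter; the unitarity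
    relations are polynomial in the entries and their conjugates and survive in the limit. One h
    serves all words at once. *)
Lemma unitary_limit (F : set_system 'End(V)) {UF : UltraFilter F} :
  F [set g | unitary g] ->
  exists2 h, unitary h & forall w (i j : idx w),
    tends F (fun g => tent g i j) (tent h i j).
Proof.
move=> Fu; have PF : ProperFilter F by apply: ultra_proper.
have [l lP] : exists l : 'I_d * 'I_d ->
  C, forall x, tends F (fun g => entry g std x.1 x.2) (l x).
  have ex x : exists l, tends F (fun g => entry g std x.1 x.2) l.
    by apply: (@ultra_limit _ _ F UF _ 1); apply: filterS Fu => g ug; apply: entry_norm.
  by have [l lP] := choice ex; exists l.
have [i j|i j|h uh hE] := @unitary_of_entries R V (fun i j => l (i, j)).
- apply: (@tends_uniq _ _ F _ (fun g => \sum_k (entry g std k i)^* * entry g std k j)).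
    apply: tends_sum => k; apply: tendsM; last exact: (lP (k, j)).
    by apply: tends_conj; apply: (lP (k, i)).
  apply: tends_ext Fu _ (tends_cst (i == j)%:R) => g ug.
  rewrite -(entry1 (V := V) std) -(unitary_adjl ug) entryM.
  by apply: eq_bigr => k _; rewrite entry_adj.
- apply: (@tends_uniq _ _ F _ (fun g => \sum_k entry g std i k * (entry g std j k)^*)).
    apply: tends_sum => k; apply: tendsM; first exact: (lP (i, k)).
    by apply: tends_conj; apply: (lP (j, k)).
  apply: tends_ext Fu _ (tends_cst (i == j)%:R) => g ug.
  rewrite -(entry1 (V := V) std) -(unitary_adjr ug) entryM.
  by apply: eq_bigr => k _; rewrite entry_adj.
exists h => //.
have ent a i j : tends F (fun g => entry g a i j) (entry h a i j).
  have s : tends F (fun g => entry g std i j) (entry h std i j).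
    by rewrite hE; apply: (lP (i, j)).
  by case: a => //; apply: tends_conj.
elim=> [|a w IH] i j /=; first exact: tends_cst.
by apply: tendsM.
Qed.

Lemma act_limit (F : set_system 'End(V)) {PF : ProperFilter F} h w (x : tens w) :
  F [set g | unitary g] -> unitary h ->
  (forall i j : idx w, tends F (fun g => tent g i j) (tent h i j)) ->
  tends F (fun g => hdot (act g w x - act h w x) (act g w x - act h w x)) 0.
Proof.
move=> Fu uh th.
have -> : 0 = \sum_(i : idx w) (0 * 0^*) :> C.
  by rewrite big1 // => i _; rewrite mul0r.
apply: (@tends_ext _ _ F _ (fun g => \sum_i
   (\sum_j tent g i j * hdot x (bv w j) - hdot (act h w x) (bv w i)) *
   (\sum_j tent g i j * hdot x (bv w j) - hdot (act h w x) (bv w i))^*) _ _ _ Fu).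
  move=> g ug; rewrite hdot_sum; apply: eq_bigr => i _.
  by rewrite hdotBl (act_entries _ _ ug).
apply: tends_sum => i.
have t0 : tends F (fun g => \sum_j tent g i j * hdot x (bv w j) - hdot (act h w x) (bv
  w i))
     (hdot (act h w x) (bv w i) - hdot (act h w x) (bv w i)).
  apply: tendsD; last exact: tends_cst.
  rewrite act_entries //; apply: tends_sum => j; apply: tendsM => //.
  exact: tends_cst.
rewrite subrr in t0.
by apply: tendsM => //; apply: tends_conj.
Qed.

Variables (J : Type) (word : J -> seq letter) (tt : forall j, tens (word j)).

Definition disp (r : seq J) (g : 'End(V)) : C :=
  \sum_(j <- r) hdot (act g _ (tt j) - tt j) (act g _ (tt j) - tt j).

Lemma disp_ge0 r g : 0 <= disp r g.
Proof. by apply: sumr_ge0 => j _; apply: hdot_ge0. Qed.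

Lemma parallelogram w (x y : tens w) : hdot (x - y) (x - y) <= 2 * (hdot x x + hdot y y).
Proof.
rewrite -subr_ge0.
have -> : 2 * (hdot x x + hdot y y) - hdot (x - y) (x - y) = hdot (x + y) (x + y).
  rewrite !hdotBl !hdotBr !hdotDl !hdotDr; ring.
exact: hdot_ge0.
Qed.

(** By [parallelogram] a unitary g satisfies |g t - t|^2 <= 4 |t|^2; the added 1 keeps the later
    divisor positive even for an empty list or zero tensors. *)
Definition disp_bound (r : seq J) : C := 4 * \sum_(j <- r) hdot (tt j) (tt j) + 1.

Lemma disp_bound_gt0 r : 0 < disp_bound r.
Proof. by rewrite ltr_wpDl // mulr_ge0 // sumr_ge0 // => j _; apply: hdot_ge0. Qed.

Lemma disp_le r g : unitary g -> disp r g <= disp_bound r.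
Proof.
move=> ug; apply: (@le_trans _ _ (4 * \sum_(j <- r) hdot (tt j) (tt j)));
  last by rewrite lerDl.
rewrite mulr_sumr; apply: ler_sum => j _; apply: le_trans (parallelogram _ _) _.
rewrite hdot_act // (_ : 2 * _ = 4 * hdot (tt j) (tt j)) //; ring.
Qed.

Lemma disp_adj r g h : unitary g -> unitary h -> disp r (adjV h \o g)%VF =
  \sum_(j <- r) hdot (act g _ (tt j) - act h _ (tt j)) (act g _ (tt j) - act h _ (tt j)).
Proof.
move=> ug uh; have uh' := unitary_adj uh; apply: eq_bigr => j _.
have -> : act (adjV h \o g)%VF (word j) (tt j) - tt j =
    act (adjV h) _ (act g _ (tt j) - act h _ (tt j)); last by rewrite hdot_act.
rewrite linearB /= actM // comp_lfunE; congr (_ - _).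
by rewrite -[RHS]comp_lfunE -actM // unitary_adjl // act1 id_lfunE.
Qed.

(** If no finite list worked, the uncovered sets would generate a proper filter; take an ultrafilter
    above it, with limit h. The limit is only known to be unitary, so an element g0 of [Gp] near h
    is used instead: elements g near h are then near g0, and g0^* g has small displacement although
    g avoids the translate by g0^*. *)
Lemma disp_cover (Gp : 'End(V) -> Prop) (r : seq J) (delta : C) :
  (forall g, Gp g -> unitary g) -> (forall g, Gp g -> Gp (adjV g)) -> 0 < delta ->
  exists2 hs : seq 'End(V), forall h, h \in hs -> Gp h &
    forall g, Gp g -> exists2 h, h \in hs & disp r (h \o g)%VF < delta.
Proof.
move=> Gu Ga d0; apply: contrapT => nex.
pose D := [set hs : seq 'End(V) | forall h, h \in hs -> Gp h].
pose B (hs : seq 'End(V)) := [set g | Gp g /\ forall h, h \in hs ->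
  ~ (disp r (h \o g)%VF < delta)].
have FF : Filter (filter_from D B).
  apply: filter_from_filter; first by exists [::].
  move=> h1 h2 D1 D2; exists (h1 ++ h2) => [h|g [Gg Bg]].
    by rewrite mem_cat => /orP[/D1|/D2].
  by split; split => // h hh; apply: Bg; rewrite mem_cat hh ?orbT.
have PF : ProperFilter (filter_from D B).
  apply: filter_from_proper => hs Dhs; apply: contrapT => /nonemptyPn B0.
  apply: nex; exists hs => // g Gg; apply: contrapT => nh.
  have : B hs g by split => // h hh dd; apply: nh; exists h.
  by rewrite B0.
have [F [UF FB]] := ultraFilterLemma PF.
have PF' : ProperFilter F by apply: ultra_proper.
have FG : F [set g | Gp g].
  by apply: FB; exists [::] => // g [].
have Fu : F [set g | unitary g] by apply: filterS FG => g; apply: Gu.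
have [h uh hE] := unitary_limit Fu.
pose dist g := \sum_(j <- r) hdot (act g _ (tt j) - act h _ (tt j)) (act g _ (tt j) -
  act h _ (tt j)).
have Fd : F [set g | dist g < delta / 4].
  have t0 : tends F dist (\sum_(j <- r) 0).
    by apply: tends_sum => j; apply: act_limit.
  rewrite big1 // in t0.
  apply: filterS (t0 (delta / 4) _) => [g /=|]; last by rewrite divr_gt0.
  rewrite subr0 ger0_norm // /dist sumr_ge0 // => j _; apply: hdot_ge0.
have [g0 [/= Gg0 dg0]] := filter_ex (filterI FG Fd).
have FB0 : F (B [:: adjV g0]).
  apply: FB; exists [:: adjV g0] => // h'; rewrite inE => /eqP ->; exact: Ga.
have [g [[Gg dg] [_ /(_ (adjV g0))]]] := filter_ex (filterI (filterI FG Fd) FB0).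
rewrite inE eqxx => /(_ isT); apply; rewrite disp_adj ?Gu //; do ?exact: Gu.
apply: (@le_lt_trans _ _ (2 * (dist g + dist g0))).
  rewrite /dist -big_split mulr_sumr; apply: ler_sum => j _ /=.
  set a := act g _ _; set b := act g0 _ _; set c := act h _ _.
  have -> : a - b = (a - c) - (b - c) by rewrite opprB addrA subrK.
  exact: parallelogram.
have -> : delta = 2 * (delta / 4 + delta / 4) by field.
by rewrite ltr_pM2l // ltrD.
Qed.

End Displacement.

Lemma null_coefficient_fin (R : realType) (S : eqType) (mul : S -> S -> S) (one : S)
    (G : S -> Prop) (G1 : G one) (GM : forall g h, G g -> G h -> G (mul g h))
    (GV : forall g, G g -> exists2 h, G h & mul g h = one)
    (J : finType) (pi : S -> J -> J -> Cplx R) (c : Cplx R) :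
  (forall i j, pi one i j = (i == j)%:R) ->
  (forall g h, G g -> G h -> forall i j, pi (mul g h) i j = \sum_k pi g i k * pi h k j) ->
  (forall g, G g -> forall i j, `|pi g i j| <= c) -> 0 <= c ->
  forall x y : J -> Cplx R,
  (forall p : J -> Cplx R, (forall g, G g -> forall j, \sum_i p i * pi g i j = p j) ->
    \sum_i p i * y i = 0) ->
  null mul G (fun g => \sum_i \sum_j x i * pi g i j * y j).
Proof.
move=> pi1 piM pib c0 x y yinv.
have sumE (f : J -> Cplx R) : \sum_i f i = \sum_(a < #|J|) f (enum_val a).
  by rewrite (reindex (@enum_val J J)) //; apply/onW_bij/enum_val_bij.
pose P g : 'M[Cplx R]_(#|J|) := \matrix_(a, b) pi g (enum_val a) (enum_val b).
pose x' : 'rV[Cplx R]_(#|J|) := \row_a x (enum_val a).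
pose y' : 'cV[Cplx R]_(#|J|) := \col_a y (enum_val a).
apply: (null_ext GM (phi := fun g => (x' *m P g *m y') 0 0)) => [g Gg|].
  rewrite sumE mxE; under eq_bigr do rewrite mxE big_distrl /=.
  rewrite exchange_big; apply: eq_bigr => a _ /=; rewrite sumE.
  by apply: eq_bigr => b _; rewrite !mxE.
apply: (null_coefficient G1 GM GV (c := c)) => //.
- by apply/matrixP => a b; rewrite !mxE pi1 (inj_eq enum_val_inj).
- move=> g h Gg Gh; apply/matrixP => a b; rewrite !mxE piM // sumE.
  by apply: eq_bigr => k _; rewrite !mxE.
- by move=> g Gg a b; rewrite mxE pib.
move=> p pinv; pose p' i := p 0 (enum_rank i).
apply/matrixP => a b; rewrite !ord1 !mxE.
transitivity (\sum_i p' i * y i).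
  by rewrite sumE; apply: eq_bigr => k _; rewrite /p' enum_valK mxE.
apply: yinv => g Gg j; rewrite sumE.
transitivity ((p *m P g) 0 (enum_rank j)); last by rewrite pinv.
rewrite mxE; by apply: eq_bigr => k _; rewrite /p' enum_valK mxE enum_rankK.
Qed.

(** * Bump functions built from displacement *)

Section UnitaryGroup.
Variables (R : realType) (V : hilbert R).
Local Notation C := (Cplx R).
Local Notation d := (\dim (fullv : {vspace V})).
Local Notation tens := (tens V).
Local Notation adjV := (@adj R V V).
Local Notation mul := (fun g h : 'End(V) => (g \o h)%VF).

Variable Gp : 'End(V) -> Prop.
Hypothesis Gu : forall g, Gp g -> unitary g.
Hypothesis G1 : Gp \1%VF.
Hypothesis GM : forall g h, Gp g -> Gp h -> Gp (g \o h)%VF.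
Hypothesis GA : forall g, Gp g -> Gp (adjV g).

Variables (J : Type) (word : J -> seq letter) (tt : forall j, tens (word j)).
Variable r : seq J.

(** Its values on unitaries lie in [0, 1], and by [disp_term] it is of degree one in the
    coefficients of the tensors and their conjugates. *)
Definition bump (g : 'End(V)) : C := 1 - disp tt r g / disp_bound tt r.

Lemma bump_not_null_disp (psi : 'End(V) -> C) (l k delta : C) :
  (forall g, Gp g -> `|psi g| <= l) -> 0 < k -> 0 < delta ->
  (forall g, Gp g -> disp tt r g < delta -> k <= 'Re (psi g)) ->
  (forall N, null mul Gp (fun g => bump g ^+ N * psi g)) -> False.
Proof.
move=> psil k0 d0 near nb; set B := disp_bound tt r.
have B0 : 0 < B by apply: disp_bound_gt0.
(* Smaller than both B and delta: the levels 1 - e / B and 1 - e / (2 B) are then nonnegative, the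
   lower one confines g to displacement below delta, and the higher one is reached on a finite
   cover. *)
set e := B * delta / (B + delta).
have Bd : 0 < B + delta by rewrite addr_gt0.
have e0 : 0 < e by rewrite divr_gt0 ?mulr_gt0.
have ed : e < delta.
  by rewrite ltr_pdivrMr // mulrC ltr_pM2l // ltrDl.
have eB : e < B by rewrite ltr_pdivrMr // ltr_pM2l // ltrDr.
have e20 : 0 < e / 2 by rewrite divr_gt0.
have [hs hsG cover] := disp_cover tt r Gu GA e20.
apply: (@bump_not_null R _ mul \1%VF Gp (@comp_lfun1r _ _ _) G1 GM bump psi
   (1 - e / B) (1 - (e / 2) / B) k l hs) => //.
- move=> g Gg; rewrite subr_ge0 ler_pdivrMr // mul1r; apply: disp_le; exact: Gu.
- by rewrite subr_ge0 ler_pdivrMr // mul1r ltW.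
- by rewrite ltrD2l ltrN2 ltr_pM2r ?invr_gt0 // ltr_pdivrMr // mulr_natr mulr2n ltrDl.
- move=> g Gg; rewrite /bump lerD2l lerN2 ler_pM2r ?invr_gt0 // => de.
  by apply: near => //; apply: le_lt_trans ed.
move=> g Gg; have [h hh dh] := cover g Gg; exists h => //.
by rewrite /bump lerD2l lerN2 ler_pM2r ?invr_gt0 // ltW.
Qed.

Lemma disp_term w (t : tens w) g : unitary g ->
  hdot (act g w t - t) (act g w t - t) =
  2 * hdot t t - hdot (act g w t) t - (hdot (act g w t) t)^*.
Proof.
by move=> ug; rewrite hdotBl !hdotBr hdot_act // [hdot t (act g w t)]hdotC; ring.
Qed.

(** Expanding one factor of the bump gives a combination of bump^N times phi, phi multiplied by a
    coefficient, or phi multiplied by its conjugate; all three stay in P, so the induction is over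
    all of P. *)
Lemma null_bump (P : ('End(V) -> C) -> Prop) :
  (forall phi, P phi -> null mul Gp phi) ->
  (forall phi j, P phi -> exists2 phi', P phi' & forall g, Gp g ->
    phi' g = phi g * hdot (act g _ (tt j)) (tt j)) ->
  (forall phi j, P phi -> exists2 phi', P phi' & forall g, Gp g ->
    phi' g = phi g * (hdot (act g _ (tt j)) (tt j))^*) ->
  forall N phi, P phi -> null mul Gp (fun g => bump g ^+ N * phi g).
Proof.
move=> Pnull P1 P2; elim=> [|N IH] phi Pphi.
  by apply: (null_ext GM) (Pnull _ Pphi) => g _; rewrite mul1r.
set B := disp_bound tt r.
have mulA : associative mul by move=> f g h; apply: comp_lfunA.
apply: (null_ext GM (phi := fun g => bump g ^+ N * phi g + \sum_(j <- r)
   (- (2 * hdot (tt j) (tt j) / B) * (bump g ^+ N * phi g) +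
   (B^-1 * (bump g ^+ N * (phi g * hdot (act g _ (tt j)) (tt j))) +
    B^-1 * (bump g ^+ N * (phi g * (hdot (act g _ (tt j)) (tt j))^*)))))) => [g Gg|].
  have -> : bump g ^+ N.+1 * phi g =
      bump g ^+ N * phi g + - (B^-1 * (bump g ^+ N * phi g)) * disp tt r g.
    by rewrite exprS {1}/bump -/B; ring.
  congr (_ + _); rewrite /disp mulr_sumr; apply: eq_bigr => j _.
  by rewrite (disp_term _ (Gu Gg)); ring.
have nD phi1 psi1 : null mul Gp phi1 -> null mul Gp psi1 ->
  null mul Gp (fun g => phi1 g + psi1 g).
  exact: nullD.
apply: (nD); first exact: IH.
apply: (null_sum mulA G1 GM) => j.
apply: (nD); first by apply: nullZ; apply: IH.
apply: (nD); apply: nullZ.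
  have [phi' Pphi' e] := P1 phi j Pphi.
  by apply: (null_ext GM) (IH _ Pphi') => g Gg; rewrite e.
have [phi' Pphi' e] := P2 phi j Pphi.
by apply: (null_ext GM) (IH _ Pphi') => g Gg; rewrite e.
Qed.

End UnitaryGroup.

(** * Intertwiners are generated *)

Section PartTwo.
Variables (R : realType) (V : hilbert R).
Local Notation C := (Cplx R).
Local Notation d := (\dim (fullv : {vspace V})).
Local Notation idx := (idx d).
Local Notation tens := (tens V).
Local Notation adjV := (@adj R V V).
Local Notation tent g := (tensor_entry (entry g)).
Local Notation mul := (fun g h : 'End(V) => (g \o h)%VF).
Variable e : d.-tuple V.
Hypothesis he : basis_of fullv e.
Variables (I : Type) (w : I -> seq letter) (T : forall i, tens (w i)).
Local Notation composite := (composite e T).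
Local Notation generated := (generated e T).

Definition insert u (t : tens u) v : 'Hom(tens v, tens (u ++ v)) :=
  linfun (fun y : tens v => tcat t y).

Lemma insertE u (t : tens u) v y : insert t v y = tcat t y.
Proof. by rewrite /insert linfunE //; apply: tcat_linearr. Qed.

Lemma tensor_homE u (t : tens u) (x : tens [::]) : tensor_hom t x = (x : C) *: t.
Proof. by rewrite /tensor_hom linfunE // => a y z; rewrite scalerDl scalerA. Qed.

Lemma insert_front u (t : tens u) v : @front R V [::] u v (tensor_hom t) (insert t v).
Proof.
move=> x z; change (insert t v ((x : C) *: z) = tcat (tensor_hom t x) z).
rewrite linearZ /= insertE tensor_homE.
have lin a : tcat (a *: t) z = a *: tcat t z.
  by rewrite -(linfunE (@tcat_linearl R V u v z)) linearZ /= (linfunE (@tcat_linearl R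
    V u v z)).
by rewrite lin.
Qed.

Lemma composite_insert i v : composite (insert (T i) v).
Proof. by apply: (composite_front (gen_T e T i)); apply: insert_front. Qed.

Lemma composite_insert_adj i v : composite (adj (insert (T i) v)).
Proof.
apply: (@composite_front _ _ _ _ _ _ (w i) [::] v _ _ (gen_T_adj e T i)).
by apply: front_adj; apply: insert_front.
Qed.

Lemma act_insert g u (t : tens u) v : (act g (u ++ v) \o insert t v)%VF =
    (insert (act g u t) v \o act g v)%VF.
Proof. by apply: hom_ext => i; rewrite !comp_lfunE !insertE act_tcat. Qed.

Lemma insert_adj_insert u (t t' : tens u) v :
  (adj (insert t' v) \o insert t v)%VF = hdot t t' *: \1%VF.
Proof.
apply/lfunP => y; rewrite comp_lfunE scale_lfunE id_lfunE insertE.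
apply: hdot_eq => z; rewrite hdotC -adjE insertE hdot_tcat rmorphM /= -!hdotC.
by rewrite hdotZl.
Qed.

Definition conj_act g u v (Y : 'Hom(tens u, tens v)) :=
  (act g v \o Y \o adj (act g u))%VF.

Lemma conj_act_entries g u v (Y : 'Hom(tens u, tens v)) i j : unitary g ->
  hdot (conj_act g Y (bv u j)) (bv v i) =
  \sum_k \sum_l tent g i k * hdot (Y (bv u l)) (bv v k) * (tent g j l)^*.
Proof.
move=> ug; rewrite /conj_act !comp_lfunE act_entries //; apply: eq_bigr => k _.
have -> : adj (act g u) (bv u j) = \sum_l (tent g j l)^* *: bv u l.
  rewrite adj_act // act_bv; last exact: unitary_adj.
  by apply: eq_bigr => l _; rewrite tensor_entry_adj.
rewrite hom_comb hdot_suml mulr_sumr; apply: eq_bigr => l _.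
by rewrite hdotZl [X in _ * X]mulrC mulrA.
Qed.

(** Displays the pairing as a coefficient of g (x) conj(g) on pairs of multi-indices, the shape that
    [null_coefficient_fin] accepts. *)
Lemma hs_conj_act g u v (X Y : 'Hom(tens u, tens v)) : unitary g ->
  hs (conj_act g Y) X = \sum_(a : idx v * idx u) \sum_(b : idx v * idx u)
    (hdot (X (bv u a.2)) (bv v a.1))^* * (tent g a.1 b.1 * (tent g a.2 b.2)^*) *
    hdot (Y (bv u b.2)) (bv v b.1).
Proof.
move=> ug; rewrite hs_entries exchange_big.
rewrite -(pair_bigA _ (fun i j => \sum_(b : idx v * idx u)
    (hdot (X (bv u j)) (bv v i))^* * (tent g i b.1 * (tent g j b.2)^*) *
    hdot (Y (bv u b.2)) (bv v b.1))) /=.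
apply: eq_bigr => i _; apply: eq_bigr => j _.
rewrite conj_act_entries // pair_bigA big_distrl; apply: eq_bigr => b _ /=; ring.
Qed.

Definition orth_gen u v (Y : 'Hom(tens u, tens v)) := forall G, generated G -> hs Y G = 0.

(** An invariant row is, up to conjugation, the matrix of a morphism commuting with U(V). By
    [first_fundamental_theorem] that morphism is generated, hence orthogonal to Y, so the row kills
    the column of Y. *)
Lemma null_conj_act u v (X Y : 'Hom(tens u, tens v)) : orth_gen Y ->
  null mul (@unitary R V) (fun g => hs (conj_act g Y) X).
Proof.
move=> oY.
have GM (g h : 'End(V)) : unitary g -> unitary h ->
  unitary (g \o h)%VF by apply: unitaryM.
have GV (g : 'End(V)) : unitary g -> exists2 h, unitary h & (g \o h)%VF = \1%VF.
  move=> ug; exists (adjV g); first exact: unitary_adj.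
  exact: unitary_adjr.
apply: (null_ext GM) (fun g ug => esym (hs_conj_act X Y ug)) _.
have H := @null_coefficient_fin R 'End(V) mul \1%VF (@unitary R V) (@unitary1 R V) GM GV
  (idx v * idx u)%type (fun g a b => tent g a.1 b.1 * (tent g a.2 b.2)^*) 1.
apply: (H _ _ _ ler01 (fun a => (hdot (X (bv u a.2)) (bv v a.1))^*)
  (fun b => hdot (Y (bv u b.2)) (bv v b.1))).
- move=> [a1 a2] [b1 b2] /=; rewrite !tensor_entry1; try by move=> l i j; apply: entry1.
  by rewrite rmorph_nat -natrM mulnb.
- move=> g h ug uh [a1 a2] [b1 b2] /=.
  rewrite !(tensor_entryM (A := entry (g \o h)%VF) (B := entry g) (D :=
    entry h)) //; try by move=> l i j; apply: entryM.
  rewrite rmorph_sum big_distrlr pair_bigA; apply: eq_bigr => k _ /=.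
  by rewrite rmorphM /=; ring.
- move=> g ug a b; rewrite normrM norm_conjC mulr_ile1 ?tensor_entry_norm //.
move=> p pinv; pose m i j := (p (i, j))^*.
have im : invariant_form m.
  move=> g ug i j; have ug' := unitary_adj ug.
  rewrite /m -(pinv _ ug') rmorph_sum [RHS]pair_bigA; apply: eq_bigr => [[k l]] _ /=.
  by rewrite !tensor_entry_adj !rmorphM /= !conjCK; ring.
have := oY _ (first_fundamental_theorem he T im);
  rewrite hs_entries exchange_big pair_bigA /= => h.
rewrite -[RHS]h; apply: eq_bigr => [[i j]] _ /=.
rewrite hom_ofE hdot_suml (bigD1 i) //= big1 => [|k ki].
  by rewrite addr0 hdotZl hdot_bv eqxx mulr1 /m conjCK mulrC.
by rewrite hdotZl hdot_bv (negPf ki) mulr0.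
Qed.

Lemma conj_act_limit (Fl : set_system 'End(V)) {PF : ProperFilter Fl} h u v
    (X Y : 'Hom(tens u, tens v)) :
  Fl [set g | unitary g] -> unitary h ->
  (forall w (i j : idx w), tends Fl (fun g => tent g i j) (tent h i j)) ->
  tends Fl (fun g => hs (conj_act g Y) X) (hs (conj_act h Y) X).
Proof.
move=> Fu uh th; rewrite hs_conj_act //.
apply: (tends_ext Fu) (fun g ug => esym (hs_conj_act X Y ug)) _.
apply: tends_sum => a; apply: tends_sum => b; apply: tendsM; last exact: tends_cst.
apply: tendsM; first exact: tends_cst.
by apply: tendsM => //; apply: tends_conj.
Qed.

(** Half the harmonic mean lies below both numbers without deciding which is smaller. *)
Lemma pos_below (a b : C) : 0 < a -> 0 < b -> exists2 c, 0 < c & c < a /\ c < b.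
Proof.
move=> a0 b0; have ab : 0 < a + b by rewrite addr_gt0.
exists (a * b / (a + b)); first by rewrite divr_gt0 ?mulr_gt0.
by rewrite !ltr_pdivrMr //; split;
  [rewrite ltr_pM2l // ltrDr|rewrite mulrC ltr_pM2l // ltrDl].
Qed.

(** Here finitely many tensors are extracted from the collection. Were no finite list and radius
    good enough, an ultrafilter of counterexamples would have a limit h fixing every T_i, where psi
    equals k; continuity then contradicts the choice of counterexamples. *)
Lemma near_stabilizer (psi : 'End(V) -> C) (k : C) : 0 < k ->
  (forall (Fl : set_system 'End(V)) h, UltraFilter Fl -> Fl [set g | unitary g] ->
    unitary h ->
    (forall w (i j : idx w), tends Fl (fun g => tent g i j) (tent h i j)) ->
    tends Fl psi (psi h)) ->
  (forall g, stabilizer T g -> psi g = k) ->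
  exists r : seq I, exists2 delta : C, 0 < delta &
    forall g, unitary g -> disp T r g < delta -> k / 2 <= 'Re (psi g).
Proof.
move=> k0 psic psik; apply: contrapT => nex.
pose D := [set x : seq I * C | 0 < x.2].
pose B (x : seq I * C) :=
  [set g : 'End(V) | unitary g /\ disp T x.1 g < x.2 /\ ~ (k / 2 <= 'Re (psi g))].
have FF : Filter (filter_from D B).
  apply: filter_from_filter; first by exists ([::], 1); rewrite /D /=.
  move=> [r1 d1] [r2 d2] /= D1 D2; have [c c0 [c1 c2]] := pos_below D1 D2.
  exists (r1 ++ r2, c) => //= g [ug [dg ng]]; rewrite /disp big_cat /= in dg.
  have n1 := disp_ge0 T r1 g; have n2 := disp_ge0 T r2 g.
  split; split => //; split => //=.
    by apply: lt_trans c1; apply: le_lt_trans dg; rewrite lerDl.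
  by apply: lt_trans c2; apply: le_lt_trans dg; rewrite lerDr.
have PF : ProperFilter (filter_from D B).
  apply: filter_from_proper => [[r delta]] /= d0; apply: contrapT => /nonemptyPn B0.
  apply: nex; exists r, delta => // g ug dg; apply: contrapT => ng.
  have : B (r, delta) g by [].
  by rewrite B0.
have [Fl [UF FB]] := ultraFilterLemma PF.
have PF' : ProperFilter Fl by apply: ultra_proper.
have Fu : Fl [set g | unitary g].
  by apply: FB; exists ([::], 1) => [|g []] //; rewrite /D /=.
have [h uh th] := unitary_limit Fu.
(* Some g has both |g T_i - T_i|^2 and |g T_i - h T_i|^2 below a quarter of eps = |h T_i - T_i|^2,
   against the parallelogram bound. *)
have hK : stabilizer T h.
  split=> // i; apply/eqP; rewrite -subr_eq0 -hdot_eq0; apply/negP => /negP nz.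
  set eps := hdot _ _ in nz.
  have e0 : 0 < eps / 4 by rewrite divr_gt0 // lt_neqAle eq_sym nz hdot_ge0.
  have Fa := @act_limit R V Fl PF' h (w i) (T i) Fu uh (th _) _ e0.
  have Fb : Fl (B ([:: i], eps / 4)) by apply: FB; exists ([:: i], eps / 4).
  have [g [/= ga [_ [gb _]]]] := filter_ex (filterI Fa Fb).
  rewrite subr0 ger0_norm ?hdot_ge0 // in ga.
  rewrite /disp big_seq1 /= in gb.
  have : eps < eps.
    apply: (@le_lt_trans _ _ (2 * (hdot (act g _ (T i) - T i) (act g _ (T i) - T i) +
       hdot (act g _ (T i) - act h _ (T i)) (act g _ (T i) - act h _ (T i))))).
      rewrite /eps (_ : act h _ (T i) - T i =
        (act g _ (T i) - T i) - (act g _ (T i) - act h _ (T i))).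
        exact: parallelogram.
      by rewrite opprB [RHS]addrC addrA subrK.
    have -> : eps = 2 * (eps / 4 + eps / 4) by field.
    by rewrite ltr_pM2l // ltrD.
  by rewrite ltxx.
have tp := psic _ _ UF Fu uh th; rewrite psik // in tp.
have k20 : 0 < k / 2 by rewrite divr_gt0.
have FB0 : Fl (B ([::], 1)) by apply: FB; exists ([::], 1) => //; rewrite /D /=.
have [g [/= pg [_ [_ ng]]]] := filter_ex (filterI (tp _ k20) FB0).
apply: ng; have -> : psi g = k + (psi g - k) by rewrite addrC subrK.
rewrite raddfD /= (Creal_ReP _ (ger0_real (ltW k0))).
have -> : k / 2 = k - k / 2 by field.
rewrite lerD2l; apply: le_trans (Re_norm_ge _).
by rewrite lerN2 ltW.
Qed.

Lemma orth_decomposition u v (F : 'Hom(tens u, tens v)) :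
  exists2 F0, generated F0 & orth_gen (F - F0).
Proof.
have [t tP tE] := hs_frame (@generated0 _ _ e _ _ T u v) (@generatedD _ _ e _ _ T u v).
exists (\sum_(G <- t) hs F G *: G); first exact: generated_sum_seq.
move=> G gG; have linl (X Y Z : 'Hom(tens u,
  tens v)) a : hs (a *: X + Y) Z = a * hs X Z + hs Y Z.
  by rewrite hs_lin.
have hsB (X Y Z : 'Hom(tens u, tens v)) : hs (X - Y) Z = hs X Z - hs Y Z.
  by rewrite addrC -scaleN1r linl mulN1r addrC.
have hs0 (Z : 'Hom(tens u, tens v)) : hs 0 Z = 0.
  by have := hsB Z Z Z; rewrite !subrr.
have hsS (c : 'Hom(tens u, tens v) ->
  C) Z : hs (\sum_(H <- t) c H *: H) Z = \sum_(H <- t) c H * hs H Z.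
  elim: (t) => [|H s IH]; first by rewrite !big_nil hs0.
  by rewrite !big_cons linl IH.
rewrite hsB hsS [X in X - _]hs_herm {1}(tE G gG) hsS rmorph_sum.
apply/eqP; rewrite subr_eq0; apply/eqP; apply: eq_bigr => H _.
by rewrite rmorphM /= -!hs_herm mulrC.
Qed.

Lemma hs_scale_l u v a (X Y : 'Hom(tens u, tens v)) : hs (a *: X) Y = a * hs X Y.
Proof.
rewrite /hs mulr_sumr; apply: eq_bigr => j _.
by rewrite scale_lfunE hdotZl.
Qed.

Lemma hs_scale_r u v a (X Y : 'Hom(tens u, tens v)) : hs X (a *: Y) = a^* * hs X Y.
Proof. by rewrite hs_herm hs_scale_l rmorphM /= -hs_herm. Qed.

Lemma hs_conj_insert_l u v i (X Y : 'Hom(tens u, tens v)) g : unitary g ->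
  hs (conj_act g (insert (T i) v \o Y)%VF) (insert (T i) v \o X)%VF =
  hs (conj_act g Y) X * hdot (act g _ (T i)) (T i).
Proof.
move=> ug; have -> : conj_act g (insert (T i) v \o Y)%VF =
    (insert (act g _ (T i)) v \o conj_act g Y)%VF.
  by rewrite /conj_act !comp_lfunA act_insert.
rewrite -[insert (T i) v]adjK -hs_adjl comp_lfunA insert_adj_insert.
rewrite -comp_lfunZl comp_lfun1l hs_scale_l; exact: mulrC.
Qed.

Lemma hs_conj_insert_r u v i (X Y : 'Hom(tens u, tens v)) g : unitary g ->
  hs (conj_act g (Y \o adj (insert (T i) u))%VF) (X \o adj (insert (T i) u))%VF =
  hs (conj_act g Y) X * (hdot (act g _ (T i)) (T i))^*.
Proof.
move=> ug; have -> : conj_act g (Y \o adj (insert (T i) u))%VF =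
    (conj_act g Y \o adj (insert (act g _ (T i)) u))%VF.
  by rewrite /conj_act -!comp_lfunA -!adj_comp act_insert.
rewrite hs_adjr adjK -comp_lfunA insert_adj_insert.
rewrite -comp_lfunZr comp_lfun1r hs_scale_r; exact: mulrC.
Qed.

Lemma intertwiner_generated u v (F : 'Hom(tens u, tens v)) :
  (forall g, stabilizer T g -> (F \o act g u = act g v \o F)%VF) -> generated F.
Proof.
move=> FK; have [F0 gF0 oF] := orth_decomposition F.
set F1 := F - F0 in oF.
have [F10|F1n0] := eqVneq F1 0.
  by have -> : F = F0 by apply/eqP; rewrite -subr_eq0 -/F1 F10.
exfalso.
have FE : F = F1 + F0 by rewrite /F1 subrK.
have kE : hs F1 F = hs F1 F1.
  rewrite {1}FE hs_herm addrC -[F0]scale1r hs_lin mul1r rmorphD /= -!hs_herm.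
  by rewrite oF // add0r.
pose k := hs F1 F1; have k0 : 0 < k by apply: hs_pos.
(* Pairing with F rather than F1 means that only F has to commute with [K]; by [kE] the value on [K]
   is still the squared norm of F1. *)
pose psi g := hs (conj_act g F1) F.
have psiK g : stabilizer T g -> psi g = k.
  move=> gK; have [ug _] := gK; rewrite /psi /conj_act hs_adjr adjK hs_adjl.
  rewrite FK // comp_lfunA act_adjl // comp_lfun1l; exact: kE.
have [r [delta d0 near]] : exists r : seq I, exists2 delta : C, 0 < delta &
    forall g, unitary g -> disp T r g < delta -> k / 2 <= 'Re (psi g).
  apply: near_stabilizer => // Fl h UF Fu uh th.
  have PF : ProperFilter Fl by apply: ultra_proper.
  exact: conj_act_limit.
pose l := \sum_(a : idx v * idx u) \sum_(b : idx v * idx u)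
   `|hdot (F (bv u a.2)) (bv v a.1)| * `|hdot (F1 (bv u b.2)) (bv v b.1)|.
have psil g : unitary g -> `|psi g| <= l.
  move=> ug; rewrite /psi hs_conj_act //; apply: le_trans (ler_norm_sum _ _ _) _.
  apply: ler_sum => a _; apply: le_trans (ler_norm_sum _ _ _) _.
  apply: ler_sum => b _; rewrite !normrM !norm_conjC ler_wpM2r //.
  by rewrite ler_piMr // mulr_ile1 ?tensor_entry_norm.
have GM (g h : 'End(V)) : unitary g -> unitary h ->
  unitary (g \o h)%VF by apply: unitaryM.
have GA (g : 'End(V)) : unitary g -> unitary (adjV g) by apply: unitary_adj.
apply: (@bump_not_null_disp R V (@unitary R V) _ (@unitary1 R V) GM GA I w T r psi l (k
  / 2) delta) => //.
  by rewrite divr_gt0.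
move=> N.
(* The words u, v are left free because each multiplication by a coefficient of T_i lengthens one of
   them: the target for the coefficient, the source for its conjugate. *)
pose P (phi : 'End(V) -> C) := exists u v (X Y : 'Hom(tens u, tens v)),
  orth_gen Y /\ phi = fun g => hs (conj_act g Y) X.
apply: (@null_bump R V (@unitary R V) _ (@unitary1 R V) GM I w T r P) => //.
- by move=> phi [u1 [v1 [X [Y [oY ->]]]]]; apply: null_conj_act.
- move=> phi i [u1 [v1 [X [Y [oY ->]]]]].
  exists (fun g => hs (conj_act g (insert (T i) v1 \o Y)%VF) (insert (T i) v1 \o X)%VF).
    exists u1, (w i ++ v1), (insert (T i) v1 \o X)%VF, (insert (T i) v1 \o Y)%VF;
      split => // G gG.
    rewrite hs_adjl; apply: oY; apply: generated_comp_l => //;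
      exact: composite_insert_adj.
  by move=> g ug; apply: hs_conj_insert_l.
- move=> phi i [u1 [v1 [X [Y [oY ->]]]]].
  exists (fun g => hs (conj_act g (Y \o adj (insert (T i) u1))%VF) (X \o adj (insert (T
    i) u1))%VF).
    exists (w i ++ u1), v1, (X \o adj (insert (T i) u1))%VF,
      (Y \o adj (insert (T i) u1))%VF; split => // G gG.
    rewrite hs_adjr adjK; apply: oY; apply: generated_comp_r => //;
      exact: composite_insert.
  by move=> g ug; apply: hs_conj_insert_r.
by exists u, v, F, F1; split.
Qed.

End PartTwo.

(** * Irreducible representations occur in tensor words *)

Section Stabilizer.
Variables (R : realType) (V : hilbert R).
Local Notation adjV := (@adj R V V).
Variables (I : Type) (w : I -> seq letter) (T : forall i, tens V (w i)).
Local Notation K := (stabilizer T).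

Lemma stabilizer_unitary g : K g -> unitary g. Proof. by case. Qed.

Lemma stabilizer1 : K \1%VF.
Proof. by split=> [|i]; [exact: unitary1|rewrite act1 id_lfunE]. Qed.

Lemma stabilizerM g h : K g -> K h -> K (g \o h)%VF.
Proof.
move=> [ug gT] [uh hT]; split=> [|i]; first exact: unitaryM.
by rewrite actM // comp_lfunE hT.
Qed.

Lemma stabilizer_adj g : K g -> K (adjV g).
Proof.
move=> [ug gT]; split=> [|i]; first exact: unitary_adj.
by rewrite -{1}(gT i) -comp_lfunE -actM ?unitary_adjl ?act1 ?id_lfunE //;
  apply: unitary_adj.
Qed.

End Stabilizer.

(** * Topology of endomorphism spaces *)

Section InitialMatrixTopology.
Variables (R : realType) (m n : nat).
Local Notation C := (Cplx R).

Lemma mx_nbhs_norm (M : 'M[C]_(m, n)) (D : set 'M[C]_(m, n)) :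
  nbhs M D <-> exists2 eps : C, 0 < eps &
    forall N : 'M[C]_(m, n), (forall i j, `|M i j - N i j| < eps) -> D N.
Proof.
split=> [/nbhs_ballP[eps /= e0 eD]|[eps e0 eD]].
  by exists eps => // N MN; apply: eD; split.
by apply/nbhs_ballP; exists eps => //= N [_ MN]; apply: eD.
Qed.

Lemma initial_mx_nbhs (S : choiceType) (f : S -> 'M[C]_(m, n)) (g : S) (A : set S) :
  nbhs (g : initial_topology f) A <-> exists2 eps : C, 0 < eps &
    forall h : S, (forall i j, `|f g i j - f h i j| < eps) -> A h.
Proof.
split.
  rewrite nbhsE => -[B [[D oD DB] Bg] BA].
  have Dg : D (f g) by rewrite -DB in Bg.
  have /mx_nbhs_norm[eps e0 eD] : nbhs (f g) D by apply: open_nbhs_nbhs.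
  by exists eps => // h gh; apply: BA; rewrite -DB; apply: eD.
move=> [eps e0 eA].
have nD : nbhs (f g) [set N | forall i j, `|f g i j - N i j| < eps].
  by apply/mx_nbhs_norm; exists eps.
have nb := @initial_continuous _ _ f g _ nD.
by apply: (@filterS _ (nbhs (g : initial_topology f)) _ _ _ _ nb).
Qed.

End InitialMatrixTopology.

Lemma term_le_sum (R : numDomainType) (J : finType) (F : J -> R) (j : J) :
  (forall i, 0 <= F i) -> F j <= \sum_i F i.
Proof. by move=> F0; rewrite (bigD1 j) // lerDl sumr_ge0. Qed.

Section PartOne.
Variables (R : realType) (V : hilbert R).
Local Notation C := (Cplx R).
Local Notation d := (\dim (fullv : {vspace V})).
Local Notation idx := (idx d).
Local Notation tens := (tens V).
Local Notation adjV := (@adj R V V).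
Local Notation tent g := (tensor_entry (entry g)).
Local Notation mul := (fun g h : 'End(V) => (g \o h)%VF).

Variable K : set 'End(V).
Hypothesis Ku : forall g, K g -> unitary g.
Hypothesis K1 : K \1%VF.
Hypothesis KM : forall g h, K g -> K h -> K (g \o h)%VF.
Hypothesis KA : forall g, K g -> K (adjV g).

Variables (W : vectType C) (rho : 'End(V) -> 'End(W)).
Hypothesis rep : representation K rho.
Local Notation n := (\dim (fullv : {vspace W})).
Local Notation vb := (vbasis (fullv : {vspace W})).

Definition rep_entry g (i j : 'I_n) : C := coord vb i (rho g vb`_j).

Lemma coord_sum (x : W) : x = \sum_(i < n) coord vb i x *: vb`_i.
Proof. by apply: coord_vbasis; rewrite memvf. Qed.

Lemma coord_vb (i j : 'I_n) : coord vb i vb`_j = (i == j)%:R.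
Proof. by rewrite coord_free ?(basis_free (vbasisP _)) // eq_sym. Qed.

Lemma rho_vb g (j : 'I_n) : rho g vb`_j = \sum_i rep_entry g i j *: vb`_i.
Proof. exact: coord_sum. Qed.

Lemma rep_entry1 i j : rep_entry \1%VF i j = (i == j)%:R.
Proof. by rewrite /rep_entry; case: rep => -> _ _; rewrite id_lfunE coord_vb. Qed.

Lemma rep_entryM g h i j : K g -> K h ->
  rep_entry (g \o h)%VF i j = \sum_k rep_entry g i k * rep_entry h k j.
Proof.
move=> Kg Kh; rewrite {1}/rep_entry; case: rep => _ -> // _.
rewrite comp_lfunE rho_vb !linear_sum; apply: eq_bigr => k _.
by rewrite !linearZ /= mulrC.
Qed.

Definition std_vec (i : 'I_d) : tens [:: std] := bv [:: std] ((i, tt) : idx [:: std]).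

Local Notation sdisp g := (disp std_vec (index_enum 'I_d) g).


Lemma sdisp_entry g (i j : 'I_d) : unitary g ->
  `|entry g std i j - (i == j)%:R| ^+ 2 <= sdisp g.
Proof.
move=> ug; rewrite /disp (bigD1 j) //.
apply: (@le_trans _ _ (hdot (act g [:: std] (std_vec j) - std_vec j) (act g [:: std]
  (std_vec j) - std_vec j))); last first.
  by rewrite lerDl; apply: sumr_ge0 => k _; apply: hdot_ge0.
rewrite sqnorm_entries (bigD1 ((i, tt) : idx [:: std])) //.
rewrite hdotBl hdot_act_bv // hdot_bv [tensor_entry _ _ _]mulr1 xpair_eqE andbT [j ==
  i]eq_sym lerDl.
by apply: sumr_ge0 => k _; rewrite exprn_ge0.
Qed.

Lemma mxofE (X : vectType C) (g : 'End(X)) i j :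
  passmx.mxof (vbasis {:X}) (vbasis {:X}) g i j =
    coord (vbasis {:X}) j (g (vbasis {:X})`_i).
Proof.
rewrite /passmx.mxof mxE /= /passmx.rVof mxE /passmx.vecof.
congr (coord _ _ (g _)).
rewrite (bigD1 i) //= big1 => [|k ki]; first by rewrite mxE !eqxx scale1r addr0.
by rewrite mxE (negPf ki) scale0r.
Qed.

Lemma End_top_nbhs (X : vectType C) (g : 'End(X)) (A : set 'End(X)) :
  nbhs (g : End_top X) A <-> exists2 eps : C, 0 < eps &
    forall h : 'End(X), (forall i j, `|passmx.mxof (vbasis {:X}) (vbasis {:X}) g i j -
      passmx.mxof (vbasis {:X}) (vbasis {:X}) h i j| < eps) -> A h.
Proof. exact: initial_mx_nbhs. Qed.

Lemma rep_entry_continuous (eps : C) : 0 < eps -> exists2 delta : C, 0 < delta &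
  forall g, K g -> sdisp g < delta -> forall i j, `|rep_entry g i j - (i == j)%:R| < eps.
Proof.
move=> e0.
have cr : {within (K : set (End_top V)), continuous (rho : End_top V ->
  End_top W)} by case: rep.
have /(_ _ K1) := (@subspace_continuousP _ (K : set (End_top V)) (End_top W) rho).1 cr.
set A := [set h : 'End(W) | forall i j : 'I_n,
  `|coord vb i (h vb`_j) - (i == j)%:R| < eps].
have nA : nbhs (rho \1%VF : End_top W) A.
  apply/End_top_nbhs; exists eps => // h hE i j.
  have := hE j i; rewrite !mxofE distrC.
  have -> : coord vb i (rho \1%VF vb`_j) = (i == j)%:R by apply: rep_entry1.
  by [].
move=> /(_ A nA) /End_top_nbhs[eta eta0 nbE].
pose vV := vbasis {:V}.
pose c i j k l := `|hdot vV`_i (onb V)`_l| * `|coord vV j (onb V)`_k|.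
(* Bounds the passage from the orthonormal basis, in which displacement is measured, to [vbasis],
   which defines the topology; the leading 1 keeps it positive. *)
pose M := 1 + \sum_(i < d) \sum_(j < d) \sum_(k < d) \sum_(l < d) c i j k l.
have c0 i j k l : 0 <= c i j k l by rewrite mulr_ge0.
have M0 : 0 < M by rewrite ltr_wpDr // !sumr_ge0 // => i _;
  rewrite !sumr_ge0 // => j _; rewrite !sumr_ge0 // => k _; rewrite sumr_ge0.
exists ((eta / M) ^+ 2) => [|g Kg dg]; first by rewrite exprn_gt0 // divr_gt0.
have ug := Ku Kg.
have ent k l : `|entry g std k l - (k == l)%:R| <= eta / M.
  rewrite -(ler_pXn2r (n := 2)) ?nnegrE ?normr_ge0 ?divr_ge0 ?(ltW eta0) ?(ltW M0) //.
  by apply: le_trans (ltW dg); apply: sdisp_entry.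
suff : A (rho g) by [].
apply: nbE => // i j; rewrite !mxofE id_lfunE -/vV.
have exp x : g x - x = \sum_(l < d) \sum_(k < d)
    (hdot x (onb V)`_l * (entry g std k l - (k == l)%:R)) *: (onb V)`_k.
  rewrite {1 2}(onb_sum x) linear_sum -sumrB; apply: eq_bigr => l _.
  rewrite linearZ /= -scalerBr; under eq_bigr do rewrite -scalerA.
  rewrite -scaler_sumr; congr (_ *: _).
  under eq_bigr do rewrite scalerBl.
  rewrite sumrB {1}(onb_sum (g (onb V)`_l)); congr (_ - _).
  rewrite (bigD1 l) //= eqxx scale1r big1 ?addr0 // => k kl.
  by rewrite (negPf kl) scale0r.
rewrite distrC -linearB exp linear_sum.
apply: (@le_lt_trans _ _ (\sum_(l < d) \sum_(k < d) c i j k l * (eta / M))).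
  apply: le_trans (ler_norm_sum _ _ _) _; apply: ler_sum => l _.
  rewrite linear_sum; apply: le_trans (ler_norm_sum _ _ _) _; apply: ler_sum => k _.
  rewrite linearZ /= !normrM mulrAC; apply: ler_pM => //;
    [by rewrite mulr_ge0|exact: ent].
have -> : \sum_(l < d) \sum_(k < d) c i j k l * (eta / M) =
    (\sum_(k < d) \sum_(l < d) c i j k l) * (eta / M).
  rewrite exchange_big mulr_suml; apply: eq_bigr => k _; by rewrite mulr_suml.
rewrite mulrA ltr_pdivrMr // mulrC ltr_pM2l //.
apply: (@le_lt_trans _ _ (M - 1)); last by rewrite ltrBlDr ltrDl.
rewrite /M addrAC subrr add0r.
apply: (@le_trans _ _ (\sum_(j < d) \sum_(k < d) \sum_(l < d) c i j k l)).
  apply: (term_le_sum (F := fun j : 'I_d => \sum_(k < d) \sum_(l < d) c i j k l)) => j'.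
  by rewrite sumr_ge0 // => k _; rewrite sumr_ge0.
apply: (term_le_sum (F := fun i : 'I_d =>
  \sum_(j < d) \sum_(k < d) \sum_(l < d) c i j k l)) => i'.
by rewrite sumr_ge0 // => j' _; rewrite sumr_ge0 // => k _; rewrite sumr_ge0.
Qed.

(** Near the identity the entries have modulus at most 2, and finitely many translates of that
    neighbourhood cover [K]; g = h^* (h g) then bounds them everywhere. *)
Lemma rep_entry_bounded : exists2 c : C, 0 <= c & forall g, K g ->
    forall i j, `|rep_entry g i j| <= c.
Proof.
have [delta d0 dP] := rep_entry_continuous ltr01.
have [hs hsK cover] := disp_cover std_vec (index_enum 'I_d) Ku KA d0.
pose c := \sum_(h <- hs) \sum_(i < n) \sum_(k < n) 2 * `|rep_entry (adjV h) i k|.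
have t0 h i k : 0 <= 2 * `|rep_entry (adjV h) i k| by rewrite mulr_ge0.
exists c => [|g Kg i j].
  by rewrite sumr_ge0 // => h _; rewrite sumr_ge0 // => i _; rewrite sumr_ge0.
have [h hh dh] := cover g Kg; have Kh := hsK _ hh.
have Khg := KM Kh Kg.
have -> : g = (adjV h \o (h \o g))%VF.
  by rewrite comp_lfunA unitary_adjl ?comp_lfun1l //; apply: Ku.
rewrite rep_entryM //; last exact: KA.
apply: le_trans (ler_norm_sum _ _ _) _.
apply: (@le_trans _ _ (\sum_(k < n) 2 * `|rep_entry (adjV h) i k|)).
  apply: ler_sum => k _; rewrite normrM mulrC ler_wpM2r //.
  have := dP _ Khg dh k j; set x := rep_entry _ k j => lx.
  have -> : x = (x - (k == j)%:R) + (k == j)%:R by rewrite subrK.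
  apply: le_trans (ler_normD _ _) _; rewrite -[2]/(1 + 1) lerD ?(ltW lx) //.
  by case: (k == j); rewrite ?normr1 ?normr0.
apply: (@le_trans _ _ (\sum_(i' < n) \sum_(k < n) 2 * `|rep_entry (adjV h) i' k|)).
  apply: (term_le_sum (F := fun i' => \sum_(k < n) 2 * `|rep_entry (adjV h) i' k|)) => i'.
  by rewrite sumr_ge0.
rewrite /c (big_rem h) // lerDl sumr_ge0 // => h' _.
by rewrite sumr_ge0 // => i' _; rewrite sumr_ge0.
Qed.

Definition row_hom w (p : idx w * 'I_n -> C) : 'Hom(W, tens w) :=
  linfun (fun x => \sum_(a : idx w * 'I_n) (p a * coord vb a.2 x) *: bv w a.1).

Lemma row_homE w p x : row_hom p x =
    \sum_(a : idx w * 'I_n) (p a * coord vb a.2 x) *: bv w a.1.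
Proof.
rewrite /row_hom linfunE // => b y z; rewrite scaler_sumr -big_split.
by apply: eq_bigr => a _; rewrite /= linearP scalerA -scalerDl mulrDr mulrCA.
Qed.

Lemma row_hom_vb w p (l : 'I_n) : row_hom p vb`_l = \sum_(i : idx w) p (i, l) *: bv w i.
Proof.
rewrite row_homE.
transitivity (\sum_(i : idx w) \sum_(k < n) (p (i, k) * coord vb k vb`_l) *: bv w i).
  by rewrite pair_bigA; apply: eq_bigr => -[].
apply: eq_bigr => i _; rewrite (bigD1 l) //= coord_vb eqxx mulr1 big1 ?addr0 // => k kl.
by rewrite coord_vb (negPf kl) mulr0 scale0r.
Qed.

Lemma hom_vb_ext (Z : vectType C) (F G : 'Hom(W, Z)) :
  (forall l : 'I_n, F vb`_l = G vb`_l) -> F = G.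
Proof.
move=> FG; apply/lfunP => x; rewrite (coord_sum x) !linear_sum.
by apply: eq_bigr => l _; rewrite !linearZ /= FG.
Qed.

(** Invariance of p says g^* F rho(g) = F for F = [row_hom p]; composing with g on the left cancels
    g^*. *)
Lemma row_hom_intertwiner w (p : idx w * 'I_n -> C) :
  (forall g, K g -> forall b, \sum_a p a * ((tent g a.1 b.1)^* * rep_entry g a.2 b.2) =
    p b) ->
  intertwiner K rho (fun g => act g w) (row_hom p).
Proof.
move=> pinv g Kg; have ug := Ku Kg; have ug' := unitary_adj ug.
suff H : (act (adjV g) w \o (row_hom p \o rho g))%VF = row_hom p.
  by rewrite -[in RHS]H !comp_lfunA -actM // unitary_adjr // act1 comp_lfun1l.
apply: hom_vb_ext => l; rewrite row_hom_vb !comp_lfunE row_homE linear_sum.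
under eq_bigr => a _.
  rewrite linearZ /= act_bv // scaler_sumr; under eq_bigr do rewrite scalerA.
  over.
rewrite exchange_big; apply: eq_bigr => j _ /=; rewrite -scaler_suml; congr (_ *: _).
rewrite -(pinv g Kg); apply: eq_bigr => a _ /=.
by rewrite tensor_entry_adj -/(rep_entry g a.2 l) -mulrA [X in _ * X]mulrC.
Qed.

Hypothesis irr : irreducible K rho.

Lemma intertwiner_ker (W' : vectType C) (rho' : 'End(V) -> 'End(W')) (F : 'Hom(W, W')) :
  intertwiner K rho rho' F -> F != 0 -> lker F = 0%VS.
Proof.
move=> iF F0; have [|//|kf] := irr.2 (lker F).
  move=> g Kg; apply/subvP => _ /memv_imgP[x xk ->].
  rewrite memv_ker -comp_lfunE iF // comp_lfunE.
  by move: xk; rewrite memv_ker => /eqP->; rewrite linear0.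
case/eqP: F0; apply/lfunP => x; rewrite lfunE.
by apply/eqP; rewrite -memv_ker kf memvf.
Qed.

(** The assumption that [rho] occurs in no tensor word, put in the form required by
    [null_coefficient_fin]: a nonzero invariant row would be a nonzero intertwiner. *)
Definition trivial_rows := forall w (p : idx w * 'I_n -> C),
  (forall g, K g -> forall b, \sum_a p a * ((tent g a.1 b.1)^* * rep_entry g a.2 b.2) =
    p b) ->
  forall b, p b = 0.

Lemma null_tensor_rep w (I J : idx w) (k l : 'I_n) : trivial_rows ->
  null mul K (fun g => (tent g I J)^* * rep_entry g k l).
Proof.
move=> tr; have [c c0 cP] := rep_entry_bounded.
have KV (g : 'End(V)) : K g -> exists2 h, K h & (g \o h)%VF = \1%VF.
  by move=> Kg; exists (adjV g); [exact: KA|apply: unitary_adjr; apply: Ku].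
have := @null_coefficient_fin R 'End(V) mul \1%VF K K1 KM KV
  (idx w * 'I_n)%type (fun g a b => (tent g a.1 b.1)^* * rep_entry g a.2 b.2) c.
move=> /(_ _ _ _ c0 (fun a => (a == (I, k))%:R) (fun b => (b == (J, l))%:R)) H.
apply: null_ext (H _ _ _ _) => //.
- move=> g Kg; rewrite (bigD1 (I, k)) //= (bigD1 (J, l)) //= !eqxx mul1r mulr1.
  rewrite !big1 ?addr0 // => [a /negPf->|b /negPf->]; last by rewrite mulr0.
  by rewrite big1 // => b _; rewrite !mul0r.
- move=> [a1 a2] [b1 b2] /=; rewrite tensor_entry1; last by move=> ? ? ?; apply: entry1.
  by rewrite rep_entry1 rmorph_nat -natrM mulnb.
- move=> g h Kg Kh [a1 a2] [b1 b2] /=.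
  rewrite (tensor_entryM (A := entry (g \o h)%VF) (B := entry g) (D :=
    entry h)); last by move=> ? ? ?; apply: entryM.
  rewrite rep_entryM // rmorph_sum big_distrlr pair_bigA; apply: eq_bigr => q _ /=.
  by rewrite rmorphM /=; ring.
- move=> g Kg a b; rewrite normrM norm_conjC -[c]mul1r ler_pM //.
    by rewrite tensor_entry_norm //; apply: Ku.
  exact: cP.
by move=> p /tr p0; rewrite big1 // => b _; rewrite p0 mul0r.
Qed.

Lemma nontrivial_rows : ~ trivial_rows.
Proof.
move=> tr; have [c c0 cP] := rep_entry_bounded.
have n0 : (0 < n)%N by rewrite lt0n dimv_eq0; case: irr.
(* With each diagonal entry within 1 / (2 n) of 1, the real part of the trace is at least n - 1/2,
   hence at least 1/2 because n >= 1. *)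
have e0 : 0 < (2 * n%:R)^-1 :> C by rewrite invr_gt0 mulr_gt0 // ltr0n.
have [delta d0 dP] := rep_entry_continuous e0.
pose psi g := \sum_(k < n) rep_entry g k k.
apply: (@bump_not_null_disp R V K Ku K1 KM KA 'I_d (fun=> [:: std]) std_vec (index_enum
  'I_d)
  psi (n%:R * c) 2^-1 delta) => //.
- move=> g Kg; apply: le_trans (ler_norm_sum _ _ _) _.
  rewrite mulr_natl -[X in _ *+ X](card_ord n) -sumr_const; apply: ler_sum => k _;
    exact: cP.
- by rewrite invr_gt0 ltr0n.
- move=> g Kg dg; have -> : psi g = n%:R + \sum_(k < n) (rep_entry g k k - 1).
    by rewrite sumrB sumr_const card_ord addrC subrK.
  rewrite raddfD /= (Creal_ReP _ (ger0_real (ler0n _ _))).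
  apply: (@le_trans _ _ (n%:R - 2^-1)).
    rewrite lerBrDr -mulr2n -[_ *+ 2]mulr_natr mulVf ?pnatr_eq0 //.
    by rewrite -[1]/(1%:R) ler_nat.
  rewrite lerD2l; apply: le_trans (Re_norm_ge _); rewrite lerN2.
  apply: le_trans (ler_norm_sum _ _ _) _.
  apply: (@le_trans _ _ (\sum_(k < n) (2 * n%:R)^-1)).
    by apply: ler_sum => k _; apply: ltW; have := dP g Kg dg k k; rewrite eqxx.
  by rewrite sumr_const card_ord -[_^-1 *+ _]mulr_natr invfM -mulrA mulVf ?mulr1 //
    pnatr_eq0 -lt0n.
move=> N.
have mulA : associative mul by move=> f g h; apply: comp_lfunA.
apply: (null_ext KM (phi := fun g => \sum_(k <- index_enum 'I_n)
   bump std_vec (index_enum 'I_d) g ^+ N * rep_entry g k k)).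
  by move=> g Kg; rewrite mulr_sumr.
apply: (null_sum mulA K1 KM) => k.
pose P (phi : 'End(V) -> C) := exists w (I J : idx w) k l,
  phi = fun g => (tent g I J)^* * rep_entry g k l.
apply: (@null_bump R V K Ku K1 KM 'I_d (fun=> [:: std]) std_vec (index_enum 'I_d) P) =>
  //.
- by move=> phi [w [I [J [k' [l ->]]]]]; apply: null_tensor_rep.
- move=> phi i [w [I [J [k' [l ->]]]]].
  (* The conjugate of an entry on [dual] is the entry on [std], so prefixing [dual] multiplies by
     the coefficient itself; prefixing [std] does so by its conjugate. *)
  exists (fun g => (@tensor_entry _ _ (entry g) (dual :: w) (i, I) (i,
    J))^* * rep_entry g k' l).
    by exists (dual :: w), (i, I), (i, J), k', l.
  move=> g Kg; rewrite hdot_act_bv; last exact: Ku.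
  by rewrite /= mulr1 rmorphM /= conjCK; ring.
- move=> phi i [w [I [J [k' [l ->]]]]].
  exists (fun g => (@tensor_entry _ _ (entry g) (std :: w) (i, I) (i,
    J))^* * rep_entry g k' l).
    by exists (std :: w), (i, I), (i, J), k', l.
  move=> g Kg; rewrite hdot_act_bv; last exact: Ku.
  by rewrite /= mulr1 rmorphM /=; ring.
exists [::], tt, tt, k, k; apply: functional_extensionality_dep => g.
by rewrite /= rmorph1 mul1r.
Qed.

Lemma irreducible_subrepresentation : exists w,
    subrepresentation K rho (fun g => act g w).
Proof.
apply: contrapT => nex; apply: nontrivial_rows => w p pinv [i l].
have iF := row_hom_intertwiner pinv.
have [F0|F0] := eqVneq (row_hom p) 0; last first.
  by exfalso; apply: nex; exists w, (row_hom p); [exact: (intertwiner_ker iF)|].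
have := row_hom_vb p l; rewrite F0 lfunE /= => /esym s0.
have := congr1 (fun x => hdot x (bv w i)) s0; rewrite hdot_suml.
rewrite (bigD1 i) //= hdotZl hdot_bv eqxx mulr1 big1 => [|j ji].
  by rewrite addr0 => ->; rewrite linear0l.
by rewrite hdotZl hdot_bv (negPf ji) mulr0.
Qed.

End PartOne.

Theorem theorem2p1 (R : realType) (V : hilbert R)
    (I : Type) (m n : I -> nat)
    (T : forall i : I, tens V (nseq (m i) dual ++ nseq (n i) std))
    (e : (\dim (fullv : {vspace V})).-tuple V) (he : basis_of fullv e) :
  let K := stabilizer T in
  (forall (W : vectType (Cplx R)) (rho : 'End(V) -> 'End(W)),
     representation K rho -> irreducible K rho ->
     exists w : seq letter, subrepresentation K rho (fun g => act g w)) /\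
  (forall (u v : seq letter) (F : 'Hom(tens V u, tens V v)),
     intertwiner K (fun g => act g u) (fun g => act g v) F ->
     generated e T F).
Proof.
split=> [W rho rep irr|u v F].
  apply: irreducible_subrepresentation rep irr.
  - exact: stabilizer_unitary.
  - exact: stabilizer1.
  - exact: stabilizerM.
  - exact: stabilizer_adj.
exact: intertwiner_generated.
Qed.
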